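(* Let $a$ satisfy $\bigl|1-e^{-2\pi i a}\bigr|>1$ (which is the case, for example, when $a\in\bigl(\frac16,\frac56\bigr)$), let $s\in\mathbb{C}$, and let $|z|>1$ with $z$ in the sector $|\arg(1+z)|\le\pi$. Put $$x=\frac12-\frac{\ln z}{2\pi i},\qquad B(z,s,a)=z^{-a}\int_{-(1+i)\infty}^{(0+)}e^{t\ln z}\,t^{-s}\,\frac{i}{2\sin\pi(t-a)}\,dt,\qquad p_n(x,s)=\int_{\infty}^{(0+)}e^{-x\tau}\tau^{-s}\bigl(1-e^{-\tau}\bigr)^n\,d\tau .$$ Then $$B(z,s,a)=\frac{e^{\pi i a}(2\pi i)^{s-1}}{z^{a}}\sum_{n=0}^{\infty}\frac{e^{2\pi i a n}}{\bigl(e^{2\pi i a}-1\bigr)^{n+1}}\,p_n(x,s),$$ the series being convergent.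
   Context: The sector $|\arg(1+z)|\le\pi$ is closed: both sides of the cut $z\in(-\infty,-1)$ are included, with $\arg z=\pi$ on the upper side and $\arg z=-\pi$ on the lower side. $\ln z=\ln|z|+i\arg z$ with $-\pi\le\arg z\le\pi$, $z^a=e^{a\ln z}$, and $(2\pi i)^{s-1}$ takes its principal value. The integral for $B$ is written for $0<a<1$, and $B$ is extended to other values of $a$ by analytic continuation in $a$. Its loop contour begins at infinity in the direction $-(1+i)$, circles $t=0$ once in the positive direction without enclosing any pole $t=a+k$, $k\in\mathbb{Z}$, of the integrand, and returns to infinity in the direction $-(1+i)$; $t^{-s}$ is continuous along the contour, with $\arg t$ running from $-\frac{3\pi}{4}$ to $\frac{5\pi}{4}$. The integral for $p_n$ is over a loop contour that begins at $+\infty$, circles $\tau=0$ once in the positive direction without enclosing any other singularity, and returns to $+\infty$, with $\arg\tau$ running from $0$ to $2\pi$. Equivalently, $$p_n(x,s)=\frac{-2\pi i\,e^{-\pi i s}}{\Gamma(s)}\sum_{m=0}^n\binom{n}{m}(-1)^m(x+m)^{s-1},$$ which also gives the meaning of $p_n(x,s)$ on the boundary $\arg z=\pi$, where $\operatorname{Re}x=0$. For $0<a<1$, $B(z,s,a)$ is the branch-point contribution at $t=-a$ when the contour $L$ (from $-i\infty$ to $i\infty$, crossing the real axis in $(-a,0)$) of the Mellin–Barnes integral $\Phi(-z,s,a)=\frac{1}{2\pi i}\int_L\frac{\Gamma(1+t)\Gamma(-t)z^t}{(a+t)^s}\,dt$ is pushed to the left. Here $\Phi$ is the Lerch transcendent,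 $\Phi(z,s,a)=\sum_{n\ge0}z^n(a+n)^{-s}$ for $|z|<1$, continued analytically in $z$. *)

(* Defs.v *)
From Stdlib Require Export Reals Factorial ClassicalEpsilon.
From Coquelicot Require Export Coquelicot.
Open Scope R_scope.
Open Scope C_scope.

(* [Coquelicot] has no complex exponential, logarithm, sine or Gamma function. *)

Definition Cexp (w : C) : C :=
  ((exp (Re w) * cos (Im w))%R, (exp (Re w) * sin (Im w))%R).

Definition Csin (w : C) : C :=
  (Cexp (Ci * w) - Cexp (- (Ci * w))) / (2 * Ci).

(* Principal argument, in (-PI, PI], for w <> 0. *)
Definition Carg (w : C) : R :=
  if Rle_dec 0 (Im w) then acos (Re w / Cmod w)
  else (- acos (Re w / Cmod w))%R.

Definition Clog (w : C) : C := (ln (Cmod w), Carg w).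

Definition Cpow_principal (w b : C) : C := Cexp (b * Clog w).

Definition polar (rho phi : R) : C := ((rho * cos phi)%R, (rho * sin phi)%R).

(* A point of the closed sector is a complex number z together with the choice
   [theta] of its argument: for z on the negative real axis, [theta = PI] is the
   upper side of the cut and [theta = - PI] the lower side. *)
Definition in_closed_sector (z : C) (theta : R) : Prop :=
  (- PI <= theta <= PI)%R /\ z = polar (Cmod z) theta.

Definition lnz (z : C) (theta : R) : C := (ln (Cmod z), theta).

Definition zpow (z : C) (theta : R) (b : C) : C := Cexp (b * lnz z theta).

(* Integral of t^(-s) g(t) dt over the loop that comes from infinity along the
   ray arg t = alpha, runs once counterclockwise around the circle |t| = delta
   and returns to infinity along the same ray, now with arg t = alpha + 2 PI.
   The power t^(-s) is taken with this continuous argument. *)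
Definition loop_integral (s : C) (g : C -> C) (alpha delta : R) : C :=
  let f (rho phi : R) : C :=
    Cexp (- s * (ln rho, phi)) * g (polar rho phi) in
  let ray (phi : R) : C :=
    RInt_gen (V := C_R_CompleteNormedModule)
      (fun rho : R => f rho phi * polar 1 phi)
      (at_point delta) (Rbar_locally p_infty) in
  - ray alpha
  + RInt (V := C_R_CompleteNormedModule)
      (fun phi : R => f delta phi * (Ci * polar delta phi))
      alpha (alpha + 2 * PI)%R
  + ray (alpha + 2 * PI)%R.

(* The poles a + k nearest to 0 are a and a - 1, so that the circle of the
   loop encloses none of them; the ray only meets the real axis at 0. *)
Definition B_integral (z : C) (theta : R) (s : C) (a : R) : C :=
  zpow z theta (- a) *
  loop_integral s
    (fun t => Cexp (t * lnz z theta) * (Ci / (2 * Csin (PI * (t - a)))))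
    (- (3 * PI / 4))%R (Rmin a (1 - a) / 2)%R.

Definition analytic_on (D : C -> Prop) (f : C -> C) : Prop :=
  forall a0 : C, D a0 ->
    exists (c : nat -> C) (r : R), (0 < r)%R /\
      forall a : C, (Cmod (a - a0) < r)%R ->
        is_pseries (K := C_AbsRing) (V := C_NormedModule) c (a - a0) (f a).

(* The function analytic on D that coincides with f0 on D and (0,1); it is
   unique when D is open, connected and meets (0,1). *)
Definition continuation (D : C -> Prop) (f0 : R -> C) : C -> C :=
  epsilon (inhabits (fun _ : C => RtoC 0))
    (fun f : C -> C => analytic_on D f /\
       forall r : R, (0 < r < 1)%R -> D (RtoC r) -> f (RtoC r) = f0 r).

(* Writing a = u + i v, this is the set exp (2 PI v) > 2 cos (2 PI u): the part
   of the plane above a graph, hence simply connected.  It meets the real axis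
   in the intervals (k + 1/6, k + 5/6) and contains no integer. *)
Definition region (a : C) : Prop :=
  (1 < Cmod (1 - Cexp (- (2 * PI * Ci * a))))%R.

(* The analytic continuation of B in a branches at the integers.  [region]
   avoids them, and being simply connected it determines a single-valued
   continuation from its interval (1/6, 5/6). *)
Definition B (z : C) (theta : R) (s a : C) : C :=
  if excluded_middle_informative ((0 < Re a < 1)%R /\ Im a = 0%R)
  then B_integral z theta s (Re a)
  else continuation region (B_integral z theta s) a.

Fixpoint rising (s : C) (n : nat) : C :=
  match n with
  | O => 1
  | S k => rising s k * (s + INR k)
  end.

(* 1 / Gamma(s) by Gauss's product
   lim s (s + 1) ... (s + n) / (n! n^s), which is 0 at the poles of Gamma. *)
Definition rGamma (s : C) : C :=
  let u (n : nat) : C :=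
    rising s (S n) / INR (fact n) * Cexp (- s * ln (INR n)) in
  (real (Lim_seq (fun n => Re (u n))), real (Lim_seq (fun n => Im (u n)))).

Definition p_integral (n : nat) (x s : C) : C :=
  loop_integral s (fun tau => Cexp (- x * tau) * (1 - Cexp (- tau)) ^ n) 0 1.

Definition p_sum (n : nat) (x s : C) : C :=
  - (2 * PI * Ci) * Cexp (- (PI * Ci * s)) * rGamma s *
  sum_n (G := C_AbelianMonoid)
    (fun m : nat => RtoC (Binomial.C n m) * (- (1)) ^ m *
                    Cpow_principal (x + INR m) (s - 1)) n.

(* The loop integral converges absolutely for Re x > 0; on the boundary
   Re x = 0 its meaning is given by the closed form. *)
Definition p (n : nat) (x s : C) : C :=
  if Rlt_dec 0 (Re x) then p_integral n x s else p_sum n x s.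

Definition x_of (z : C) (theta : R) : C :=
  1 / 2 - lnz z theta / (2 * PI * Ci).

(* Main.v *)
Require Import Defs.
From Stdlib Require Import Lra Lia FunctionalExtensionality.

(** With [tau = 2 pi i t] the integrand of [B] becomes, up to a factor,
    [e^(-x tau) tau^(-s) / (E e^(-tau) - 1)] where [E = e^(2 pi i a)], and
    [E e^(-tau) - 1 = (E - 1) (1 - q (1 - e^(-tau)))] with [q = E / (E - 1)], so
    that [|q| < 1].  When [a] is real, the loop can be rotated and shrunk to one
    whose rays have argument slightly below that of the positive real axis and
    whose circle is small; there [|q (1 - e^(-tau))|] is bounded by a constant
    less than 1, and integrating the geometric series termwise gives
    [q^n / (E - 1)] times the loop integral of [e^(-x tau) tau^(-s) (1 - e^(-tau))^n].

    The latter is [p_n]: by rotation if [Re x > 0], and if [Re x = 0] by Hankel's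
    formula for [1 / Gamma].  With Gauss's product as definition of [1 / Gamma],
    Hankel's formula follows from the recursion [1 / Gamma (s) = s / Gamma (s + 1)]
    and from the saddle point estimate of Hankel's integral at [s + n + 1], taken
    with a circle of radius [n] and compared with its value [1 / n!] at [s = 0].

    Since [p_n = O (r^n)] for every [r > 1], the right-hand side is a power series
    in [q] times elementary functions, hence analytic in [a] on [region], and the
    identity theorem along three segments starting at [1 / 2] identifies it with
    the analytic continuation. *)

(** Two demands on the rays conflict. When arg z = pi one has Re x = 0, and e^(-x tau) decays only
    through Im x > 0, that is, only for arg tau < 0; here |z| > 1 enters. On the real axis |1 -
    e^(-tau)| < 1, but on a tilted ray this modulus may exceed 1 once |Im tau| passes pi/3. The
    slack in |q| < 1 pays for the tilt: some r > 1 still has r |q| < 1, and the angle is chosen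
    after r, so small that |1 - e^(-tau)| <= r on the whole ray.

    The direction -(1+i) of the loop for B becomes arg tau = -pi/4, where the geometric series need
    not converge, so a rotation is unavoidable. For real a the poles lie on the imaginary tau-axis,
    and a rotation within the right half-plane meets none of them. For every other a no integral
    with poles is deformed: only the right-hand side is examined, through bounds on p_n that do not
    involve a.

    Loops are compared after truncation at a finite radius, where Green's theorem in polar
    coordinates applies; the argument of t then stays a real variable, and no branch of the
    logarithm is ever chosen. *)

Notation R2_UniformSpace := (prod_UniformSpace R_UniformSpace R_UniformSpace).
Notation Ccontinuous := (continuous (U := C_UniformSpace)).
Notation Clocally := (locally (T := C_UniformSpace)).
Notation CRInt := (RInt (V := C_R_CompleteNormedModule)).
Notation is_CRInt := (is_RInt (V := C_R_NormedModule)).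
Notation ex_CRInt := (ex_RInt (V := C_R_NormedModule)).
Notation is_CRInt_unique := (is_RInt_unique (V := C_R_CompleteNormedModule)).
Notation CRInt_correct := (RInt_correct (V := C_R_CompleteNormedModule)).
Notation ex_Rderive_continuous := (ex_derive_continuous (K := R_AbsRing) (V := R_NormedModule)).
Notation is_derive_Rconst := (is_derive_const (K := R_AbsRing) (V := R_NormedModule)).

Ltac csimpl := unfold Re, Im in *; simpl in *.

(** * The complex exponential and polar coordinates *)

Lemma C_ext (z w : C) : Re z = Re w -> Im z = Im w -> z = w.
Proof. destruct z, w; simpl; intros; subst; reflexivity. Qed.

Lemma exp_le_compat (x y : R) : (x <= y)%R -> (exp x <= exp y)%R.
Proof. intros [H| ->]; [left; apply exp_increasing, H|right; reflexivity]. Qed.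

Lemma Cexp_plus (z w : C) : Cexp (z + w) = Cexp z * Cexp w.
Proof.
  apply C_ext; unfold Cexp; csimpl; rewrite exp_plus, ?cos_plus, ?sin_plus; ring.
Qed.

Lemma Cexp_0 : Cexp 0 = 1.
Proof. apply C_ext; unfold Cexp; csimpl; rewrite exp_0, ?cos_0, ?sin_0; ring. Qed.

Lemma Cmod_Cexp (w : C) : Cmod (Cexp w) = exp (Re w).
Proof.
  destruct w as [x y]; unfold Cmod, Cexp; csimpl.
  replace (_ + _)%R with ((exp x)²).
  - apply sqrt_Rsqr; left; apply exp_pos.
  - pose proof (sin2_cos2 y) as H; unfold Rsqr in *.
    transitivity (exp x * exp x * (sin y * sin y + cos y * cos y))%R; [|ring].
    rewrite H; ring.
Qed.

Lemma Cexp_neq_0 (w : C) : Cexp w <> 0.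
Proof. apply Cmod_gt_0; rewrite Cmod_Cexp; apply exp_pos. Qed.

Lemma Cexp_opp (w : C) : Cexp (- w) = / Cexp w.
Proof.
  assert (H : Cexp (- w) * Cexp w = 1).
  { rewrite <- Cexp_plus. replace (- w + w) with (RtoC 0) by ring. apply Cexp_0. }
  rewrite <- (Cmult_1_l (/ Cexp w)), <- H. field. apply Cexp_neq_0.
Qed.

Lemma Cexp_INR (w : C) (n : nat) : Cexp (w * INR n) = Cexp w ^ n.
Proof.
  induction n as [|n IH].
  - rewrite Cmult_0_r. apply Cexp_0.
  - rewrite S_INR, RtoC_plus, Cpow_S, Cmult_plus_distr_l, Cexp_plus, IH.
    rewrite Cmult_1_r; ring.
Qed.

Lemma Cexp_Ci (y : R) : Cexp (Ci * y) = (cos y, sin y).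
Proof.
  apply C_ext; unfold Cexp; csimpl;
  replace (0 * y - 1 * 0)%R with 0%R by ring;
  replace (0 * 0 + 1 * y)%R with y by ring; rewrite exp_0; ring.
Qed.

Lemma Cexp_2PI : Cexp (2 * PI * Ci) = 1.
Proof.
  replace (2 * PI * Ci) with (Ci * (2 * PI)%R) by (rewrite RtoC_mult; ring).
  rewrite Cexp_Ci, cos_2PI, sin_2PI; reflexivity.
Qed.

Lemma Cexp_PI : Cexp (PI * Ci) = - (1).
Proof.
  replace (PI * Ci) with (Ci * PI) by ring.
  rewrite Cexp_Ci, cos_PI, sin_PI. apply C_ext; csimpl; ring.
Qed.

(** The modulus forces Re w = 0; then cos y = 1 gives sin (y / 2) = 0, whose zeros are known. This
    locates the poles of the integrand of B. *)
Lemma Cexp_eq_1 (w : C) : Cexp w = 1 -> exists k : Z, w = 2 * PI * Ci * IZR k.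
Proof.
  destruct w as [x y]; intros H.
  assert (Hx : x = 0%R).
  { apply exp_inv. rewrite exp_0, <- Cmod_1, <- H, Cmod_Cexp; reflexivity. }
  subst x; unfold Cexp in H; injection H as Hc _; csimpl; rewrite exp_0 in Hc.
  assert (Hh : sin (y / 2) = 0%R).
  { pose proof (cos_2a_sin (y / 2)) as E.
    replace (2 * (y / 2))%R with y in E by field. nra. }
  destruct (sin_eq_0_0 _ Hh) as [k Hk]. exists k.
  apply C_ext; csimpl; lra.
Qed.

Lemma polar_Cexp (rho phi : R) : (0 < rho)%R -> polar rho phi = Cexp (ln rho, phi).
Proof. intros H; unfold polar, Cexp; csimpl; rewrite exp_ln by exact H; reflexivity. Qed.

Lemma polar_mult (r1 r2 p1 p2 : R) :
  polar r1 p1 * polar r2 p2 = polar (r1 * r2) (p1 + p2).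
Proof.
  apply C_ext; unfold polar; csimpl; rewrite ?cos_plus, ?sin_plus; ring.
Qed.

Lemma polar_2PI (r p : R) : polar r (p + 2 * PI) = polar r p.
Proof. unfold polar. rewrite cos_plus, sin_plus, cos_2PI, sin_2PI. f_equal; ring. Qed.

Lemma polar_RtoC (r p : R) : polar r p = r * Cexp (Ci * p).
Proof. rewrite Cexp_Ci. apply C_ext; unfold polar; csimpl; ring. Qed.

Lemma Cmod_polar (r p : R) : Cmod (polar r p) = Rabs r.
Proof.
  rewrite polar_RtoC, Cmod_mult, Cmod_R, Cmod_Cexp; csimpl.
  replace (0 * p - 1 * 0)%R with 0%R by ring. rewrite exp_0; ring.
Qed.

(** * Differentiation along curves *)

(** Taken componentwise, so that the real differentiation rules and the real fundamental theorem of
    calculus apply to each component. *)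
Definition is_Rderive (f : R -> C) (t : R) (l : C) : Prop :=
  is_derive (fun u => Re (f u)) t (Re l) /\ is_derive (fun u => Im (f u)) t (Im l).

Lemma is_Rderive_eq (f : R -> C) (t : R) (l l' : C) :
  is_Rderive f t l -> l = l' -> is_Rderive f t l'.
Proof. intros H <-; exact H. Qed.

Lemma is_Rderive_ext (f g : R -> C) (t : R) (l : C) :
  (forall u, f u = g u) -> is_Rderive f t l -> is_Rderive g t l.
Proof.
  intros E [H1 H2]; split;
  [refine (is_derive_ext _ _ _ _ _ H1) | refine (is_derive_ext _ _ _ _ _ H2)];
  intros u; rewrite E; reflexivity.
Qed.

Lemma is_Rderive_const (c : C) (t : R) : is_Rderive (fun _ => c) t 0.
Proof. split; apply (is_derive_const (K:=R_AbsRing) (V:=R_NormedModule)). Qed.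

Lemma is_Rderive_plus (f g : R -> C) (t : R) (l m : C) :
  is_Rderive f t l -> is_Rderive g t m -> is_Rderive (fun u => f u + g u) t (l + m).
Proof. intros [H1 H2] [H3 H4]; split; apply (is_derive_plus (K:=R_AbsRing) (V:=R_NormedModule)); assumption. Qed.

Lemma is_Rderive_opp (f : R -> C) (t : R) (l : C) :
  is_Rderive f t l -> is_Rderive (fun u => - f u) t (- l).
Proof. intros [H1 H2]; split; apply (is_derive_opp (K:=R_AbsRing) (V:=R_NormedModule)); assumption. Qed.

Lemma is_derive_Rmult (f g : R -> R) (t l m : R) :
  is_derive f t l -> is_derive g t m ->
  is_derive (fun u => f u * g u)%R t (l * g t + f t * m)%R.
Proof. intros Hf Hg; apply (is_derive_mult f g t l m Hf Hg Rmult_comm). Qed.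

Lemma is_Rderive_mult (f g : R -> C) (t : R) (l m : C) :
  is_Rderive f t l -> is_Rderive g t m ->
  is_Rderive (fun u => f u * g u) t (l * g t + f t * m).
Proof.
  intros [H1 H2] [H3 H4]; split.
  - evar_last.
    + exact (is_derive_minus _ _ _ _ _ (is_derive_Rmult _ _ _ _ _ H1 H3) (is_derive_Rmult _ _ _ _ _ H2 H4)).
    + unfold minus, plus, opp; csimpl; ring.
  - evar_last.
    + exact (is_derive_plus _ _ _ _ _ (is_derive_Rmult _ _ _ _ _ H1 H4) (is_derive_Rmult _ _ _ _ _ H2 H3)).
    + unfold plus; csimpl; ring.
Qed.

Lemma Re_Im_neq_0 (z : C) : z <> 0 -> (Re z ^ 2 + Im z ^ 2 <> 0)%R.
Proof.
  destruct z as [x y]; intros Hz E; csimpl. apply Hz. apply C_ext; csimpl; nra.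
Qed.

Lemma is_Rderive_inv (f : R -> C) (t : R) (l : C) :
  f t <> 0 -> is_Rderive f t l -> is_Rderive (fun u => / f u) t (- l / (f t * f t)).
Proof.
  intros Hn [H1 H2]. pose proof (Re_Im_neq_0 _ Hn) as Hd.
  assert (HD : is_derive (fun u => (Re (f u) ^ 2 + Im (f u) ^ 2)%R) t
     (2 * Re (f t) * Re l + 2 * Im (f t) * Im l)%R).
  { evar_last.
    - exact (is_derive_plus _ _ _ _ _ (is_derive_pow _ 2 _ _ H1) (is_derive_pow _ 2 _ _ H2)).
    - unfold plus; csimpl; ring. }
  split.
  - evar_last.
    + exact (is_derive_div _ _ _ _ _ H1 HD Hd).
    + clear -Hd; destruct l as [c d]; csimpl; destruct (f t) as [a b]; csimpl; field; split; [|lra].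
      intros E; apply Hd; nra.
  - evar_last.
    + exact (is_derive_div _ _ _ _ _ (is_derive_opp _ _ _ H2) HD Hd).
    + clear -Hd; unfold opp; destruct l as [c d]; csimpl; destruct (f t) as [a b]; csimpl; field; split; [|lra].
      intros E; apply Hd; nra.
Qed.

Lemma is_Rderive_Cexp (f : R -> C) (t : R) (l : C) :
  is_Rderive f t l -> is_Rderive (fun u => Cexp (f u)) t (Cexp (f t) * l).
Proof.
  intros [H1 H2].
  assert (He := is_derive_comp exp _ t _ _ (is_derive_exp (Re (f t))) H1).
  assert (Hc := is_derive_comp cos _ t _ _ (is_derive_cos (Im (f t))) H2).
  assert (Hs := is_derive_comp sin _ t _ _ (is_derive_sin (Im (f t))) H2).
  split.
  - evar_last.
    + exact (is_derive_Rmult _ _ _ _ _ He Hc).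
    + unfold scal; simpl; unfold mult; csimpl; ring.
  - evar_last.
    + exact (is_derive_Rmult _ _ _ _ _ He Hs).
    + unfold scal; simpl; unfold mult; csimpl; ring.
Qed.

(** * Continuity of complex-valued functions *)

Lemma continuous_C {T : UniformSpace} (f : T -> C) (x : T) :
  continuous (fun u => Re (f u)) x -> continuous (fun u => Im (f u)) x ->
  Ccontinuous f x.
Proof.
  intros H1 H2 P [eps HP].
  assert (A := H1 _ (locally_ball (Re (f x)) eps)).
  assert (B := H2 _ (locally_ball (Im (f x)) eps)).
  refine (filter_imp (F := locally x) _ _ _ (filter_and (F := locally x) _ _ A B)); intros u [Hu Hv].
  apply HP; split; assumption.
Qed.

Lemma continuous_Re {T : UniformSpace} (f : T -> C) (x : T) :
  Ccontinuous f x -> continuous (fun u => Re (f u)) x.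
Proof.
  intros H P [eps HP].
  refine (filter_imp (F := locally x) _ _ _ (H _ (locally_ball (f x) eps))); intros u [Hu _].
  apply HP; assumption.
Qed.

Lemma continuous_Im {T : UniformSpace} (f : T -> C) (x : T) :
  Ccontinuous f x -> continuous (fun u => Im (f u)) x.
Proof.
  intros H P [eps HP].
  refine (filter_imp (F := locally x) _ _ _ (H _ (locally_ball (f x) eps))); intros u [_ Hu].
  apply HP; assumption.
Qed.

Lemma continuous_pair {T U V : UniformSpace} (f : T -> U) (g : T -> V) (x : T) :
  continuous f x -> continuous g x ->
  continuous (U := prod_UniformSpace U V) (fun u => (f u, g u)) x.
Proof.
  intros H1 H2 P [eps HP].
  refine (filter_imp (F := locally x) _ _ _ (filter_and (F := locally x) _ _
    (H1 _ (locally_ball (f x) eps)) (H2 _ (locally_ball (g x) eps)))); intros u [Hu Hv].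
  apply HP; split; assumption.
Qed.

Section Continuity.
Context {T : UniformSpace}.
Implicit Types (f g : T -> C) (x : T).

Lemma continuous_Cconst (c : C) x : Ccontinuous (fun _ : T => c) x.
Proof. apply continuous_const. Qed.

Lemma continuous_Cplus f g x :
  Ccontinuous f x -> Ccontinuous g x ->
  Ccontinuous (fun u => f u + g u) x.
Proof.
  intros Hf Hg; apply continuous_C.
  - apply (continuous_plus (V := R_NormedModule)); apply continuous_Re; assumption.
  - apply (continuous_plus (V := R_NormedModule)); apply continuous_Im; assumption.
Qed.

Lemma continuous_Copp f x :
  Ccontinuous f x ->
  Ccontinuous (fun u => - f u) x.
Proof.
  intros Hf; apply continuous_C.
  - apply (continuous_opp (V := R_NormedModule)); apply continuous_Re; assumption.
  - apply (continuous_opp (V := R_NormedModule)); apply continuous_Im; assumption.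
Qed.

Lemma continuous_Cmult f g x :
  Ccontinuous f x -> Ccontinuous g x ->
  Ccontinuous (fun u => f u * g u) x.
Proof.
  intros Hf Hg.
  assert (F1 := continuous_Re f x Hf). assert (F2 := continuous_Im f x Hf).
  assert (G1 := continuous_Re g x Hg). assert (G2 := continuous_Im g x Hg).
  apply continuous_C.
  - apply (continuous_minus (V := R_NormedModule)); apply (continuous_mult (K := R_AbsRing)); assumption.
  - apply (continuous_plus (V := R_NormedModule)); apply (continuous_mult (K := R_AbsRing)); assumption.
Qed.

Lemma continuous_Cinv f x :
  f x <> 0 -> Ccontinuous f x ->
  Ccontinuous (fun u => / f u) x.
Proof.
  intros Hn Hf. pose proof (Re_Im_neq_0 _ Hn) as Hd.
  assert (F1 := continuous_Re f x Hf). assert (F2 := continuous_Im f x Hf).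
  assert (D : continuous (fun u => / (Re (f u) ^ 2 + Im (f u) ^ 2))%R x).
  { apply (continuous_comp (fun u => (Re (f u) ^ 2 + Im (f u) ^ 2)%R) Rinv); [|apply continuous_Rinv, Hd].
    apply (continuous_plus (V := R_NormedModule)); simpl;
    (apply (continuous_mult (K := R_AbsRing)); [assumption|];
     apply (continuous_mult (K := R_AbsRing)); [assumption|apply continuous_const]). }
  apply continuous_C.
  - apply (continuous_mult (K := R_AbsRing)); assumption.
  - apply (continuous_mult (K := R_AbsRing)); [|assumption].
    apply (continuous_opp (V := R_NormedModule)); assumption.
Qed.

Lemma continuous_Cexp_comp f x :
  Ccontinuous f x ->
  Ccontinuous (fun u => Cexp (f u)) x.
Proof.
  intros Hf.
  assert (F1 := continuous_Re f x Hf). assert (F2 := continuous_Im f x Hf).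
  assert (E := continuous_comp _ exp x F1 (continuous_exp _)).
  apply continuous_C; apply (continuous_mult (K := R_AbsRing)); try assumption.
  - exact (continuous_comp _ cos x F2 (continuous_cos _)).
  - exact (continuous_comp _ sin x F2 (continuous_sin _)).
Qed.

End Continuity.

Lemma is_Rderive_continuous (f : R -> C) (t : R) (l : C) :
  is_Rderive f t l -> Ccontinuous f t.
Proof.
  intros [H1 H2]; apply continuous_C; apply ex_Rderive_continuous; eexists; eassumption.
Qed.

(* Complex differentiability is tested along differentiable curves, so that no
   derivative over the field C is needed. *)
Definition is_Cderive (f : C -> C) (w d : C) : Prop :=
  forall (g : R -> C) (t : R) (l : C),
    g t = w -> is_Rderive g t l -> is_Rderive (fun u => f (g u)) t (d * l).

Definition C1_at (f f' : C -> C) (w : C) : Prop :=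
  is_Cderive f w (f' w) /\ @continuous C_UniformSpace C_UniformSpace f w /\
  @continuous C_UniformSpace C_UniformSpace f' w.

(** [U] need not be open: at each of its points the condition concerns all curves through that point
    and continuity in the plane. A contour can therefore serve as [U]. *)
Definition C1_on (U : C -> Prop) (f : C -> C) : Prop :=
  exists f' : C -> C, forall w, U w -> C1_at f f' w.

Section C1.
Context (U : C -> Prop).
Implicit Types f g : C -> C.

Lemma C1_const (c : C) : C1_on U (fun _ => c).
Proof.
  exists (fun _ => 0); intros w _; split; [|split; apply continuous_Cconst].
  intros h t l _ _. rewrite Cmult_0_l; apply is_Rderive_const.
Qed.

Lemma C1_id : C1_on U (fun w => w).
Proof.
  exists (fun _ => 1); intros w _; split; [|split; [|apply continuous_Cconst]].
  - intros h t l _ H. rewrite Cmult_1_l; exact H.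
  - apply continuous_id.
Qed.

Lemma C1_plus f g : C1_on U f -> C1_on U g -> C1_on U (fun w => f w + g w).
Proof.
  intros [f' Hf] [g' Hg]; exists (fun w => f' w + g' w); intros w Hw.
  destruct (Hf w Hw) as (F1 & F2 & F3), (Hg w Hw) as (G1 & G2 & G3).
  split; [|split; apply continuous_Cplus; assumption].
  intros h t l E H. rewrite Cmult_plus_distr_r.
  apply is_Rderive_plus; auto.
Qed.

Lemma C1_opp f : C1_on U f -> C1_on U (fun w => - f w).
Proof.
  intros [f' Hf]; exists (fun w => - f' w); intros w Hw.
  destruct (Hf w Hw) as (F1 & F2 & F3).
  split; [|split; apply continuous_Copp; assumption].
  intros h t l E H. eapply is_Rderive_eq; [apply is_Rderive_opp; eapply F1; eassumption|ring].
Qed.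

Lemma C1_minus f g : C1_on U f -> C1_on U g -> C1_on U (fun w => f w - g w).
Proof. intros Hf Hg; apply C1_plus; [exact Hf|apply C1_opp; exact Hg]. Qed.

Lemma C1_mult f g : C1_on U f -> C1_on U g -> C1_on U (fun w => f w * g w).
Proof.
  intros [f' Hf] [g' Hg]; exists (fun w => f' w * g w + f w * g' w); intros w Hw.
  destruct (Hf w Hw) as (F1 & F2 & F3), (Hg w Hw) as (G1 & G2 & G3).
  split; [|split; [apply continuous_Cmult; assumption
    |apply continuous_Cplus; apply continuous_Cmult; assumption]].
  intros h t l E H. eapply is_Rderive_eq.
  - apply is_Rderive_mult; [eapply F1|eapply G1]; eassumption.
  - cbv beta; rewrite E; ring.
Qed.

Lemma C1_inv f : (forall w, U w -> f w <> 0) -> C1_on U f -> C1_on U (fun w => / f w).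
Proof.
  intros Hn [f' Hf]; exists (fun w => - f' w * / (f w * f w)); intros w Hw.
  specialize (Hn w Hw). destruct (Hf w Hw) as (F1 & F2 & F3).
  split; [|split].
  - intros h t l E H. eapply is_Rderive_eq.
    + apply is_Rderive_inv; [cbv beta; rewrite E; assumption|eapply F1; eassumption].
    + cbv beta; rewrite E; field; assumption.
  - apply continuous_Cinv; assumption.
  - apply continuous_Cmult; [apply continuous_Copp; assumption|].
    apply continuous_Cinv; [apply Cmult_neq_0; assumption|apply continuous_Cmult; assumption].
Qed.

Lemma C1_Cexp f : C1_on U f -> C1_on U (fun w => Cexp (f w)).
Proof.
  intros [f' Hf]; exists (fun w => Cexp (f w) * f' w); intros w Hw.
  destruct (Hf w Hw) as (F1 & F2 & F3).
  split; [|split].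
  - intros h t l E H. eapply is_Rderive_eq.
    + apply is_Rderive_Cexp; eapply F1; eassumption.
    + cbv beta; rewrite E; ring.
  - apply continuous_Cexp_comp; assumption.
  - apply continuous_Cmult; [apply continuous_Cexp_comp|]; assumption.
Qed.

Lemma C1_pow f (n : nat) : C1_on U f -> C1_on U (fun w => f w ^ n).
Proof.
  intros Hf; induction n as [|n IH]; [exact (C1_const 1)|exact (C1_mult f (fun w => f w ^ n) Hf IH)].
Qed.

End C1.

(** * Green's theorem on rectangles *)

Lemma is_CRInt_components (f : R -> C) (a b : R) (l : C) :
  is_RInt (fun t => Re (f t)) a b (Re l) -> is_RInt (fun t => Im (f t)) a b (Im l) ->
  is_CRInt f a b l.
Proof. intros H1 H2; apply (is_RInt_fct_extend_pair (U := R_NormedModule) (V := R_NormedModule)); assumption. Qed.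

Lemma ex_CRInt_continuous (f : R -> C) (a b : R) :
  (forall t, (Rmin a b <= t <= Rmax a b)%R -> Ccontinuous f t) ->
  ex_CRInt f a b.
Proof. intros H; apply (ex_RInt_continuous (V := C_R_CompleteNormedModule)); exact H. Qed.

Lemma Re_CRInt (f : R -> C) (a b : R) :
  ex_CRInt f a b -> is_RInt (fun t => Re (f t)) a b (Re (CRInt f a b)).
Proof.
  intros H. apply (is_RInt_fct_extend_fst (U := R_NormedModule) (V := R_NormedModule)).
  apply (CRInt_correct), H.
Qed.

Lemma Im_CRInt (f : R -> C) (a b : R) :
  ex_CRInt f a b -> is_RInt (fun t => Im (f t)) a b (Im (CRInt f a b)).
Proof.
  intros H. apply (is_RInt_fct_extend_snd (U := R_NormedModule) (V := R_NormedModule)).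
  apply (CRInt_correct), H.
Qed.

Lemma is_CRInt_derive (f f' : R -> C) (a b : R) :
  (forall t, (Rmin a b <= t <= Rmax a b)%R -> is_Rderive f t (f' t)) ->
  (forall t, (Rmin a b <= t <= Rmax a b)%R -> Ccontinuous f' t) ->
  is_CRInt f' a b (f b - f a).
Proof.
  intros H1 H2; apply is_CRInt_components.
  - apply (is_RInt_derive (fun t => Re (f t))); intros t Ht; [apply H1, Ht|apply continuous_Re, H2, Ht].
  - apply (is_RInt_derive (fun t => Im (f t))); intros t Ht; [apply H1, Ht|apply continuous_Im, H2, Ht].
Qed.

Section Green.
Context (P Q D : R -> R -> C) (r1 r2 p1 p2 e : R).
Hypothesis He : (0 < e)%R.
Hypothesis Hr : (r1 <= r2)%R.
Hypothesis Hp : (p1 <= p2)%R.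
Hypothesis HP : forall r p, (r1 - e < r < r2 + e)%R -> (p1 - e < p < p2 + e)%R ->
  is_Rderive (P r) p (D r p).
Hypothesis HQ : forall r p, (r1 - e < r < r2 + e)%R -> (p1 - e < p < p2 + e)%R ->
  is_Rderive (fun u => Q u p) r (D r p).
Hypothesis HD : forall r p, (r1 - e < r < r2 + e)%R -> (p1 - e < p < p2 + e)%R ->
  @continuous R2_UniformSpace C_UniformSpace
    (fun z => D (snd z) (fst z)) (p, r).
Hypothesis HPc : forall r p, (r1 - e < r < r2 + e)%R -> (p1 - e < p < p2 + e)%R ->
  Ccontinuous (fun u => P u p) r.
Hypothesis HQc : forall r p, (r1 - e < r < r2 + e)%R -> (p1 - e < p < p2 + e)%R ->
  Ccontinuous (Q r) p.

Lemma near_p (p : R) : (p1 <= p <= p2)%R ->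
  locally p (fun q => (p1 - e < q < p2 + e)%R).
Proof.
  intros Hpp; exists (mkposreal e He); intros q Hq.
  assert (Hq' : (Rabs (q - p) < e)%R) by exact Hq.
  apply Rabs_def2 in Hq'; lra.
Qed.

(** Differentiation under the integral sign for one component. The margin [e] supplies the
    neighbourhood of [p] which that theorem requires, also at the ends of the interval. *)
Lemma green_aux (k : C -> R) (p : R) : (k = Re \/ k = Im) -> (p1 <= p <= p2)%R ->
  is_derive (fun q => RInt (fun r => k (P r q)) r1 r2) p
    (RInt (fun r => k (D r p)) r1 r2).
Proof.
  intros Hk Hpp.
  assert (Hkd : forall r q, (r1 - e < r < r2 + e)%R -> (p1 - e < q < p2 + e)%R ->
     is_derive (fun z => k (P r z)) q (k (D r q))).
  { intros r q H1 H2; destruct (HP r q H1 H2); destruct Hk; subst k; assumption. }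
  assert (Hkc : forall r q, (r1 - e < r < r2 + e)%R -> (p1 - e < q < p2 + e)%R ->
     continuous (fun u => k (P u q)) r).
  { intros r q H1 H2; specialize (HPc r q H1 H2); destruct Hk; subst k;
    [apply continuous_Re|apply continuous_Im]; assumption. }
  evar_last.
  - apply (is_derive_RInt_param (fun q r => k (P r q))).
    + refine (filter_imp _ _ _ (near_p p Hpp)); intros q Hq t Ht.
      rewrite Rmin_left, Rmax_right in Ht by lra.
      eexists; apply Hkd; [lra|assumption].
    + intros t Ht. rewrite Rmin_left, Rmax_right in Ht by lra.
      apply continuity_2d_pt_ext_loc with (fun q r => k (D r q)).
      * exists (mkposreal e He); intros u v Hu Hv; simpl in Hu, Hv.
        apply Rabs_def2 in Hu; apply Rabs_def2 in Hv.
        symmetry; apply is_derive_unique, Hkd; lra.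
      * apply continuity_2d_pt_filterlim.
        assert (C : @continuous R2_UniformSpace C_UniformSpace
          (fun z => D (snd z) (fst z)) (p, t)) by (apply HD; lra).
        destruct Hk; subst k; [apply (continuous_Re _ _ C)|apply (continuous_Im _ _ C)].
    + refine (filter_imp _ _ _ (near_p p Hpp)); intros q Hq.
      apply (ex_RInt_continuous (V := R_CompleteNormedModule)).
      intros t Ht. rewrite Rmin_left, Rmax_right in Ht by lra. apply Hkc; [lra|assumption].
  - apply RInt_ext; intros r Hrr. rewrite Rmin_left, Rmax_right in Hrr by lra.
    apply is_derive_unique, Hkd; lra.
Qed.

(** No double integral is needed: the p-derivative of the integral of P over r is the integral of D,
    which equals Q r2 p - Q r1 p because D is also the r-derivative of Q. Integrating over p gives
    the claim. *)
Lemma green :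
  CRInt (fun r => P r p2) r1 r2 - CRInt (fun r => P r p1) r1 r2 =
  CRInt (Q r2) p1 p2 - CRInt (Q r1) p1 p2.
Proof.
  assert (exP : forall q, (p1 - e < q < p2 + e)%R -> ex_CRInt (fun r => P r q) r1 r2).
  { intros q Hq; apply ex_CRInt_continuous; intros t Ht.
    rewrite Rmin_left, Rmax_right in Ht by lra; apply HPc; [lra|assumption]. }
  assert (exQ : forall r, (r1 <= r <= r2)%R -> ex_CRInt (Q r) p1 p2).
  { intros r Hrr; apply ex_CRInt_continuous; intros t Ht.
    rewrite Rmin_left, Rmax_right in Ht by lra; apply HQc; lra. }
  assert (ID : forall p, (p1 <= p <= p2)%R ->
    is_CRInt (fun r => D r p) r1 r2 (Q r2 p - Q r1 p)).
  { intros p Hpp; apply (is_CRInt_derive (fun r => Q r p)); intros t Ht;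
    rewrite Rmin_left, Rmax_right in Ht by lra.
    - apply HQ; lra.
    - apply (@continuous_comp R_UniformSpace (R2_UniformSpace) C_UniformSpace
        (fun r => (p, r)) (fun z => D (snd z) (fst z))).
      + apply continuous_pair; [apply continuous_const|apply continuous_id].
      + apply HD; lra. }
  assert (HA : forall p, (p1 <= p <= p2)%R ->
    is_Rderive (fun q => CRInt (fun r => P r q) r1 r2) p (Q r2 p - Q r1 p)).
  { intros p Hpp; split.
    - evar_last.
      + apply (is_derive_ext_loc (fun q => RInt (fun r => Re (P r q)) r1 r2)).
        * refine (filter_imp _ _ _ (near_p p Hpp)); intros q Hq.
          apply is_RInt_unique, Re_CRInt, exP, Hq.
        * apply green_aux; [left; reflexivity|exact Hpp].
      + apply is_RInt_unique. specialize (ID p Hpp).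
        rewrite <- (is_CRInt_unique _ _ _ _ ID).
        apply Re_CRInt; eexists; exact ID.
    - evar_last.
      + apply (is_derive_ext_loc (fun q => RInt (fun r => Im (P r q)) r1 r2)).
        * refine (filter_imp _ _ _ (near_p p Hpp)); intros q Hq.
          apply is_RInt_unique, Im_CRInt, exP, Hq.
        * apply green_aux; [right; reflexivity|exact Hpp].
      + apply is_RInt_unique. specialize (ID p Hpp).
        rewrite <- (is_CRInt_unique _ _ _ _ ID).
        apply Im_CRInt; eexists; exact ID. }
  rewrite <- (is_CRInt_unique _ _ _ _
    (is_CRInt_derive _ (fun p => Q r2 p - Q r1 p) p1 p2
       ltac:(intros p Hpp; rewrite Rmin_left, Rmax_right in Hpp by lra; exact (HA p Hpp))
       ltac:(intros p Hpp; rewrite Rmin_left, Rmax_right in Hpp by lra;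
             apply continuous_Cplus; [|apply continuous_Copp]; apply HQc; lra))).
  apply (RInt_minus (V := C_R_CompleteNormedModule)); apply exQ; lra.
Qed.

End Green.

(** * The form t^(-s) g(t) dt in polar coordinates *)

Definition integrand (s : C) (g : C -> C) (rho phi : R) : C :=
  Cexp (- s * (ln rho, phi)) * g (polar rho phi).

Lemma C1_comp (U V : C -> Prop) (f h : C -> C) :
  C1_on U f -> C1_on V h -> (forall w, V w -> U (h w)) -> C1_on V (fun w => f (h w)).
Proof.
  intros [f' Hf] [h' Hh] HUV; exists (fun w => f' (h w) * h' w); intros w Hw.
  destruct (Hh w Hw) as (F1 & F2 & F3), (Hf (h w) (HUV w Hw)) as (G1 & G2 & G3).
  split; [|split].
  - intros k t l E H. eapply is_Rderive_eq.
    + apply (G1 (fun u => h (k u))); [rewrite E; reflexivity|eapply F1; eassumption].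
    + ring.
  - exact (@continuous_comp C_UniformSpace C_UniformSpace C_UniformSpace h f w F2 G2).
  - apply continuous_Cmult; [|exact F3].
    exact (@continuous_comp C_UniformSpace C_UniformSpace C_UniformSpace h f' w F2 G3).
Qed.

Lemma C1_subset (U V : C -> Prop) (f : C -> C) :
  (forall w, V w -> U w) -> C1_on U f -> C1_on V f.
Proof. intros HUV [f' Hf]; exists f'; intros w Hw; apply Hf, HUV, Hw. Qed.

Lemma is_Rderive_log_polar_r (r p : R) : (0 < r)%R -> is_Rderive (fun u => (ln u, p)) r (/ r)%R.
Proof.
  intros Hr; split; csimpl.
  - apply is_derive_ln; exact Hr.
  - apply is_derive_Rconst.
Qed.

Lemma is_Rderive_log_polar_p (r p : R) : is_Rderive (fun u => (ln r, u)) p Ci.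
Proof.
  split; csimpl.
  - apply is_derive_Rconst.
  - apply (is_derive_id (K := R_AbsRing)).
Qed.

Lemma is_Rderive_polar_r (r p : R) : is_Rderive (fun u => polar u p) r (polar 1 p).
Proof. split; unfold polar; csimpl; auto_derive; auto; ring. Qed.

Lemma is_Rderive_polar_p (r p : R) : is_Rderive (polar r) p (Ci * polar r p).
Proof. split; unfold polar; csimpl; auto_derive; auto; ring. Qed.

Lemma polar_scal (r p : R) : polar r p = r * polar 1 p.
Proof. apply C_ext; unfold polar; csimpl; ring. Qed.

Lemma RtoC_neq_0 (r : R) : r <> 0%R -> RtoC r <> 0.
Proof. intros H E; apply H; apply (f_equal Re) in E; exact E. Qed.

Section LoopForms.
Context (U : C -> Prop) (s : C) (g : C -> C).
Hypothesis Hg : C1_on U g.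

Lemma continuous_integrand_r (r p : R) : (0 < r)%R -> U (polar r p) ->
  Ccontinuous (fun u => integrand s g u p) r.
Proof.
  intros Hr HU; destruct Hg as [g' Hg']; destruct (Hg' _ HU) as (G1 & _ & _).
  apply continuous_Cmult.
  - apply continuous_Cexp_comp, continuous_Cmult; [apply continuous_Cconst|].
    exact (is_Rderive_continuous _ _ _ (is_Rderive_log_polar_r r p Hr)).
  - exact (is_Rderive_continuous _ _ _ (G1 (fun u => polar u p) r _ eq_refl (is_Rderive_polar_r r p))).
Qed.

Lemma continuous_integrand_p (r p : R) : U (polar r p) ->
  Ccontinuous (integrand s g r) p.
Proof.
  intros HU; destruct Hg as [g' Hg']; destruct (Hg' _ HU) as (G1 & _ & _).
  apply continuous_Cmult.
  - apply continuous_Cexp_comp, continuous_Cmult; [apply continuous_Cconst|].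
    exact (is_Rderive_continuous _ _ _ (is_Rderive_log_polar_p r p)).
  - exact (is_Rderive_continuous _ _ _ (G1 (polar r) p _ eq_refl (is_Rderive_polar_p r p))).
Qed.

(* In polar coordinates, t^(-s) g(t) dt = radial_form d rho + angular_form d phi. *)
Definition radial_form (r p : R) : C := integrand s g r p * polar 1 p.
Definition angular_form (r p : R) : C := integrand s g r p * (Ci * polar r p).

Lemma continuous_radial_form (r p : R) : (0 < r)%R -> U (polar r p) ->
  Ccontinuous (fun u => radial_form u p) r.
Proof.
  intros Hr HU; apply continuous_Cmult; [apply continuous_integrand_r; assumption|].
  apply continuous_Cconst.
Qed.

Lemma continuous_angular_form (r p : R) : U (polar r p) ->
  Ccontinuous (angular_form r) p.
Proof.
  intros HU; apply continuous_Cmult; [apply continuous_integrand_p; assumption|].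
  apply continuous_Cmult; [apply continuous_Cconst|].
  exact (is_Rderive_continuous _ _ _ (is_Rderive_polar_p r p)).
Qed.

Lemma continuous_polar_pair (r p : R) :
  @continuous R2_UniformSpace C_UniformSpace
    (fun z => polar (snd z) (fst z)) (p, r).
Proof.
  assert (C1 : continuous (T := R2_UniformSpace) fst (p, r))
    by apply continuous_fst.
  assert (C2 : continuous (T := R2_UniformSpace) snd (p, r))
    by apply continuous_snd.
  apply continuous_C; apply (continuous_mult (K := R_AbsRing)); try exact C2.
  - exact (continuous_comp _ cos _ C1 (continuous_cos _)).
  - exact (continuous_comp _ sin _ C1 (continuous_sin _)).
Qed.

(** Cauchy's theorem for a polar rectangle. The angle is not reduced modulo 2 pi, so the rectangle
    may wrap around 0; [e <= r1] keeps the widened rectangle away from radius 0. *)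
Lemma integrand_green (r1 r2 p1 p2 e : R) :
  (0 < e <= r1)%R -> (r1 <= r2)%R -> (p1 <= p2)%R ->
  (forall r p, (r1 - e < r < r2 + e)%R -> (p1 - e < p < p2 + e)%R -> U (polar r p)) ->
  CRInt (fun r => radial_form r p2) r1 r2 - CRInt (fun r => radial_form r p1) r1 r2 =
  CRInt (angular_form r2) p1 p2 - CRInt (angular_form r1) p1 p2.
Proof.
  intros He Hr Hp HU. destruct Hg as [g' Hg'].
  (* With t = r e^(ip), the common mixed derivative is i e^(ip) t^(-s) ((1 - s) g(t) + t g'(t)). *)
  apply (green radial_form angular_form (fun r p => Ci * polar 1 p *
    (Cexp (- s * (ln r, p)) * ((1 - s) * g (polar r p) + g' (polar r p) * polar r p))) r1 r2 p1 p2 e);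
    try assumption; try lra; intros r p H1 H2; specialize (HU r p H1 H2);
    destruct (Hg' _ HU) as (G1 & G2 & G3).
  - eapply is_Rderive_eq.
    + apply is_Rderive_mult; [apply is_Rderive_mult|apply is_Rderive_polar_p].
      * apply is_Rderive_Cexp, is_Rderive_mult; [apply is_Rderive_const|apply is_Rderive_log_polar_p].
      * exact (G1 (polar r) p _ eq_refl (is_Rderive_polar_p r p)).
    + unfold integrand; cbv beta; ring.
  - assert (Hr0 : (0 < r)%R) by lra.
    eapply is_Rderive_eq.
    + apply is_Rderive_mult; [apply is_Rderive_mult|apply is_Rderive_mult; [apply is_Rderive_const|apply is_Rderive_polar_r]].
      * apply is_Rderive_Cexp, is_Rderive_mult; [apply is_Rderive_const|apply is_Rderive_log_polar_r, Hr0].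
      * exact (G1 (fun u => polar u p) r _ eq_refl (is_Rderive_polar_r r p)).
    + unfold integrand; cbv beta. rewrite (polar_scal r p), RtoC_inv by lra. field.
      apply RtoC_neq_0; lra.
  - assert (CP := continuous_polar_pair r p).
    assert (CP1 : @continuous R2_UniformSpace C_UniformSpace
      (fun z => polar 1 (fst z)) (p, r)).
    { apply (@continuous_comp (R2_UniformSpace) R_UniformSpace C_UniformSpace fst (polar 1)).
      - apply continuous_fst.
      - exact (is_Rderive_continuous _ _ _ (is_Rderive_polar_p 1 p)). }
    assert (CL : @continuous R2_UniformSpace C_UniformSpace
      (fun z => (ln (snd z), fst z)) (p, r)).
    { apply (continuous_pair (T := R2_UniformSpace) (U := R_UniformSpace) (V := R_UniformSpace)).
      - apply (@continuous_comp (R2_UniformSpace) R_UniformSpace R_UniformSpace snd ln).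
        + apply continuous_snd.
        + apply ex_Rderive_continuous. eexists; apply is_derive_ln; simpl; lra.
      - apply continuous_fst. }
    assert (CG := @continuous_comp (R2_UniformSpace) C_UniformSpace C_UniformSpace
      (fun z => polar (snd z) (fst z)) g (p, r) CP G2).
    assert (CG' := @continuous_comp (R2_UniformSpace) C_UniformSpace C_UniformSpace
      (fun z => polar (snd z) (fst z)) g' (p, r) CP G3).
    cbv beta in *.
    apply continuous_Cmult; [apply continuous_Cmult; [apply continuous_Cconst|exact CP1]|].
    apply continuous_Cmult.
    + apply continuous_Cexp_comp, continuous_Cmult; [apply continuous_Cconst|exact CL].
    + apply continuous_Cplus; apply continuous_Cmult;
        [apply continuous_Cconst|exact CG|exact CG'|exact CP].
  - apply continuous_radial_form; [lra|exact HU].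
  - apply continuous_angular_form; exact HU.
Qed.

Lemma Cmod_radial_form (r p : R) : Cmod (radial_form r p) = Cmod (integrand s g r p).
Proof. unfold radial_form. rewrite Cmod_mult, Cmod_polar, Rabs_R1, Rmult_1_r; reflexivity. Qed.

Lemma Cmod_angular_form (r p : R) : (0 <= r)%R -> Cmod (angular_form r p) = (Cmod (integrand s g r p) * r)%R.
Proof.
  intros Hr; unfold angular_form. rewrite 2!Cmod_mult, Cmod_polar, Cmod_Ci, Rabs_pos_eq by exact Hr; ring.
Qed.

Lemma integrand_2PI (r p : R) : integrand s g r (p + 2 * PI) = Cexp (- s * (2 * PI * Ci)) * integrand s g r p.
Proof.
  unfold integrand. rewrite polar_2PI, Cmult_assoc, <- Cexp_plus. do 2 f_equal.
  apply C_ext; csimpl; ring.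
Qed.

(** The monodromy of t^(-s) is a constant factor, so every bound on the incoming ray carries over to
    the outgoing one. *)
Lemma Cmod_integrand_2PI (r p : R) :
  Cmod (integrand s g r (p + 2 * PI)) = (exp (2 * PI * Im s) * Cmod (integrand s g r p))%R.
Proof. rewrite integrand_2PI, Cmod_mult, Cmod_Cexp. do 2 f_equal. csimpl; ring. Qed.

End LoopForms.

(** * Limits at infinity and integrals with exponential decay *)

Notation lim_infty f l := (filterlim f (Rbar_locally p_infty) (Clocally l)).

(** The balls of [C_UniformSpace] are squares; the factor sqrt 2 is the cost of comparing them with
    discs. *)
Lemma locally_C_Cmod {T : Type} (F : (T -> Prop) -> Prop) {FF : Filter F} (f : T -> C) (l : C) :
  (forall eps : R, (0 < eps)%R -> F (fun x => (Cmod (f x - l) < eps)%R)) <->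
  filterlim f F (Clocally l).
Proof.
  split.
  - intros H P [eps HP].
    refine (filter_imp (F := F) _ _ _ (H eps (cond_pos eps))); intros x Hx.
    apply HP. apply C_NormedModule_mixin_compat1. exact Hx.
  - intros H eps He.
    assert (He' : (0 < eps / sqrt 2)%R) by (apply Rdiv_lt_0_compat; [exact He|apply sqrt_lt_R0; lra]).
    refine (filter_imp (F := F) _ _ _ (H _ (locally_ball (l : C_UniformSpace) (mkposreal _ He')))); intros x Hx.
    apply C_NormedModule_mixin_compat2 in Hx. simpl in Hx.
    replace (sqrt 2 * (eps / sqrt 2))%R with eps in Hx; [exact Hx|].
    field. apply Rgt_not_eq, sqrt_lt_R0; lra.
Qed.

Lemma filterlim_Cplus {T : Type} (F : (T -> Prop) -> Prop) {FF : Filter F} (f g : T -> C) (l m : C) :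
  filterlim f F (Clocally l) -> filterlim g F (Clocally m) ->
  filterlim (fun x => f x + g x) F (Clocally (l + m)).
Proof.
  intros Hf Hg.
  exact (@filterlim_comp_2 T C C C F (Clocally l) (Clocally m)
    (Clocally (l + m)) FF f g Cplus Hf Hg (filterlim_plus (V := C_NormedModule) l m)).
Qed.

Lemma filterlim_Cscal {T : Type} (F : (T -> Prop) -> Prop) {FF : Filter F} (f : T -> C) (k l : C) :
  filterlim f F (Clocally l) ->
  filterlim (fun x => k * f x) F (Clocally (k * l)).
Proof.
  intros Hf.
  exact (filterlim_comp T C C f (fun z => k * z) F (locally l) (locally (k * l)) Hf
    (filterlim_scal_r (K := C_AbsRing) (V := C_NormedModule) k l)).
Qed.

Lemma filterlim_Cunique {T : Type} (F : (T -> Prop) -> Prop) {FF : ProperFilter F} (f : T -> C) (l m : C) :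
  filterlim f F (Clocally l) -> filterlim f F (Clocally m) -> l = m.
Proof. intros H1 H2; exact (filterlim_locally_unique (V := C_NormedModule) f l m H1 H2). Qed.

Lemma filterlim_Cmod_le {T : Type} (F : (T -> Prop) -> Prop) {FF : ProperFilter F} (f : T -> C) (l : C) (B : R) :
  filterlim f F (Clocally l) -> F (fun x => (Cmod (f x) <= B)%R) -> (Cmod l <= B)%R.
Proof.
  intros H1 H2. apply Rnot_lt_le; intros Hlt.
  assert (He : (0 < Cmod l - B)%R) by lra.
  assert (H3 := proj2 (locally_C_Cmod F f l) H1 _ He).
  destruct (filter_ex (F := F) _ (filter_and (F := F) _ _ H2 H3)) as [x [Hx1 Hx2]].
  pose proof (Cmod_triangle (f x) (- (f x - l))) as Ht.
  rewrite Cmod_opp in Ht. replace (f x + - (f x - l)) with l in Ht by ring. lra.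
Qed.

Lemma Cmod_CRInt_le (f : R -> C) (g : R -> R) (a b lg : R) :
  (a <= b)%R -> ex_CRInt f a b -> (forall x, (a <= x <= b)%R -> (Cmod (f x) <= g x)%R) ->
  is_RInt g a b lg -> (Cmod (CRInt f a b) <= lg)%R.
Proof.
  intros Hab Hf Hfg Hg. rewrite Cmod_norm.
  apply (norm_RInt_le (V := C_R_NormedModule) f g a b); try assumption.
  - intros x Hx; apply Rle_trans with (2 := Hfg x Hx); right; symmetry; apply (Cmod_norm (f x)).
  - apply (CRInt_correct); exact Hf.
Qed.

Lemma Cmod_CRInt_le_const (f : R -> C) (a b M : R) :
  (a <= b)%R -> ex_CRInt f a b -> (forall x, (a <= x <= b)%R -> (Cmod (f x) <= M)%R) ->
  (Cmod (CRInt f a b) <= (b - a) * M)%R.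
Proof.
  intros Hab Hf HM. apply (Cmod_CRInt_le f (fun _ => M) a b); try assumption.
  apply (is_RInt_const (V := R_NormedModule)).
Qed.

Lemma is_RInt_exp_decay (M c a b : R) : (0 < c)%R ->
  is_RInt (fun x => M * exp (- c * x))%R a b (M / c * exp (- c * a) - M / c * exp (- c * b))%R.
Proof.
  intros Hc. evar_last.
  - apply (is_RInt_derive (fun x => - (M / c * exp (- c * x)))%R); intros x _.
    + auto_derive; [exact I|field; lra].
    + apply ex_Rderive_continuous. auto_derive; exact I.
  - unfold minus, plus, opp; simpl; ring.
Qed.

Lemma exp_decay_lim (c B : R) : (0 < c)%R -> (0 < B)%R ->
  Rbar_locally p_infty (fun x => (exp (- c * x) < B)%R).
Proof.
  intros Hc HB; exists (- ln B / c)%R; intros x Hx.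
  rewrite <- (exp_ln B HB). apply exp_increasing.
  apply (Rmult_lt_compat_l c) in Hx; [|exact Hc].
  replace (c * (- ln B / c))%R with (- ln B)%R in Hx by (field; lra). lra.
Qed.

Lemma Cplus_minus_l (a b : C) : a + b - a = b.
Proof. ring. Qed.

Section Ray.
Context (f : R -> C) (d M c : R).
Hypothesis Hc : (0 < c)%R.
Hypothesis Hcont : forall r, (d <= r)%R -> Ccontinuous f r.
Hypothesis Hf : forall r, (d <= r)%R -> (Cmod (f r) <= M * exp (- c * r))%R.

Lemma ray_ex (a b : R) : (d <= a)%R -> (d <= b)%R -> ex_CRInt f a b.
Proof.
  intros Ha Hb; apply ex_CRInt_continuous; intros t [Ht _]; apply Hcont.
  apply Rle_trans with (2 := Ht). apply Rmin_glb; assumption.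
Qed.

Lemma ray_M : (0 <= M)%R.
Proof.
  apply Rmult_le_reg_r with (exp (- c * d)); [apply exp_pos|].
  rewrite Rmult_0_l. apply Rle_trans with (2 := Hf d (Rle_refl d)). apply Cmod_ge_0.
Qed.

Lemma ray_tail (a b : R) : (d <= a <= b)%R -> (Cmod (CRInt f a b) <= M / c * exp (- c * a))%R.
Proof.
  intros Hab. pose proof ray_M as HM.
  apply Rle_trans with (M / c * exp (- c * a) - M / c * exp (- c * b))%R.
  - apply Cmod_CRInt_le with (fun x => M * exp (- c * x))%R.
    + lra.
    + apply ray_ex; lra.
    + intros x Hx; apply Hf; lra.
    + apply is_RInt_exp_decay, Hc.
  - assert (0 <= M / c * exp (- c * b))%R; [|lra].
    apply Rmult_le_pos; [|left; apply exp_pos].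
    apply Rmult_le_pos; [exact HM|left; apply Rinv_0_lt_compat, Hc].
Qed.

Lemma ray_Chasles (a b : R) : (d <= a)%R -> (d <= b)%R ->
  CRInt f d b = CRInt f d a + CRInt f a b.
Proof.
  intros Ha Hb; symmetry.
  apply (RInt_Chasles (V := C_R_CompleteNormedModule)); apply ray_ex; lra.
Qed.

Lemma ray_ex_lim : exists l : C, lim_infty (fun b => CRInt f d b) l.
Proof.
  apply (filterlim_locally_cauchy (U := C_R_CompleteNormedModule)).
  intros eps. pose proof ray_M as HM.
  (* The added 1 avoids a division by zero when [M = 0]. *)
  set (B := (eps / (M / c + 1))%R).
  assert (HMc : (0 <= M / c)%R) by (apply Rmult_le_pos; [exact HM|left; apply Rinv_0_lt_compat, Hc]).
  assert (HB : (0 < B)%R) by (apply Rdiv_lt_0_compat; [apply cond_pos|lra]).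
  exists (fun x => (exp (- c * x) < B)%R /\ (d <= x)%R); split.
  - apply filter_and; [apply exp_decay_lim; assumption|].
    exists d; intros x Hx; lra.
  - assert (W : forall u v, (exp (- c * u) < B)%R -> (d <= u <= v)%R ->
      (Cmod (CRInt f d v - CRInt f d u) < eps)%R).
    { intros u v Hu Huv. rewrite (ray_Chasles u v) by lra.
      rewrite Cplus_minus_l.
      apply Rle_lt_trans with (1 := ray_tail u v Huv).
      apply Rle_lt_trans with (M / c * B)%R.
      - apply Rmult_le_compat_l; [exact HMc|lra].
      - unfold B. apply Rmult_lt_reg_r with (M / c + 1)%R; [lra|].
        replace (M / c * (eps / (M / c + 1)) * (M / c + 1))%R with (M / c * eps)%R by (field; lra).
        pose proof (cond_pos eps). nra. }
    intros u v [Hu1 Hu2] [Hv1 Hv2].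
    apply C_NormedModule_mixin_compat1.
    destruct (Rle_lt_dec u v) as [Huv|Huv].
    + apply W; [exact Hu1|lra].
    + apply Rle_lt_trans with (Cmod (CRInt f d u - CRInt f d v)); [right|apply W; [exact Hv1|lra]].
      transitivity (Cmod (- (CRInt f d u - CRInt f d v))); [|apply Cmod_opp].
      apply f_equal; symmetry; exact (Copp_minus_distr (CRInt f d u) (CRInt f d v)).
Qed.

(** Connects the improper integral in [loop_integral] with the limit of truncated integrals, on
    which all contour deformations are carried out. *)
Lemma ray_limit : exists l : C, lim_infty (fun b => CRInt f d b) l /\
  is_RInt_gen (V := C_R_NormedModule) f (at_point d) (Rbar_locally p_infty) l /\
  (Cmod l <= M / c * exp (- c * d))%R.
Proof.
  destruct ray_ex_lim as [l Hl]; exists l; split; [exact Hl|split].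
  - intros P HP. specialize (Hl P HP). destruct Hl as [N HN].
    exists (fun x => x = d) (fun y => (Rmax N d < y)%R).
    + reflexivity.
    + exists (Rmax N d); auto.
    + intros x y -> Hy. exists (CRInt f d y); split; simpl.
      * apply (CRInt_correct), ray_ex; [lra|].
        pose proof (Rmax_r N d); lra.
      * apply HN. pose proof (Rmax_l N d); lra.
  - apply (filterlim_Cmod_le (Rbar_locally p_infty) _ l _ Hl).
    exists d; intros x Hx. apply ray_tail; lra.
Qed.

End Ray.

(** * Loop integrals *)

(** As a point set only: both rays have the same trace, so one clause covers them. *)
Definition contour (alpha delta : R) (t : C) : Prop :=
  (exists rho, (delta <= rho)%R /\ t = polar rho alpha) \/ (exists phi, t = polar delta phi).

(** Required on the incoming ray only; the outgoing one differs by the constant monodromy factor. *)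
Definition decays (s : C) (g : C -> C) (alpha delta : R) : Prop :=
  exists M c : R, (0 < c)%R /\
    forall rho, (delta <= rho)%R -> (Cmod (integrand s g rho alpha) <= M * exp (- c * rho))%R.

Definition loop_ok (s : C) (g : C -> C) (alpha delta : R) : Prop :=
  (0 < delta)%R /\ C1_on (contour alpha delta) g /\ decays s g alpha delta.

(** The loop cut off at radius [r]. Identities between loops are proved for it, up to terms
    vanishing as [r] grows, and then passed to the limit by [loop_integral_unique]. *)
Definition trunc_loop (s : C) (g : C -> C) (alpha delta r : R) : C :=
  - CRInt (fun rho => radial_form s g rho alpha) delta r
  + CRInt (angular_form s g delta) alpha (alpha + 2 * PI)
  + CRInt (fun rho => radial_form s g rho (alpha + 2 * PI)) delta r.

Lemma lim_infty_plus (f g : R -> C) (l m : C) :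
  lim_infty f l -> lim_infty g m -> lim_infty (fun x => f x + g x) (l + m).
Proof. apply filterlim_Cplus; exact _. Qed.

Lemma lim_infty_scal (f : R -> C) (k l : C) :
  lim_infty f l -> lim_infty (fun x => k * f x) (k * l).
Proof. apply filterlim_Cscal; exact _. Qed.

Lemma contour_ray (alpha delta rho : R) : (delta <= rho)%R -> contour alpha delta (polar rho alpha).
Proof. intros H; left; exists rho; auto. Qed.

Lemma contour_ray_2PI (alpha delta rho : R) :
  (delta <= rho)%R -> contour alpha delta (polar rho (alpha + 2 * PI)).
Proof. rewrite polar_2PI; apply contour_ray. Qed.

Lemma contour_circle (alpha delta phi : R) : contour alpha delta (polar delta phi).
Proof. right; exists phi; reflexivity. Qed.

Lemma decays_2PI (s : C) (g : C -> C) (alpha delta : R) :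
  decays s g alpha delta -> decays s g (alpha + 2 * PI) delta.
Proof.
  intros (M & c & Hc & HM); exists (exp (2 * PI * Im s) * M)%R, c; split; [exact Hc|].
  intros rho Hr; rewrite Cmod_integrand_2PI, (Rmult_assoc (exp (2 * PI * Im s))).
  apply Rmult_le_compat_l; [left; apply exp_pos|apply HM, Hr].
Qed.

Lemma radial_form_ray_limit (s : C) (g : C -> C) (alpha delta phi M c : R) :
  (0 < delta)%R -> C1_on (contour alpha delta) g ->
  (phi = alpha \/ phi = alpha + 2 * PI)%R -> (0 < c)%R ->
  (forall rho, (delta <= rho)%R -> (Cmod (integrand s g rho phi) <= M * exp (- c * rho))%R) ->
  exists l : C, lim_infty (fun r => CRInt (fun rho => radial_form s g rho phi) delta r) l /\
    is_RInt_gen (V := C_R_NormedModule) (fun rho => radial_form s g rho phi)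
      (at_point delta) (Rbar_locally p_infty) l /\
    (Cmod l <= M / c * exp (- c * delta))%R.
Proof.
  intros Hd Hg Hphi Hc HM; apply ray_limit; [exact Hc| |].
  - intros r Hr; apply (continuous_radial_form _ s g Hg); [lra|].
    destruct Hphi; subst phi; [apply contour_ray|apply contour_ray_2PI]; exact Hr.
  - intros r Hr; rewrite Cmod_radial_form; apply HM, Hr.
Qed.

Lemma loop_integral_E (s : C) (g : C -> C) (alpha delta : R) :
  loop_integral s g alpha delta =
  - RInt_gen (V := C_R_CompleteNormedModule) (fun rho => radial_form s g rho alpha)
      (at_point delta) (Rbar_locally p_infty)
  + CRInt (angular_form s g delta) alpha (alpha + 2 * PI)
  + RInt_gen (V := C_R_CompleteNormedModule) (fun rho => radial_form s g rho (alpha + 2 * PI))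
      (at_point delta) (Rbar_locally p_infty).
Proof. reflexivity. Qed.

Lemma loop_integral_lim (s : C) (g : C -> C) (alpha delta : R) :
  loop_ok s g alpha delta ->
  lim_infty (trunc_loop s g alpha delta) (loop_integral s g alpha delta).
Proof.
  intros (Hd & Hg & Hdec).
  destruct (decays_2PI _ _ _ _ Hdec) as (M2 & c2 & Hc2 & HM2).
  destruct Hdec as (M1 & c1 & Hc1 & HM1).
  destruct (radial_form_ray_limit s g alpha delta alpha M1 c1 Hd Hg (or_introl eq_refl) Hc1 HM1)
    as (l1 & L1 & E1%(is_RInt_gen_unique (V := C_R_CompleteNormedModule)) & _).
  destruct (radial_form_ray_limit s g alpha delta (alpha + 2 * PI) M2 c2 Hd Hg (or_intror eq_refl) Hc2 HM2)
    as (l2 & L2 & E2%(is_RInt_gen_unique (V := C_R_CompleteNormedModule)) & _).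
  rewrite loop_integral_E, E1, E2.
  apply lim_infty_plus; [apply lim_infty_plus; [|apply filterlim_const]|exact L2].
  apply (filterlim_ext (fun r => - (1) * CRInt (fun rho => radial_form s g rho alpha) delta r)).
  - intros r; apply C_ext; csimpl; ring.
  - replace (- l1) with (- (1) * l1) by ring. apply lim_infty_scal; exact L1.
Qed.

Lemma loop_integral_unique (s : C) (g : C -> C) (alpha delta : R) (l : C) :
  loop_ok s g alpha delta -> lim_infty (trunc_loop s g alpha delta) l ->
  loop_integral s g alpha delta = l.
Proof.
  intros Hok Hl; exact (filterlim_Cunique (Rbar_locally p_infty) _ _ _ (loop_integral_lim _ _ _ _ Hok) Hl).
Qed.

Lemma ex_angular_form (s : C) (g : C -> C) (alpha delta a b : R) :
  C1_on (contour alpha delta) g -> ex_CRInt (angular_form s g delta) a b.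
Proof.
  intros Hg; apply ex_CRInt_continuous; intros t _.
  apply (continuous_angular_form _ s g Hg), contour_circle.
Qed.

Lemma ex_radial_form (s : C) (g : C -> C) (alpha delta a b : R) :
  (0 < delta)%R -> C1_on (contour alpha delta) g -> (delta <= a)%R -> (delta <= b)%R ->
  ex_CRInt (fun rho => radial_form s g rho alpha) a b.
Proof.
  intros Hd Hg Ha Hb; apply ex_CRInt_continuous; intros t [Ht _].
  assert (delta <= t)%R by (apply Rle_trans with (2 := Ht), Rmin_glb; assumption).
  apply (continuous_radial_form _ s g Hg); [lra|apply contour_ray; assumption].
Qed.

Lemma ex_radial_form_2PI (s : C) (g : C -> C) (alpha delta a b : R) :
  (0 < delta)%R -> C1_on (contour alpha delta) g -> (delta <= a)%R -> (delta <= b)%R ->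
  ex_CRInt (fun rho => radial_form s g rho (alpha + 2 * PI)) a b.
Proof.
  intros Hd Hg Ha Hb; apply ex_CRInt_continuous; intros t [Ht _].
  assert (delta <= t)%R by (apply Rle_trans with (2 := Ht), Rmin_glb; assumption).
  apply (continuous_radial_form _ s g Hg); [lra|apply contour_ray_2PI; assumption].
Qed.

(** Each ray contributes at most the integral of M e^(-c rho) from delta on, the outgoing one
    multiplied by e^(2 pi Im s). *)
Lemma loop_circle_approx (s : C) (g : C -> C) (alpha delta M c : R) :
  (0 < delta)%R -> C1_on (contour alpha delta) g -> (0 < c)%R ->
  (forall rho, (delta <= rho)%R -> (Cmod (integrand s g rho alpha) <= M * exp (- c * rho))%R) ->
  (Cmod (loop_integral s g alpha delta - CRInt (angular_form s g delta) alpha (alpha + 2 * PI)) <=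
   (1 + exp (2 * PI * Im s)) * (M / c * exp (- c * delta)))%R.
Proof.
  intros Hd Hg Hc HM.
  assert (HM2 : forall rho, (delta <= rho)%R ->
    (Cmod (integrand s g rho (alpha + 2 * PI)) <= exp (2 * PI * Im s) * M * exp (- c * rho))%R).
  { intros rho Hr; rewrite Cmod_integrand_2PI, (Rmult_assoc (exp (2 * PI * Im s))).
    apply Rmult_le_compat_l; [left; apply exp_pos|apply HM, Hr]. }
  destruct (radial_form_ray_limit s g alpha delta alpha M c Hd Hg (or_introl eq_refl) Hc HM)
    as (l1 & _ & E1%(is_RInt_gen_unique (V := C_R_CompleteNormedModule)) & B1).
  destruct (radial_form_ray_limit s g alpha delta (alpha + 2 * PI) _ c Hd Hg (or_intror eq_refl) Hc HM2)
    as (l2 & _ & E2%(is_RInt_gen_unique (V := C_R_CompleteNormedModule)) & B2).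
  rewrite loop_integral_E, E1, E2.
  replace (- l1 + CRInt (angular_form s g delta) alpha (alpha + 2 * PI) + l2
    - CRInt (angular_form s g delta) alpha (alpha + 2 * PI)) with (- l1 + l2) by (apply C_ext; csimpl; ring).
  apply Rle_trans with (1 := Cmod_triangle _ _). rewrite Cmod_opp.
  unfold Rdiv in *. nra.
Qed.

Lemma loop_bound (s : C) (g : C -> C) (alpha delta M c N : R) :
  (0 < delta)%R -> C1_on (contour alpha delta) g -> (0 < c)%R ->
  (forall rho, (delta <= rho)%R -> (Cmod (integrand s g rho alpha) <= M * exp (- c * rho))%R) ->
  (forall phi, (alpha <= phi <= alpha + 2 * PI)%R -> (Cmod (integrand s g delta phi) <= N)%R) ->
  (Cmod (loop_integral s g alpha delta) <=
   (1 + exp (2 * PI * Im s)) * (M / c * exp (- c * delta)) + 2 * PI * (N * delta))%R.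
Proof.
  intros Hd Hg Hc HM HN.
  pose proof (loop_circle_approx s g alpha delta M c Hd Hg Hc HM) as B1.
  assert (B3 : (Cmod (CRInt (angular_form s g delta) alpha (alpha + 2 * PI)) <= 2 * PI * (N * delta))%R).
  { pose proof PI_RGT_0.
    replace (2 * PI * (N * delta))%R with ((alpha + 2 * PI - alpha) * (N * delta))%R by ring.
    apply Cmod_CRInt_le_const; [lra|apply (ex_angular_form s g alpha); exact Hg|].
    intros p Hp; rewrite Cmod_angular_form by lra.
    apply Rmult_le_compat_r; [lra|apply HN, Hp]. }
  pose proof (Cmod_triangle (loop_integral s g alpha delta - CRInt (angular_form s g delta) alpha (alpha + 2 * PI))
    (CRInt (angular_form s g delta) alpha (alpha + 2 * PI))) as T.
  replace (loop_integral s g alpha delta - CRInt (angular_form s g delta) alpha (alpha + 2 * PI)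
    + CRInt (angular_form s g delta) alpha (alpha + 2 * PI)) with (loop_integral s g alpha delta) in T
    by (apply C_ext; csimpl; ring).
  lra.
Qed.

Lemma loop_ok_plus (s : C) (g h : C -> C) (alpha delta : R) :
  loop_ok s g alpha delta -> loop_ok s h alpha delta ->
  loop_ok s (fun t => g t + h t) alpha delta.
Proof.
  intros (Hd & Hg & M1 & c1 & Hc1 & HM1) (_ & Hh & M2 & c2 & Hc2 & HM2).
  split; [exact Hd|split; [apply C1_plus; assumption|]].
  exists (M1 + M2)%R, (Rmin c1 c2); split; [apply Rmin_glb_lt; assumption|].
  intros r Hr. unfold integrand. rewrite Cmult_plus_distr_l.
  apply Rle_trans with (1 := Cmod_triangle _ _). rewrite Rmult_plus_distr_r.
  assert (W : forall M c g, (Cmod (integrand s g r alpha) <= M * exp (- c * r))%R ->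
     (Rmin c1 c2 <= c)%R -> (Cmod (integrand s g r alpha) <= M * exp (- Rmin c1 c2 * r))%R).
  { intros M c k Hk Hcc. apply Rle_trans with (1 := Hk).
    apply Rmult_le_compat_l.
    - apply Rmult_le_reg_r with (exp (- c * r)); [apply exp_pos|].
      rewrite Rmult_0_l. apply Rle_trans with (2 := Hk), Cmod_ge_0.
    - apply exp_le_compat. apply Rmult_le_compat_r; lra. }
  apply Rplus_le_compat.
  - apply (W _ c1 g); [apply HM1, Hr|apply Rmin_l].
  - apply (W _ c2 h); [apply HM2, Hr|apply Rmin_r].
Qed.

Lemma integrand_scal (s k : C) (g : C -> C) (r p : R) :
  integrand s (fun t => k * g t) r p = k * integrand s g r p.
Proof. unfold integrand; ring. Qed.

Lemma loop_ok_scal (s k : C) (g : C -> C) (alpha delta : R) :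
  loop_ok s g alpha delta -> loop_ok s (fun t => k * g t) alpha delta.
Proof.
  intros (Hd & Hg & M1 & c1 & Hc1 & HM1).
  split; [exact Hd|split; [apply C1_mult; [apply C1_const|exact Hg]|]].
  exists (Cmod k * M1)%R, c1; split; [exact Hc1|].
  intros r Hr. rewrite integrand_scal, Cmod_mult, (Rmult_assoc (Cmod k)).
  apply Rmult_le_compat_l; [apply Cmod_ge_0|apply HM1, Hr].
Qed.

Lemma CRInt_plus (f g : R -> C) (a b : R) : ex_CRInt f a b -> ex_CRInt g a b ->
  CRInt (fun t => f t + g t) a b = CRInt f a b + CRInt g a b.
Proof. apply (RInt_plus (V := C_R_CompleteNormedModule)). Qed.

(** Scalars of [C_R_NormedModule] are real; a complex factor mixes the two components, so these are
    integrated separately. *)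
Lemma is_CRInt_Cscal (k : C) (f : R -> C) (a b : R) : ex_CRInt f a b ->
  is_CRInt (fun t => k * f t) a b (k * CRInt f a b).
Proof.
  intros Hf. assert (H1 := Re_CRInt f a b Hf). assert (H2 := Im_CRInt f a b Hf).
  apply is_CRInt_components.
  - apply (is_RInt_minus (V := R_NormedModule)); apply (is_RInt_scal (V := R_NormedModule)); assumption.
  - apply (is_RInt_plus (V := R_NormedModule)); apply (is_RInt_scal (V := R_NormedModule)); assumption.
Qed.

Lemma CRInt_Cscal (k : C) (f : R -> C) (a b : R) : ex_CRInt f a b ->
  CRInt (fun t => k * f t) a b = k * CRInt f a b.
Proof.
  intros H; exact (is_CRInt_unique _ _ _ _ (is_CRInt_Cscal k f a b H)).
Qed.

Lemma CRInt_ext (f g : R -> C) (a b : R) :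
  (forall x, (Rmin a b < x < Rmax a b)%R -> f x = g x) -> CRInt f a b = CRInt g a b.
Proof. apply (RInt_ext (V := C_R_CompleteNormedModule)). Qed.

Lemma near_infty_gt (d : R) : Rbar_locally p_infty (fun r => (d < r)%R).
Proof. exists d; auto. Qed.

Lemma loop_plus (s : C) (g h : C -> C) (alpha delta : R) :
  loop_ok s g alpha delta -> loop_ok s h alpha delta ->
  loop_integral s (fun t => g t + h t) alpha delta =
  loop_integral s g alpha delta + loop_integral s h alpha delta.
Proof.
  intros Hg Hh. apply loop_integral_unique; [apply loop_ok_plus; assumption|].
  eapply filterlim_ext_loc; [|apply lim_infty_plus; [apply (loop_integral_lim _ _ _ _ Hg)|apply (loop_integral_lim _ _ _ _ Hh)]].
  refine (filter_imp _ _ _ (near_infty_gt delta)); intros r Hr.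
  destruct Hg as (Hd & Hg & _), Hh as (_ & Hh & _).
  assert (E : forall a b, radial_form s (fun t => g t + h t) a b = radial_form s g a b + radial_form s h a b)
    by (intros; unfold radial_form, integrand; ring).
  assert (EQ : forall a b, angular_form s (fun t => g t + h t) a b = angular_form s g a b + angular_form s h a b)
    by (intros; unfold angular_form, integrand; ring).
  unfold trunc_loop.
  rewrite (CRInt_ext (fun rho => radial_form s (fun t => g t + h t) rho alpha) _ _ _ (fun x _ => E x alpha)).
  rewrite (CRInt_ext (fun rho => radial_form s (fun t => g t + h t) rho (alpha + 2 * PI)) _ _ _ (fun x _ => E x _)).
  rewrite (CRInt_ext (angular_form s (fun t => g t + h t) delta) _ _ _ (fun x _ => EQ delta x)).
  assert (X1g : ex_CRInt (fun rho => radial_form s g rho alpha) delta r)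
    by (apply (ex_radial_form s g alpha delta delta r Hd Hg); lra).
  assert (X2g : ex_CRInt (fun rho => radial_form s g rho (alpha + 2 * PI)) delta r)
    by (apply (ex_radial_form_2PI s g alpha delta delta r Hd Hg); lra).
  assert (X3g := ex_angular_form s g alpha delta alpha (alpha + 2 * PI) Hg).
  assert (X1h : ex_CRInt (fun rho => radial_form s h rho alpha) delta r)
    by (apply (ex_radial_form s h alpha delta delta r Hd Hh); lra).
  assert (X2h : ex_CRInt (fun rho => radial_form s h rho (alpha + 2 * PI)) delta r)
    by (apply (ex_radial_form_2PI s h alpha delta delta r Hd Hh); lra).
  assert (X3h := ex_angular_form s h alpha delta alpha (alpha + 2 * PI) Hh).
  rewrite (CRInt_plus _ _ _ _ X1g X1h), (CRInt_plus _ _ _ _ X2g X2h), (CRInt_plus _ _ _ _ X3g X3h).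
  ring.
Qed.

Lemma loop_scal (s k : C) (g : C -> C) (alpha delta : R) :
  loop_ok s g alpha delta ->
  loop_integral s (fun t => k * g t) alpha delta = k * loop_integral s g alpha delta.
Proof.
  intros Hg. apply loop_integral_unique; [apply loop_ok_scal; assumption|].
  eapply filterlim_ext_loc; [|apply lim_infty_scal, (loop_integral_lim _ _ _ _ Hg)].
  refine (filter_imp _ _ _ (near_infty_gt delta)); intros r Hr.
  destruct Hg as (Hd & Hg & _).
  assert (E : forall a b, radial_form s (fun t => k * g t) a b = k * radial_form s g a b)
    by (intros; unfold radial_form, integrand; ring).
  assert (EQ : forall a b, angular_form s (fun t => k * g t) a b = k * angular_form s g a b)
    by (intros; unfold angular_form, integrand; ring).
  unfold trunc_loop.
  rewrite (CRInt_ext (fun rho => radial_form s (fun t => k * g t) rho alpha) _ _ _ (fun x _ => E x alpha)).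
  rewrite (CRInt_ext (fun rho => radial_form s (fun t => k * g t) rho (alpha + 2 * PI)) _ _ _ (fun x _ => E x _)).
  rewrite (CRInt_ext (angular_form s (fun t => k * g t) delta) _ _ _ (fun x _ => EQ delta x)).
  assert (X1g : ex_CRInt (fun rho => radial_form s g rho alpha) delta r)
    by (apply (ex_radial_form s g alpha delta delta r Hd Hg); lra).
  assert (X2g : ex_CRInt (fun rho => radial_form s g rho (alpha + 2 * PI)) delta r)
    by (apply (ex_radial_form_2PI s g alpha delta delta r Hd Hg); lra).
  assert (X3g := ex_angular_form s g alpha delta alpha (alpha + 2 * PI) Hg).
  rewrite (CRInt_Cscal k _ _ _ X1g), (CRInt_Cscal k _ _ _ X2g), (CRInt_Cscal k _ _ _ X3g).
  ring.
Qed.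

(** Agreement on the contour suffices. This allows algebraic rewriting of quotients whose
    denominators vanish elsewhere. *)
Lemma loop_ext (s : C) (g h : C -> C) (alpha delta : R) :
  (forall t, contour alpha delta t -> g t = h t) -> loop_ok s h alpha delta ->
  loop_integral s g alpha delta = loop_integral s h alpha delta.
Proof.
  intros E (Hd & Hh & Hdec).
  destruct (decays_2PI _ _ _ _ Hdec) as (M2 & c2 & Hc2 & HM2).
  destruct Hdec as (M1 & c1 & Hc1 & HM1).
  destruct (radial_form_ray_limit s h alpha delta alpha M1 c1 Hd Hh (or_introl eq_refl) Hc1 HM1)
    as (l1 & _ & E1 & _).
  destruct (radial_form_ray_limit s h alpha delta (alpha + 2 * PI) M2 c2 Hd Hh (or_intror eq_refl) Hc2 HM2)
    as (l2 & _ & E2 & _).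
  assert (W : forall phi, (forall rho, (delta < rho)%R -> g (polar rho phi) = h (polar rho phi)) ->
    filter_prod (at_point delta) (Rbar_locally p_infty)
    (fun ab => forall x, (Rmin (fst ab) (snd ab) < x < Rmax (fst ab) (snd ab))%R ->
       radial_form s h x phi = radial_form s g x phi)).
  { intros phi Hphi. exists (fun x => x = delta) (fun y => (delta < y)%R).
    - reflexivity.
    - exists delta; auto.
    - intros x y -> Hy u Hu; simpl in Hu. rewrite Rmin_left in Hu by lra.
      unfold radial_form, integrand. rewrite Hphi by lra. reflexivity. }
  rewrite 2!loop_integral_E.
  rewrite <- (RInt_gen_ext (V := C_R_CompleteNormedModule) (fun rho => radial_form s h rho alpha) (fun rho => radial_form s g rho alpha)).
  - rewrite <- (RInt_gen_ext (V := C_R_CompleteNormedModule) (fun rho => radial_form s h rho (alpha + 2 * PI)) (fun rho => radial_form s g rho (alpha + 2 * PI))).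
    + do 2 f_equal. apply CRInt_ext; intros x _. unfold angular_form, integrand. rewrite E by apply contour_circle. reflexivity.
    + apply W; intros rho Hr; apply E, contour_ray_2PI; lra.
    + exists l2; exact E2.
  - apply W; intros rho Hr; apply E, contour_ray; lra.
  - exists l1; exact E1.
Qed.

Lemma CRInt_comp_lin (f : R -> C) (u v a b : R) : ex_CRInt f (u * a + v) (u * b + v) ->
  CRInt (fun y => u * f (u * y + v)%R) a b = CRInt f (u * a + v) (u * b + v).
Proof.
  intros H. rewrite <- (RInt_comp_lin (V := C_R_CompleteNormedModule) f u v a b H).
  apply CRInt_ext; intros x _. symmetry; exact (scal_R_Cmult u (f (u * x + v)%R)).
Qed.

Lemma lim_infty_comp_mult (f : R -> C) (k : R) (l : C) : (0 < k)%R ->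
  lim_infty f l -> lim_infty (fun r => f (k * r)%R) l.
Proof.
  intros Hk Hf P HP. destruct (Hf P HP) as [N HN].
  exists (N / k)%R; intros x Hx; apply HN.
  apply (Rmult_lt_compat_l k) in Hx; [|exact Hk].
  replace (k * (N / k))%R with N in Hx by (field; lra). exact Hx.
Qed.

Section Scale.
Context (s : C) (g : C -> C) (alpha delta k psi : R).
Hypothesis Hk : (0 < k)%R.
Hypothesis Hok : loop_ok s g (alpha + psi) (k * delta).

Lemma integrand_scale (r p : R) : (0 < r)%R ->
  integrand s (fun t => g (polar k psi * t)) r p =
  Cexp (s * (ln k, psi)) * integrand s g (k * r) (p + psi).
Proof.
  intros Hr. unfold integrand. rewrite Cmult_assoc, <- Cexp_plus, polar_mult, (Rplus_comm p psi).
  do 2 f_equal. rewrite ln_mult by assumption. apply C_ext; csimpl; ring.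
Qed.

Lemma scale_delta : (0 < delta)%R.
Proof. destruct Hok as [Hd _]. apply Rmult_lt_reg_l with k; lra. Qed.

Lemma loop_ok_scale : loop_ok s (fun t => g (polar k psi * t)) alpha delta.
Proof.
  pose proof scale_delta as Hd.
  destruct Hok as (_ & Hg & M & c & Hc & HM). split; [exact Hd|split].
  - apply (C1_comp (contour (alpha + psi) (k * delta))); [exact Hg| |].
    + apply C1_mult; [apply C1_const|apply C1_id].
    + intros w [(rho & Hr & ->)|(phi & ->)]; rewrite polar_mult, (Rplus_comm psi).
      * apply contour_ray, Rmult_le_compat_l; lra.
      * apply contour_circle.
  - exists (Cmod (Cexp (s * (ln k, psi))) * M)%R, (c * k)%R; split; [apply Rmult_lt_0_compat; assumption|].
    intros rho Hr. rewrite integrand_scale, Cmod_mult, (Rmult_assoc (Cmod _)) by lra.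
    apply Rmult_le_compat_l; [apply Cmod_ge_0|].
    replace (- (c * k) * rho)%R with (- c * (k * rho))%R by ring.
    apply HM, Rmult_le_compat_l; lra.
Qed.

(** The substitution tau = k e^(i psi) t. Since the argument is carried along continuously, the
    factor is the power with argument exactly [psi]; the exponent s - 1 combines t^(-s) with dt. *)
Lemma loop_scale :
  loop_integral s (fun t => g (polar k psi * t)) alpha delta =
  Cexp ((s - 1) * (ln k, psi)) * loop_integral s g (alpha + psi) (k * delta).
Proof.
  pose proof scale_delta as Hd.
  apply loop_integral_unique; [exact loop_ok_scale|].
  eapply filterlim_ext_loc; [|apply lim_infty_scal, (lim_infty_comp_mult _ k _ Hk (loop_integral_lim _ _ _ _ Hok))].
  refine (filter_imp _ _ _ (near_infty_gt delta)); intros r Hr.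
  destruct Hok as (Hkd & Hg & _).
  assert (EK : Cexp (s * (ln k, psi)) = Cexp ((s - 1) * (ln k, psi)) * (k * polar 1 psi)).
  { rewrite <- polar_scal, polar_Cexp, <- Cexp_plus by exact Hk. f_equal. ring. }
  (* The affine arguments k a + 0 here and 1 b + psi below have the shape of the linear change of
     variables [CRInt_comp_lin]. *)
  assert (EP : forall a b, (0 < a)%R -> radial_form s (fun t => g (polar k psi * t)) a b =
    Cexp ((s - 1) * (ln k, psi)) * (k * radial_form s g (k * a + 0) (b + psi))).
  { intros a b Ha. unfold radial_form. rewrite integrand_scale, EK, Rplus_0_r by exact Ha.
    replace (polar 1 (b + psi)) with (polar 1 b * polar 1 psi) by (rewrite polar_mult; f_equal; ring).
    ring. }
  assert (EQ : forall b, angular_form s (fun t => g (polar k psi * t)) delta b =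
    Cexp ((s - 1) * (ln k, psi)) * (1%R * angular_form s g (k * delta) (1 * b + psi))).
  { intros b. unfold angular_form. rewrite integrand_scale, EK, Rmult_1_l by exact Hd.
    replace (polar (k * delta) (b + psi)) with (polar delta b * (k * polar 1 psi)).
    - ring.
    - rewrite <- polar_scal, polar_mult; f_equal; ring. }
  assert (H1 : (0 <= k * r - k * delta)%R) by (rewrite <- Rmult_minus_distr_l; apply Rmult_le_pos; lra).
  assert (X1 : ex_CRInt (fun rho => radial_form s g rho (alpha + psi)) (k * delta + 0) (k * r + 0)).
  { apply (ex_radial_form _ _ _ (k * delta)); [exact Hkd|exact Hg|lra|lra]. }
  assert (X2 : ex_CRInt (fun rho => radial_form s g rho (alpha + psi + 2 * PI)) (k * delta + 0) (k * r + 0)).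
  { apply (ex_radial_form_2PI _ _ _ (k * delta)); [exact Hkd|exact Hg|lra|lra]. }
  assert (X3 : forall a b, ex_CRInt (angular_form s g (k * delta)) a b).
  { intros a b; apply (ex_angular_form s g (alpha + psi)); exact Hg. }
  unfold trunc_loop.
  rewrite (CRInt_ext (fun rho => radial_form s (fun t => g (polar k psi * t)) rho alpha)
    (fun rho => Cexp ((s - 1) * (ln k, psi)) * (k * radial_form s g (k * rho + 0) (alpha + psi)))).
  2: { intros x Hx; apply EP. rewrite Rmin_left in Hx; lra. }
  rewrite (CRInt_ext (fun rho => radial_form s (fun t => g (polar k psi * t)) rho (alpha + 2 * PI))
    (fun rho => Cexp ((s - 1) * (ln k, psi)) * (k * radial_form s g (k * rho + 0) (alpha + psi + 2 * PI)))).
  2: { intros x Hx. replace (alpha + psi + 2 * PI)%R with (alpha + 2 * PI + psi)%R by ring.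
       apply EP. rewrite Rmin_left in Hx; lra. }
  rewrite (CRInt_ext (angular_form s (fun t => g (polar k psi * t)) delta) _ _ _ (fun x _ => EQ x)).
  assert (Y : forall f u v a b, ex_CRInt f (u * a + v)%R (u * b + v)%R ->
     CRInt (fun x => Cexp ((s - 1) * (ln k, psi)) * (u * f (u * x + v)%R)) a b =
     Cexp ((s - 1) * (ln k, psi)) * CRInt f (u * a + v) (u * b + v)).
  { intros f u v a b Hf. rewrite CRInt_Cscal, CRInt_comp_lin; [reflexivity|exact Hf|].
    assert (Hf' := ex_RInt_comp_lin (V := C_R_NormedModule) f u v a b Hf).
    refine (ex_RInt_ext _ _ _ _ _ Hf'). intros x _; exact (scal_R_Cmult u (f (u * x + v)%R)). }
  rewrite (Y (fun rho => radial_form s g rho (alpha + psi)) k 0%R _ _ X1).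
  rewrite (Y (fun rho => radial_form s g rho (alpha + psi + 2 * PI)) k 0%R _ _ X2).
  rewrite (Y (angular_form s g (k * delta)) 1%R psi) by apply X3.
  rewrite !Rplus_0_r, !Rmult_1_l.
  replace (alpha + 2 * PI + psi)%R with (alpha + psi + 2 * PI)%R by ring.
  ring.
Qed.

End Scale.

Lemma CRInt_Chasles (f : R -> C) (a b c : R) : ex_CRInt f a b -> ex_CRInt f b c ->
  CRInt f a b + CRInt f b c = CRInt f a c.
Proof. apply (RInt_Chasles (V := C_R_CompleteNormedModule)). Qed.

(** Green's theorem on the annulus between the two radii, slit along the ray: its two straight edges
    are the ray pieces by which the loops differ. *)
Lemma loop_shrink (U : C -> Prop) (s : C) (g : C -> C) (alpha d1 d2 e : R) :
  C1_on U g -> (0 < e <= d1)%R -> (d1 <= d2)%R ->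
  (forall r p, (d1 - e < r < d2 + e)%R -> U (polar r p)) ->
  loop_ok s g alpha d1 -> loop_ok s g alpha d2 ->
  loop_integral s g alpha d1 = loop_integral s g alpha d2.
Proof.
  intros Hg He H12 HU Hok1 Hok2. pose proof PI_RGT_0 as HPI.
  apply loop_integral_unique; [exact Hok1|].
  eapply filterlim_ext_loc; [|apply (loop_integral_lim _ _ _ _ Hok2)].
  refine (filter_imp _ _ _ (near_infty_gt d2)); intros r Hr.
  destruct Hok1 as (Hd1 & Hg1 & _), Hok2 as (Hd2 & Hg2 & _).
  assert (G := integrand_green U s g Hg d1 d2 alpha (alpha + 2 * PI) e He H12 ltac:(lra) (fun r p H _ => HU r p H)).
  unfold trunc_loop.
  rewrite <- (CRInt_Chasles (fun rho => radial_form s g rho alpha) d1 d2 r);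
    [|apply (ex_radial_form _ _ _ d1); first [assumption|lra]..].
  rewrite <- (CRInt_Chasles (fun rho => radial_form s g rho (alpha + 2 * PI)) d1 d2 r);
    [|apply (ex_radial_form_2PI _ _ _ d1); first [assumption|lra]..].
  replace (CRInt (angular_form s g d2) alpha (alpha + 2 * PI)) with
    (CRInt (angular_form s g d2) alpha (alpha + 2 * PI) - CRInt (angular_form s g d1) alpha (alpha + 2 * PI)
     + CRInt (angular_form s g d1) alpha (alpha + 2 * PI)) by (apply C_ext; csimpl; ring).
  rewrite <- G. apply C_ext; csimpl; ring.
Qed.

(** Half of the exponent absorbs the factor r, because r <= (2/c) e^(c r/2). *)
Lemma lim_infty_mult_exp (c K : R) : (0 < c)%R ->
  forall eps, (0 < eps)%R -> Rbar_locally p_infty (fun r => (K * (r * exp (- c * r)) < eps)%R).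
Proof.
  intros Hc eps Heps.
  set (B := (eps / (Rabs K * (2 / c) + 1))%R).
  pose proof (Rabs_pos K) as HK.
  assert (Hc2 : (0 < 2 / c)%R) by (apply Rdiv_lt_0_compat; lra).
  assert (HB : (0 < B)%R) by (apply Rdiv_lt_0_compat; [exact Heps|nra]).
  refine (filter_imp (F := Rbar_locally p_infty) _ _ _ (filter_and (F := Rbar_locally p_infty) _ _ (exp_decay_lim (c / 2) B ltac:(lra) HB) (near_infty_gt 0))).
  intros r [H1 H2].
  assert (H3 : (r <= 2 / c * exp (c / 2 * r))%R).
  { pose proof (exp_ineq1_le (c / 2 * r)) as X.
    replace r with (2 / c * (c / 2 * r))%R at 1 by (field; lra).
    apply Rmult_le_compat_l; lra. }
  assert (H4 : (exp (- c * r) = exp (- (c / 2) * r) * exp (- (c / 2) * r))%R).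
  { rewrite <- exp_plus; f_equal; field. }
  assert (H5 : (exp (c / 2 * r) * exp (- (c / 2) * r) = 1)%R).
  { rewrite <- exp_plus, <- exp_0; f_equal; ring. }
  pose proof (exp_pos (- (c / 2) * r)) as H6.
  assert (H7 : (r * exp (- c * r) <= 2 / c * exp (- (c / 2) * r))%R).
  { rewrite H4. apply Rle_trans with (2 / c * exp (c / 2 * r) * (exp (- (c / 2) * r) * exp (- (c / 2) * r)))%R.
    - apply Rmult_le_compat_r; [nra|exact H3].
    - right. transitivity (2 / c * (exp (c / 2 * r) * exp (- (c / 2) * r)) * exp (- (c / 2) * r))%R; [ring|].
      rewrite H5; ring. }
  assert (H8 : (0 <= r * exp (- c * r))%R) by (apply Rmult_le_pos; [lra|left; apply exp_pos]).
  apply Rle_lt_trans with (Rabs K * (2 / c) * exp (- (c / 2) * r))%R.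
  - apply Rle_trans with (Rabs K * (r * exp (- c * r)))%R.
    + apply Rmult_le_compat_r; [exact H8|apply Rle_abs].
    + rewrite Rmult_assoc. apply Rmult_le_compat_l; [exact HK|exact H7].
  - apply Rle_lt_trans with (Rabs K * (2 / c) * B)%R.
    + apply Rmult_le_compat_l; [nra|lra].
    + unfold B. apply Rmult_lt_reg_r with (Rabs K * (2 / c) + 1)%R; [nra|].
      replace (Rabs K * (2 / c) * (eps / (Rabs K * (2 / c) + 1)) * (Rabs K * (2 / c) + 1))%R
        with (Rabs K * (2 / c) * eps)%R by (field; nra).
      nra.
Qed.

Lemma lim_infty_plus_small (f h : R -> C) (l : C) (K c : R) : (0 < c)%R ->
  lim_infty f l -> Rbar_locally p_infty (fun r => (Cmod (h r) <= K * (r * exp (- c * r)))%R) ->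
  lim_infty (fun r => f r + h r) l.
Proof.
  intros Hc Hf Hh. rewrite <- (Cplus_0_r l). apply lim_infty_plus; [exact Hf|].
  apply locally_C_Cmod; [exact _|]. intros eps He.
  refine (filter_imp (F := Rbar_locally p_infty) _ _ _ (filter_and (F := Rbar_locally p_infty) _ _ Hh (lim_infty_mult_exp c K Hc eps He))).
  intros r [H1 H2]. replace (h r - 0) with (h r) by ring. lra.
Qed.

Section Rotate.
Context (U : C -> Prop) (s : C) (g : C -> C) (a1 a2 d M c e : R).
Hypothesis Hg : C1_on U g.
Hypothesis He : (0 < e <= d)%R.
Hypothesis H12 : (a1 <= a2)%R.
Hypothesis Hc : (0 < c)%R.
Hypothesis HUs : forall r p, (d - e < r)%R -> (a1 - e < p < a2 + e)%R -> U (polar r p).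
Hypothesis HUc : forall p, U (polar d p).
Hypothesis HM : forall r p, (d <= r)%R -> (a1 <= p <= a2)%R -> (Cmod (integrand s g r p) <= M * exp (- c * r))%R.

Lemma loop_ok_rotate (a : R) : (a1 <= a <= a2)%R -> loop_ok s g a d.
Proof.
  intros Ha; split; [lra|split].
  - apply (C1_subset U); [|exact Hg].
    intros w [(r & Hr & ->)|(p & ->)]; [apply HUs; lra|apply HUc].
  - exists M, c; split; [exact Hc|]. intros r Hr; apply HM; assumption.
Qed.

(** Green's theorem on the sector swept by the incoming ray and on its copy shifted by 2 pi, swept
    by the outgoing ray. The far arcs are O(r e^(-c r)) and vanish in the limit. *)
Lemma loop_rotate : loop_integral s g a1 d = loop_integral s g a2 d.
Proof.
  assert (Hok1 := loop_ok_rotate a1 ltac:(lra)). assert (Hok2 := loop_ok_rotate a2 ltac:(lra)).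
  apply loop_integral_unique; [exact Hok1|].
  (* The two far arcs at radius [r], by which the truncated loops differ. *)
  pose (h r := CRInt (angular_form s g r) a1 a2 - CRInt (angular_form s g r) (a1 + 2 * PI) (a2 + 2 * PI)).
  apply (filterlim_ext_loc (fun r => trunc_loop s g a2 d r + h r)).
  - refine (filter_imp _ _ _ (near_infty_gt d)); intros r Hr.
    assert (G := integrand_green U s g Hg d r a1 a2 e He ltac:(lra) H12
      ltac:(intros r' p' A B; apply HUs; lra)).
    assert (G' := integrand_green U s g Hg d r (a1 + 2 * PI) (a2 + 2 * PI) e He ltac:(lra) ltac:(lra)
      ltac:(intros r' p' A B; replace p' with (p' - 2 * PI + 2 * PI)%R by ring;
            rewrite polar_2PI; apply HUs; lra)).
    destruct Hok1 as (_ & Hg1 & _).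
    assert (X : forall x y, ex_CRInt (angular_form s g d) x y) by (intros; apply (ex_angular_form s g a1); exact Hg1).
    (* The arc of the small circle from [a1] to [a2 + 2 * PI], cut in two ways, reconciles the two
       starting points of the full circle. *)
    assert (CH : CRInt (angular_form s g d) a1 (a1 + 2 * PI) + CRInt (angular_form s g d) (a1 + 2 * PI) (a2 + 2 * PI) =
                 CRInt (angular_form s g d) a1 a2 + CRInt (angular_form s g d) a2 (a2 + 2 * PI)).
    { rewrite 2!CRInt_Chasles by apply X. reflexivity. }
    unfold trunc_loop, h.
    apply (f_equal Re) in G as G1; apply (f_equal Im) in G as G2.
    apply (f_equal Re) in G' as G1'; apply (f_equal Im) in G' as G2'.
    apply (f_equal Re) in CH as CH1; apply (f_equal Im) in CH as CH2.
    clear G G' CH. apply C_ext; csimpl; lra.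
  - assert (HM' : forall r p, (d <= r)%R -> (a1 + 2 * PI <= p <= a2 + 2 * PI)%R ->
       (Cmod (integrand s g r p) <= exp (2 * PI * Im s) * M * exp (- c * r))%R).
    { intros r p Hr Hp; replace p with (p - 2 * PI + 2 * PI)%R by ring.
      rewrite Cmod_integrand_2PI, (Rmult_assoc (exp (2 * PI * Im s))).
      apply Rmult_le_compat_l; [left; apply exp_pos|apply HM; lra]. }
    assert (EX : forall r a b, (d < r)%R -> (forall p, (a <= p <= b)%R -> U (polar r p)) -> (a <= b)%R ->
      ex_CRInt (angular_form s g r) a b).
    { intros r a b Hr HUp Hab; apply ex_CRInt_continuous; intros t Ht.
      rewrite Rmin_left, Rmax_right in Ht by lra. apply (continuous_angular_form U s g Hg), HUp, Ht. }
    apply (lim_infty_plus_small _ _ _ ((1 + exp (2 * PI * Im s)) * (M * (a2 - a1)))%R c Hc).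
    + apply loop_integral_lim; exact Hok2.
    + refine (filter_imp _ _ _ (near_infty_gt d)); intros r Hr. unfold h.
      apply Rle_trans with (1 := Cmod_triangle _ _). rewrite Cmod_opp.
      assert (B1 : (Cmod (CRInt (angular_form s g r) a1 a2) <= (a2 - a1) * (M * exp (- c * r) * r))%R).
      { apply Cmod_CRInt_le_const; [lra| |].
        - apply EX; [lra| |lra]. intros p Hp; apply HUs; lra.
        - intros p Hp; rewrite Cmod_angular_form by lra. apply Rmult_le_compat_r; [lra|apply HM; lra]. }
      assert (B2 : (Cmod (CRInt (angular_form s g r) (a1 + 2 * PI) (a2 + 2 * PI)) <=
          (a2 + 2 * PI - (a1 + 2 * PI)) * (exp (2 * PI * Im s) * M * exp (- c * r) * r))%R).
      { apply Cmod_CRInt_le_const; [lra| |].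
        - apply EX; [lra| |lra]. intros p Hp; replace p with (p - 2 * PI + 2 * PI)%R by ring.
          rewrite polar_2PI; apply HUs; lra.
        - intros p Hp; rewrite Cmod_angular_form by lra. apply Rmult_le_compat_r; [lra|apply HM'; lra]. }
      eapply Rle_trans; [apply Rplus_le_compat; [exact B1|exact B2]|].
      right; ring.
Qed.

End Rotate.

(** * Termwise integration of a geometric series along a loop *)

Ltac toC := match goal with |- ?a = ?b => change (@eq C a b); cbv beta end.

Section Family.
Context (s : C) (g w : C -> C) (alpha delta M c N r : R).
Hypothesis Hd : (0 < delta)%R.
Hypothesis Hc : (0 < c)%R.
Hypothesis Hg : C1_on (contour alpha delta) g.
Hypothesis Hw : C1_on (contour alpha delta) w.
Hypothesis HM : forall rho, (delta <= rho)%R -> (Cmod (integrand s g rho alpha) <= M * exp (- c * rho))%R.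
Hypothesis HN : forall phi, (alpha <= phi <= alpha + 2 * PI)%R -> (Cmod (integrand s g delta phi) <= N)%R.
Hypothesis Hr : forall t, contour alpha delta t -> (Cmod (w t) <= r)%R.

Lemma integrand_mult_pow (n : nat) (a b : R) :
  integrand s (fun t => (g t * w t ^ n)%C) a b = integrand s g a b * w (polar a b) ^ n.
Proof. unfold integrand; ring. Qed.

Lemma Cmod_integrand_pow (n : nat) (a b K : R) : contour alpha delta (polar a b) ->
  (Cmod (integrand s g a b) <= K)%R ->
  (Cmod (integrand s (fun t => (g t * w t ^ n)%C) a b) <= K * r ^ n)%R.
Proof.
  intros Hab HK. rewrite integrand_mult_pow, Cmod_mult, Cmod_pow.
  apply Rmult_le_compat; [apply Cmod_ge_0|apply pow_le, Cmod_ge_0|exact HK|].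
  apply pow_incr; split; [apply Cmod_ge_0|apply Hr, Hab].
Qed.

Lemma family_decay (n : nat) (rho : R) : (delta <= rho)%R ->
  (Cmod (integrand s (fun t => (g t * w t ^ n)%C) rho alpha) <= M * r ^ n * exp (- c * rho))%R.
Proof.
  intros Hrho. apply Rle_trans with (M * exp (- c * rho) * r ^ n)%R; [|right; ring].
  apply Cmod_integrand_pow; [apply contour_ray, Hrho|apply HM, Hrho].
Qed.

Lemma family_C1 (n : nat) : C1_on (contour alpha delta) (fun t => (g t * w t ^ n)%C).
Proof. apply C1_mult; [exact Hg|apply C1_pow, Hw]. Qed.

Lemma family_ok (n : nat) : loop_ok s (fun t => (g t * w t ^ n)%C) alpha delta.
Proof.
  split; [exact Hd|split; [apply family_C1|]].
  exists (M * r ^ n)%R, c; split; [exact Hc|apply family_decay].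
Qed.

(** The factor in front of r^n is independent of n. It controls the remainder of the geometric
    series and also gives the growth of p_n. *)
Lemma family_bound (n : nat) :
  (Cmod (loop_integral s (fun t => (g t * w t ^ n)%C) alpha delta) <=
   ((1 + exp (2 * PI * Im s)) * (M / c * exp (- c * delta)) + 2 * PI * (N * delta)) * r ^ n)%R.
Proof.
  apply Rle_trans with ((1 + exp (2 * PI * Im s)) * (M * r ^ n / c * exp (- c * delta))
    + 2 * PI * ((N * r ^ n) * delta))%R; [|right; field; lra].
  apply loop_bound; [exact Hd|apply family_C1|exact Hc|apply family_decay|].
  intros phi Hphi; apply Cmod_integrand_pow; [apply contour_circle|apply HN, Hphi].
Qed.

End Family.

Lemma sum_n_Sm_C (u : nat -> C) (n : nat) :
  sum_n (G := C_AbelianMonoid) u (S n) = sum_n (G := C_AbelianMonoid) u n + u (S n).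
Proof. exact (sum_Sn (G := C_AbelianMonoid) u n). Qed.

Lemma sum_n_0_C (u : nat -> C) : sum_n (G := C_AbelianMonoid) u 0 = u 0%nat.
Proof. exact (sum_O (G := C_AbelianMonoid) u). Qed.

Notation is_Cseries := (is_series (K := C_AbsRing) (V := C_NormedModule)).

Lemma is_Cseries_lim (u : nat -> C) (l : C) :
  is_Cseries u l <->
  filterlim (fun n => sum_n (G := C_AbelianMonoid) u n) eventually (Clocally l).
Proof. reflexivity. Qed.

Lemma is_Cseries_remainder (u r : nat -> C) (l : C) (K q : R) :
  (0 <= q < 1)%R -> (forall n, sum_n (G := C_AbelianMonoid) u n = l - r n) ->
  (forall n, (Cmod (r n) <= K * q ^ n)%R) -> is_Cseries u l.
Proof.
  intros Hq Hu Hr. apply is_Cseries_lim, locally_C_Cmod; [exact _|]. intros eps Heps.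
  pose proof (Rabs_pos K) as HK.
  assert (He : (0 < eps / (Rabs K + 1))%R) by (apply Rdiv_lt_0_compat; lra).
  destruct (pow_lt_1_zero q ltac:(rewrite Rabs_pos_eq; lra) _ He) as [N HN].
  exists N; intros n Hn. rewrite Hu.
  replace (l - r n - l) with (- r n) by ring. rewrite Cmod_opp.
  apply Rle_lt_trans with (1 := Hr n).
  specialize (HN n Hn). rewrite Rabs_pos_eq in HN by (apply pow_le; lra).
  assert (0 <= q ^ n)%R by (apply pow_le; lra).
  apply Rle_lt_trans with (Rabs K * q ^ n)%R; [apply Rmult_le_compat_r; [assumption|apply Rle_abs]|].
  apply (Rmult_lt_compat_l (Rabs K + 1)) in HN; [|lra].
  replace ((Rabs K + 1) * (eps / (Rabs K + 1)))%R with eps in HN by (field; lra). lra.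
Qed.

Section Geometric.
Context (s q : C) (g w G : C -> C) (alpha delta M c N r : R).
Hypothesis Hd : (0 < delta)%R.
Hypothesis Hc : (0 < c)%R.
Hypothesis Hg : C1_on (contour alpha delta) g.
Hypothesis Hw : C1_on (contour alpha delta) w.
Hypothesis HM : forall rho, (delta <= rho)%R -> (Cmod (integrand s g rho alpha) <= M * exp (- c * rho))%R.
Hypothesis HN : forall phi, (alpha <= phi <= alpha + 2 * PI)%R -> (Cmod (integrand s g delta phi) <= N)%R.
Hypothesis Hr : forall t, contour alpha delta t -> (Cmod (w t) <= r)%R.
Hypothesis Hqr : (Cmod q * r < 1)%R.
Hypothesis HG : forall t, contour alpha delta t -> G t = g t / (1 - q * w t).

Lemma geometric_denom (t : C) : contour alpha delta t -> (1 - Cmod q * r <= Cmod (1 - q * w t))%R.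
Proof.
  intros Ht. pose proof (Cmod_triangle (1 - q * w t) (q * w t)) as H.
  replace (1 - q * w t + q * w t) with (RtoC 1) in H by ring.
  rewrite Cmod_1, Cmod_mult in H.
  pose proof (Rmult_le_compat_l _ _ _ (Cmod_ge_0 q) (Hr t Ht)). lra.
Qed.

Lemma geometric_denom_neq_0 (t : C) : contour alpha delta t -> 1 - q * w t <> 0.
Proof. intros Ht; apply Cmod_gt_0. pose proof (geometric_denom t Ht). lra. Qed.

Let G' (t : C) : C := g t * / (1 - q * w t).

Lemma geometric_C1 : C1_on (contour alpha delta) G'.
Proof.
  apply C1_mult; [exact Hg|apply C1_inv; [exact geometric_denom_neq_0|]].
  apply C1_minus; [apply C1_const|apply C1_mult; [apply C1_const|exact Hw]].
Qed.

Lemma geometric_integrand (a b K : R) : contour alpha delta (polar a b) ->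
  (Cmod (integrand s g a b) <= K)%R -> (Cmod (integrand s G' a b) <= K / (1 - Cmod q * r))%R.
Proof.
  intros Hab HK. unfold integrand, G'. rewrite Cmult_assoc, Cmod_mult.
  pose proof (geometric_denom _ Hab).
  rewrite Cmod_inv by (apply geometric_denom_neq_0, Hab).
  apply Rmult_le_compat; [apply Cmod_ge_0| |exact HK|apply Rinv_le_contravar; lra].
  left; apply Rinv_0_lt_compat; lra.
Qed.

(** No interchange of sum and integral is needed. With T n the loop integral of g w^n / (1 - q w)
    and L n that of g w^n, one has T n = L n + q T (n + 1); so the remainder after the terms up to n
    is q^(n+1) T (n + 1), and T n = O(r^n) by [family_bound]. *)
Lemma loop_geometric :
  is_Cseries (fun n => q ^ n * loop_integral s (fun t => (g t * w t ^ n)%C) alpha delta)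
    (loop_integral s G alpha delta).
Proof.
  assert (HM' : forall rho, (delta <= rho)%R ->
    (Cmod (integrand s G' rho alpha) <= M / (1 - Cmod q * r) * exp (- c * rho))%R).
  { intros rho Hrho. apply Rle_trans with (M * exp (- c * rho) / (1 - Cmod q * r))%R.
    - apply geometric_integrand; [apply contour_ray, Hrho|apply HM, Hrho].
    - right; field; lra. }
  assert (HN' : forall phi, (alpha <= phi <= alpha + 2 * PI)%R ->
    (Cmod (integrand s G' delta phi) <= N / (1 - Cmod q * r))%R).
  { intros phi Hphi; apply geometric_integrand; [apply contour_circle|apply HN, Hphi]. }
  assert (Hg_ok := family_ok s g w alpha delta M c r Hd Hc Hg Hw HM Hr).
  assert (HG_ok := family_ok s G' w alpha delta _ c r Hd Hc geometric_C1 Hw HM' Hr).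
  assert (B := family_bound s G' w alpha delta _ c _ r Hd Hc geometric_C1 Hw HM' HN' Hr).
  set (K := ((1 + exp (2 * PI * Im s)) * (M / (1 - Cmod q * r) / c * exp (- c * delta)) +
          2 * PI * (N / (1 - Cmod q * r) * delta))%R) in B.
  set (L n := loop_integral s (fun t => (g t * w t ^ n)%C) alpha delta).
  set (T n := loop_integral s (fun t => G' t * w t ^ n) alpha delta).
  assert (Step : forall n, T n = L n + q * T (S n)).
  { intros n. unfold T, L. rewrite <- loop_scal by apply HG_ok.
    rewrite <- loop_plus; [|apply Hg_ok|apply loop_ok_scal, HG_ok].
    apply loop_ext; [|apply loop_ok_plus; [apply Hg_ok|apply loop_ok_scal, HG_ok]].
    intros t Ht. unfold G'. rewrite Cpow_S. field. apply geometric_denom_neq_0, Ht. }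
  replace (loop_integral s G alpha delta) with (T 0%nat).
  2: { symmetry; refine (loop_ext s G (fun t => G' t * w t ^ 0) _ _ _ (HG_ok 0%nat)).
       intros t Ht; rewrite (HG t Ht); unfold G'. rewrite Cmult_1_r. reflexivity. }
  assert (Hr0 : (0 <= r)%R).
  { apply Rle_trans with (2 := Hr _ (contour_circle alpha delta 0)), Cmod_ge_0. }
  apply (is_Cseries_remainder _ (fun n => q ^ (S n) * T (S n)) _ (K * (Cmod q * r)) (Cmod q * r)).
  - split; [apply Rmult_le_pos; [apply Cmod_ge_0|exact Hr0]|exact Hqr].
  - intros n; induction n as [|n IH].
    + rewrite sum_n_0_C, (Step 0%nat). toC. unfold L. ring.
    + rewrite sum_n_Sm_C, IH, (Step (S n)). toC. unfold L. rewrite !Cpow_S. ring.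
  - intros n. rewrite Cmod_mult, Cmod_pow.
    replace (K * (Cmod q * r) * (Cmod q * r) ^ n)%R with (Cmod q ^ S n * (K * r ^ S n))%R
      by (rewrite Rpow_mult_distr; simpl; ring).
    apply Rmult_le_compat_l; [apply pow_le, Cmod_ge_0|exact (B (S n))].
Qed.

End Geometric.

(** A power grows more slowly than any exponential: |ln rho| is at most a small multiple of rho plus
    a constant depending on [delta], and the argument contributes a bounded factor. *)
Lemma Cmod_Cexp_pow_le (s : C) (delta Phi eps : R) : (0 < delta)%R -> (0 < eps)%R ->
  exists M, (0 < M)%R /\ forall rho phi, (delta <= rho)%R -> (Rabs phi <= Phi)%R ->
    (Cmod (Cexp (- s * (ln rho, phi))) <= M * exp (eps * rho))%R.
Proof.
  intros Hd He. destruct s as [s1 s2].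
  (* Makes |Re s| e' <= eps, also when Re s = 0. *)
  set (e' := (eps / (Rabs s1 + 1))%R).
  pose proof (Rabs_pos s1) as H1.
  assert (He' : (0 < e')%R) by (apply Rdiv_lt_0_compat; lra).
  exists (exp (Rabs s1 * (Rabs (ln e') + Rabs (ln delta)) + Rabs s2 * Phi))%R.
  split; [apply exp_pos|]. intros rho phi Hrho Hphi.
  rewrite Cmod_Cexp, <- exp_plus. apply exp_le_compat. csimpl.
  assert (A : (Rabs (ln rho) <= e' * rho + (Rabs (ln e') + Rabs (ln delta)))%R).
  { pose proof (Rle_abs (- ln e')). rewrite Rabs_Ropp in H.
    pose proof (Rle_abs (- ln delta)). rewrite Rabs_Ropp in H0.
    pose proof (Rabs_pos (ln e')). pose proof (Rabs_pos (ln delta)).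
    assert (0 < e' * rho)%R by (apply Rmult_lt_0_compat; lra).
    apply Rabs_le; split.
    - assert (ln delta <= ln rho)%R by (apply ln_le; lra). lra.
    - pose proof (exp_ineq1_le (ln (e' * rho))) as X. rewrite exp_ln in X by assumption.
      rewrite ln_mult in X by lra. lra. }
  assert (E1 : (- s1 * ln rho <= Rabs s1 * (e' * rho + (Rabs (ln e') + Rabs (ln delta))))%R).
  { apply Rle_trans with (Rabs s1 * Rabs (ln rho))%R.
    - rewrite <- Rabs_mult. pose proof (Rle_abs (- (s1 * ln rho))). rewrite Rabs_Ropp in H. lra.
    - apply Rmult_le_compat_l; [exact H1|exact A]. }
  assert (E2 : (s2 * phi <= Rabs s2 * Phi)%R).
  { apply Rle_trans with (Rabs s2 * Rabs phi)%R.
    - rewrite <- Rabs_mult. apply Rle_abs.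
    - apply Rmult_le_compat_l; [apply Rabs_pos|exact Hphi]. }
  assert (E3 : (Rabs s1 * (e' * rho) <= eps * rho)%R).
  { rewrite <- Rmult_assoc. apply Rmult_le_compat_r; [lra|]. unfold e'.
    apply Rmult_le_reg_r with (Rabs s1 + 1)%R; [lra|].
    replace (Rabs s1 * (eps / (Rabs s1 + 1)) * (Rabs s1 + 1))%R with (Rabs s1 * eps)%R by (field; lra).
    nra. }
  lra.
Qed.

(** Half of the decay rate of g is spent on the factor t^(-s). *)
Lemma integrand_decay (s : C) (g : C -> C) (delta a1 a2 N c : R) :
  (0 < delta)%R -> (0 < c)%R ->
  (forall rho phi, (delta <= rho)%R -> (a1 <= phi <= a2)%R -> (Cmod (g (polar rho phi)) <= N * exp (- c * rho))%R) ->
  exists M, forall rho phi, (delta <= rho)%R -> (a1 <= phi <= a2)%R ->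
    (Cmod (integrand s g rho phi) <= M * exp (- (c / 2) * rho))%R.
Proof.
  intros Hd Hc HN.
  destruct (Cmod_Cexp_pow_le s delta (Rabs a1 + Rabs a2) (c / 2) Hd ltac:(lra)) as (M & HM0 & HM).
  exists (M * N)%R; intros rho phi Hrho Hphi. unfold integrand. rewrite Cmod_mult.
  apply Rle_trans with (M * exp (c / 2 * rho) * (N * exp (- c * rho)))%R.
  - apply Rmult_le_compat; [apply Cmod_ge_0|apply Cmod_ge_0| |apply HN; assumption].
    apply HM; [exact Hrho|]. apply Rabs_le.
    pose proof (Rle_abs a2). pose proof (Rle_abs (- a1)). rewrite Rabs_Ropp in H0.
    pose proof (Rabs_pos a1). pose proof (Rabs_pos a2). lra.
  - right. replace (- (c / 2) * rho)%R with (c / 2 * rho + - c * rho)%R by field.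
    rewrite exp_plus; ring.
Qed.

(** * Hankel's integral for the reciprocal Gamma function *)

(** e^w - 1 is the integral of w e^(t w) over t from 0 to 1. *)
Lemma Cmod_Cexp_minus_1 (w : C) : (Cmod (Cexp w - 1) <= Cmod w * exp (Cmod w))%R.
Proof.
  assert (I : is_CRInt (fun t => Cexp (t * w) * w) 0 1 (Cexp (1%R * w) - Cexp (0%R * w))).
  { apply (is_CRInt_derive (fun t => Cexp (RtoC t * w))); intros t _.
    - apply is_Rderive_Cexp. eapply is_Rderive_eq.
      + apply is_Rderive_mult; [|apply is_Rderive_const].
        instantiate (1 := 1). split; csimpl; [apply (is_derive_id (K := R_AbsRing))|apply is_derive_Rconst].
      + cbv beta; ring.
    - apply continuous_Cmult; [|apply continuous_Cconst].
      apply continuous_Cexp_comp, continuous_Cmult; [|apply continuous_Cconst].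
      apply continuous_C; csimpl; [apply continuous_id|apply continuous_const]. }
  rewrite Cmult_1_l, Cmult_0_l, Cexp_0 in I.
  rewrite <- (is_CRInt_unique _ _ _ _ I).
  replace (Cmod w * exp (Cmod w))%R with ((1 - 0) * (Cmod w * exp (Cmod w)))%R by ring.
  apply Cmod_CRInt_le_const; [lra|eexists; exact I|].
  intros t Ht. rewrite Cmod_mult, Cmod_Cexp, Rmult_comm.
  apply Rmult_le_compat_l; [apply Cmod_ge_0|]. apply exp_le_compat.
  apply Rle_trans with (1 := Rle_abs _). apply Rle_trans with (1 := re_le_Cmod _).
  rewrite Cmod_mult, Cmod_R, Rabs_pos_eq by lra.
  pose proof (Cmod_ge_0 w). nra.
Qed.

Definition exp_opp (t : C) : C := Cexp (- t).

Lemma C1_exp_opp (U : C -> Prop) : C1_on U exp_opp.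
Proof. apply C1_Cexp, C1_opp, C1_id. Qed.

Lemma Cmod_exp_opp (r p : R) : Cmod (exp_opp (polar r p)) = exp (- (r * cos p)).
Proof. unfold exp_opp; rewrite Cmod_Cexp. f_equal. Qed.

Lemma exp_opp_decay (s : C) (d : R) : (0 < d)%R -> exists M, forall r, (d <= r)%R ->
  (Cmod (integrand s exp_opp r 0) <= M * exp (- (1 / 2) * r))%R.
Proof.
  intros Hd. destruct (integrand_decay s exp_opp d 0 0 1 1 Hd ltac:(lra)) as [M HM].
  - intros r p Hr Hp. replace p with 0%R by lra. rewrite Cmod_exp_opp, cos_0. right; ring_simplify.
    f_equal; ring.
  - exists M; intros r Hr; apply HM; lra.
Qed.

Lemma exp_opp_ok (s : C) (d : R) : (0 < d)%R -> loop_ok s exp_opp 0 d.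
Proof.
  intros Hd; split; [exact Hd|split; [apply C1_exp_opp|]].
  destruct (exp_opp_decay s d Hd) as [M HM]. exists M, (1 / 2)%R; split; [lra|exact HM].
Qed.

(** Hankel's integral along the positive axis with arg t from 0 to 2 pi; its value turns out to be
    -2 pi i e^(-pi i s) / Gamma(s). *)
Definition Hankel (s : C) : C := loop_integral s exp_opp 0 1.

Lemma Hankel_delta (s : C) (d : R) : (0 < d)%R -> loop_integral s exp_opp 0 d = Hankel s.
Proof.
  intros Hd. unfold Hankel.
  destruct (Rle_lt_dec d 1) as [H|H]; [|symmetry].
  - apply (loop_shrink (fun _ => True) s exp_opp 0 d 1 d); auto using C1_exp_opp, exp_opp_ok; try lra.
    apply exp_opp_ok; lra.
  - apply (loop_shrink (fun _ => True) s exp_opp 0 1 d 1); auto using C1_exp_opp, exp_opp_ok; try lra.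
    apply exp_opp_ok; lra.
Qed.

Lemma integrand_shift (s : C) (g : C -> C) (r p : R) : (0 < r)%R ->
  integrand (s + 1) g r p * polar r p = integrand s g r p.
Proof.
  intros Hr. unfold integrand. rewrite (polar_Cexp r p Hr) at 2.
  rewrite Cmult_comm, Cmult_assoc, <- Cexp_plus. do 2 f_equal. ring.
Qed.

Lemma is_Rderive_integrand_exp_opp_r (s : C) (r p : R) : (0 < r)%R ->
  is_Rderive (fun u => integrand s exp_opp u p) r (- s * radial_form (s + 1) exp_opp r p - radial_form s exp_opp r p).
Proof.
  intros Hr. eapply is_Rderive_eq.
  - apply is_Rderive_mult; apply is_Rderive_Cexp.
    + apply is_Rderive_mult; [apply is_Rderive_const|apply is_Rderive_log_polar_r, Hr].
    + apply is_Rderive_opp, is_Rderive_polar_r.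
  - unfold radial_form. rewrite <- (integrand_shift s exp_opp r p Hr). unfold integrand, exp_opp.
    replace (Cexp (- s * (ln r, p))) with (Cexp (- (s + 1) * (ln r, p)) * polar r p).
    + rewrite (polar_scal r p), RtoC_inv by lra. field. apply RtoC_neq_0; lra.
    + rewrite (polar_Cexp r p Hr), <- Cexp_plus. f_equal; ring.
Qed.

Lemma is_Rderive_integrand_exp_opp_p (s : C) (r p : R) : (0 < r)%R ->
  is_Rderive (integrand s exp_opp r) p (- s * angular_form (s + 1) exp_opp r p - angular_form s exp_opp r p).
Proof.
  intros Hr. eapply is_Rderive_eq.
  - apply is_Rderive_mult; apply is_Rderive_Cexp.
    + apply is_Rderive_mult; [apply is_Rderive_const|apply is_Rderive_log_polar_p].
    + apply is_Rderive_opp, is_Rderive_polar_p.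
  - unfold angular_form. rewrite <- (integrand_shift s exp_opp r p Hr). unfold integrand, exp_opp.
    replace (Cexp (- s * (ln r, p))) with (Cexp (- (s + 1) * (ln r, p)) * polar r p).
    + ring.
    + rewrite (polar_Cexp r p Hr), <- Cexp_plus. f_equal; ring.
Qed.

(** Integration by parts: the derivative of t^(-s) e^(-t) is -s t^(-s-1) e^(-t) - t^(-s) e^(-t). The
    boundary terms at the corners of the truncated loop cancel, and those at its ends decay. *)
Lemma Hankel_rec (s : C) : Hankel s = - s * Hankel (s + 1).
Proof.
  assert (H1 := exp_opp_ok s 1 ltac:(lra)). assert (H2 := exp_opp_ok (s + 1) 1 ltac:(lra)).
  refine (loop_integral_unique s exp_opp 0 1 _ H1 _).
  apply (filterlim_ext_loc (fun r => - s * trunc_loop (s + 1) exp_opp 0 1 r + (integrand s exp_opp r 0 - integrand s exp_opp r (0 + 2 * PI)))).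
  - refine (filter_imp _ _ _ (near_infty_gt 1)); intros r Hr.
    assert (D : forall p, is_CRInt (fun u => - s * radial_form (s + 1) exp_opp u p - radial_form s exp_opp u p) 1 r (integrand s exp_opp r p - integrand s exp_opp 1 p)).
    { intros p; apply (is_CRInt_derive (fun u => integrand s exp_opp u p)); intros t Ht;
      rewrite Rmin_left, Rmax_right in Ht by lra.
      - apply is_Rderive_integrand_exp_opp_r; lra.
      - apply continuous_Cplus; [apply continuous_Cmult; [apply continuous_Cconst|]|apply continuous_Copp];
        apply (continuous_radial_form (fun _ => True) _ exp_opp (C1_exp_opp _)); try exact I; lra. }
    assert (DQ : is_CRInt (fun u => - s * angular_form (s + 1) exp_opp 1 u - angular_form s exp_opp 1 u) 0 (0 + 2 * PI)
       (integrand s exp_opp 1 (0 + 2 * PI) - integrand s exp_opp 1 0)).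
    { apply (is_CRInt_derive (integrand s exp_opp 1)); intros t Ht.
      - apply is_Rderive_integrand_exp_opp_p; lra.
      - apply continuous_Cplus; [apply continuous_Cmult; [apply continuous_Cconst|]|apply continuous_Copp];
        apply (continuous_angular_form (fun _ => True) _ exp_opp (C1_exp_opp _)); exact I. }
    assert (X : forall s' p, ex_CRInt (fun u => radial_form s' exp_opp u p) 1 r).
    { intros s' p; apply ex_CRInt_continuous; intros t Ht; rewrite Rmin_left, Rmax_right in Ht by lra.
      apply (continuous_radial_form (fun _ => True) _ exp_opp (C1_exp_opp _)); try exact I; lra. }
    assert (XQ : forall s' a b, ex_CRInt (angular_form s' exp_opp 1) a b).
    { intros s' a b; apply ex_CRInt_continuous; intros t Ht.
      apply (continuous_angular_form (fun _ => True) _ exp_opp (C1_exp_opp _)); exact I. }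
    assert (L : forall f g a b l, ex_CRInt f a b -> ex_CRInt g a b ->
      is_CRInt (fun u => - s * f u - g u) a b l -> CRInt g a b = - s * CRInt f a b - l).
    { intros f g a b l Hf Hg Hl.
      assert (Hm : is_CRInt (fun u => - s * f u - g u) a b (- s * CRInt f a b - CRInt g a b)).
      { apply (is_RInt_minus (V := C_R_NormedModule)).
        - apply is_CRInt_Cscal; exact Hf.
        - apply (CRInt_correct); exact Hg. }
      apply (is_CRInt_unique) in Hl.
      apply (is_CRInt_unique) in Hm.
      rewrite <- Hl, Hm. apply C_ext; csimpl; ring. }
    unfold trunc_loop.
    rewrite (L _ _ _ _ _ (X (s + 1) 0%R) (X s 0%R) (D 0%R)).
    rewrite (L _ _ _ _ _ (X (s + 1) (0 + 2 * PI)%R) (X s (0 + 2 * PI)%R) (D (0 + 2 * PI)%R)).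
    rewrite (L _ _ _ _ _ (XQ (s + 1) 0%R (0 + 2 * PI)%R) (XQ s 0%R (0 + 2 * PI)%R) DQ).
    apply C_ext; csimpl; ring.
  - destruct (exp_opp_decay s 1 ltac:(lra)) as [M HM].
    apply (lim_infty_plus_small _ _ _ ((1 + exp (2 * PI * Im s)) * M)%R (1 / 2)%R); [lra| |].
    + apply lim_infty_scal, loop_integral_lim, H2.
    + refine (filter_imp _ _ _ (near_infty_gt 1)); intros r Hr.
      apply Rle_trans with (1 := Cmod_triangle _ _).
      rewrite Cmod_opp, Cmod_integrand_2PI.
      specialize (HM r ltac:(lra)). pose proof (Cmod_ge_0 (integrand s exp_opp r 0)).
      pose proof (exp_pos (2 * PI * Im s)). pose proof (exp_pos (- (1 / 2) * r)).
      apply Rle_trans with ((1 + exp (2 * PI * Im s)) * (M * exp (- (1 / 2) * r)))%R; [nra|].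
      rewrite (Rmult_assoc _ M). apply Rmult_le_compat_l; [lra|].
      assert (0 <= M * exp (- (1 / 2) * r))%R by lra. nra.
Qed.

(** For s = 1 the power is single-valued, so the two rays cancel and only the circle, of any radius,
    remains. *)
Lemma Hankel_1_circle (d : R) : (0 < d)%R ->
  Hankel 1 = CRInt (fun p => Ci * exp_opp (polar d p)) 0 (0 + 2 * PI).
Proof.
  intros Hd. rewrite <- (Hankel_delta 1 d Hd).
  refine (loop_integral_unique 1 exp_opp 0 d _ (exp_opp_ok 1 d Hd) _).
  apply (filterlim_ext (fun _ => CRInt (fun p => Ci * exp_opp (polar d p)) 0 (0 + 2 * PI))); [|apply filterlim_const].
  intros r. unfold trunc_loop.
  rewrite (CRInt_ext (fun rho => radial_form 1 exp_opp rho (0 + 2 * PI)) (fun rho => radial_form 1 exp_opp rho 0)).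
  2: { intros x _. unfold radial_form. rewrite integrand_2PI, polar_2PI.
       replace (- (1) * (2 * PI * Ci)) with (- (2 * PI * Ci)) by ring.
       rewrite Cexp_opp, Cexp_2PI. field. }
  rewrite (CRInt_ext (angular_form 1 exp_opp d) (fun p => Ci * exp_opp (polar d p))).
  - apply C_ext; csimpl; ring.
  - intros x _. unfold angular_form, integrand. rewrite (polar_Cexp d x Hd) at 2.
    replace (- (1) * (ln d, x)) with (- (ln d, x)) by ring.
    rewrite Cexp_opp. field. apply Cexp_neq_0.
Qed.

(** The radius in [Hankel_1_circle] is arbitrary, and for small radius the integrand is close to
    i. *)
Lemma Hankel_1 : Hankel 1 = 2 * PI * Ci.
Proof.
  assert (K : (0 < 2 * PI * exp 1)%R).
  { pose proof PI_RGT_0. pose proof (exp_pos 1). nra. }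
  apply Ceq_minus, Cmod_eq_0, Rle_antisym; [|apply Cmod_ge_0].
  apply Rnot_lt_le; intros Hlt.
  (* With this radius the error 2 pi e d is at most half of the supposedly positive distance. *)
  set (d := Rmin 1 (Cmod (Hankel 1 - 2 * PI * Ci) / (2 * (2 * PI * exp 1)))%R).
  assert (Hd : (0 < d)%R) by (apply Rmin_glb_lt; [lra|apply Rdiv_lt_0_compat; lra]).
  assert (Hd1 : (d <= 1)%R) by apply Rmin_l.
  assert (Hd2 : (d <= Cmod (Hankel 1 - 2 * PI * Ci) / (2 * (2 * PI * exp 1)))%R) by apply Rmin_r.
  assert (X : ex_CRInt (fun p => Ci * exp_opp (polar d p)) 0 (0 + 2 * PI)).
  { apply ex_CRInt_continuous; intros t _. apply continuous_Cmult; [apply continuous_Cconst|].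
    apply continuous_Cexp_comp, continuous_Copp.
    exact (is_Rderive_continuous _ _ _ (is_Rderive_polar_p d t)). }
  assert (B : (Cmod (Hankel 1 - 2 * PI * Ci) <= 2 * PI * (d * exp 1))%R).
  { assert (I1 : is_CRInt (fun _ => Ci) 0 (0 + 2 * PI) (2 * PI * Ci)).
    { replace (2 * PI * Ci) with (scal (V := C_R_NormedModule) (0 + 2 * PI - 0)%R Ci).
      - apply (is_RInt_const (V := C_R_NormedModule)).
      - rewrite scal_R_Cmult, RtoC_minus, RtoC_plus, RtoC_mult. toC. ring. }
    assert (I2 := is_RInt_minus (V := C_R_NormedModule) _ _ _ _ _ _
      (CRInt_correct _ _ _ X) I1).
    rewrite (Hankel_1_circle d Hd).
    change (CRInt (fun p => Ci * exp_opp (polar d p)) 0 (0 + 2 * PI) - 2 * PI * Ci)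
      with (minus (G := C_R_NormedModule) (CRInt (fun p => Ci * exp_opp (polar d p)) 0 (0 + 2 * PI)) (2 * PI * Ci)).
    rewrite <- (is_CRInt_unique _ _ _ _ I2).
    replace (2 * PI * (d * exp 1))%R with ((0 + 2 * PI - 0) * (d * exp 1))%R by ring.
    pose proof PI_RGT_0.
    apply Cmod_CRInt_le_const; [lra|eexists; exact I2|].
    intros p Hp.
    change (Cmod (Ci * exp_opp (polar d p) - Ci) <= d * exp 1)%R.
    replace (Ci * exp_opp (polar d p) - Ci) with (Ci * (Cexp (- polar d p) - 1)) by (unfold exp_opp; ring).
    rewrite Cmod_mult, Cmod_Ci, Rmult_1_l.
    apply Rle_trans with (1 := Cmod_Cexp_minus_1 _). rewrite Cmod_opp, Cmod_polar, Rabs_pos_eq by lra.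
    apply Rmult_le_compat_l; [lra|apply exp_le_compat, Hd1]. }
  apply (Rmult_le_compat_r (2 * PI * exp 1)) in Hd2; [|lra].
  replace (Cmod (Hankel 1 - 2 * PI * Ci) / (2 * (2 * PI * exp 1)) * (2 * PI * exp 1))%R
    with (Cmod (Hankel 1 - 2 * PI * Ci) / 2)%R in Hd2.
  - nra.
  - field. pose proof (exp_pos 1); pose proof PI_RGT_0; split; lra.
Qed.

(** The difference of the two sides has derivative x^2 / ((1 + x) (2 + x)^2). At u = 1/N this is (N
    + 1/2) ln (1 + 1/N) >= 1, the induction step of [fact_upper]. *)
Lemma ln_1p_lower (u : R) : (0 <= u)%R -> (2 * u / (2 + u) <= ln (1 + u))%R.
Proof.
  intros Hu.
  destruct (MVT_gen (fun x => ln (1 + x) - 2 * x / (2 + x))%R 0 u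
    (fun x => x ^ 2 / ((1 + x) * (2 + x) ^ 2))%R) as (x & Hx & E).
  - intros x Hx; rewrite Rmin_left, Rmax_right in Hx by lra.
    auto_derive; [repeat split; lra|field; lra].
  - intros x Hx; rewrite Rmin_left, Rmax_right in Hx by lra.
    apply derivable_continuous_pt.
    exists (x ^ 2 / ((1 + x) * (2 + x) ^ 2))%R.
    apply is_derive_Reals. auto_derive; [repeat split; lra|field; lra].
  - rewrite Rmin_left, Rmax_right in Hx by lra.
    rewrite Rplus_0_r, ln_1 in E.
    assert (0 <= x ^ 2 / ((1 + x) * (2 + x) ^ 2) * (u - 0))%R.
    { apply Rmult_le_pos; [|lra]. apply Rmult_le_pos; [apply pow2_ge_0|].
      left; apply Rinv_0_lt_compat. apply Rmult_lt_0_compat; [lra|apply pow_lt; lra]. }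
    unfold Rdiv in *. lra.
Qed.

(** Stirling's upper bound n! <= e n^(n + 1/2) e^(-n), with e in place of sqrt (2 pi): the order of
    magnitude suffices to compare with the saddle point estimate. *)
Lemma fact_upper (n : nat) :
  (INR (fact (S n)) <= exp (1 + (INR (S n) + 1 / 2) * ln (INR (S n)) - INR (S n)))%R.
Proof.
  induction n as [|n IH].
  - simpl. rewrite ln_1. rewrite <- exp_0 at 1. apply exp_le_compat. lra.
  - rewrite fact_simpl, mult_INR.
    set (N := INR (S n)) in *.
    assert (HN : (1 <= N)%R) by (unfold N; rewrite S_INR; pose proof (pos_INR n); lra).
    replace (INR (S (S n))) with (N + 1)%R by (rewrite (S_INR (S n)); reflexivity).
    apply Rle_trans with ((N + 1) * exp (1 + (N + 1 / 2) * ln N - N))%R.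
    + apply Rmult_le_compat_l; [lra|exact IH].
    + rewrite <- (exp_ln (N + 1)) at 1 by lra. rewrite <- exp_plus. apply exp_le_compat.
      pose proof (ln_1p_lower (/ N) ltac:(left; apply Rinv_0_lt_compat; lra)) as L.
      replace (1 + / N)%R with ((N + 1) / N)%R in L by (field; lra).
      unfold Rdiv in L at 2. rewrite ln_mult, ln_Rinv in L by (try apply Rinv_0_lt_compat; lra).
      replace (2 * / N / (2 + / N))%R with (1 / (N + 1 / 2))%R in L by (field; lra).
      apply (Rmult_le_compat_l (N + 1 / 2)) in L; [|lra].
      replace ((N + 1 / 2) * (1 / (N + 1 / 2)))%R with 1%R in L by (field; lra).
      lra.
Qed.

Lemma sin_lower (x : R) : (0 <= x <= PI / 2)%R -> (x / 4 <= sin x)%R.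
Proof.
  intros Hx. pose proof PI_4. pose proof PI_RGT_0.
  destruct (Rle_lt_dec x (PI / 3)) as [H1|H1].
  - destruct (Req_dec x 0) as [->|Hx0]; [rewrite sin_0; lra|].
    destruct (MVT_cor2 sin cos 0 x ltac:(lra)) as (c & E & Hc).
    { intros; apply derivable_pt_lim_sin. }
    rewrite sin_0 in E.
    assert (1 / 2 <= cos c)%R.
    { rewrite <- cos_PI3. apply cos_decr_1; lra. }
    nra.
  - assert (sin (PI / 3) <= sin x)%R by (apply sin_incr_1; lra).
    rewrite sin_PI3 in *.
    assert (1 <= sqrt 3)%R by (rewrite <- sqrt_1; apply sqrt_le_1; lra). lra.
Qed.

(** From cos x = 1 - 2 sin^2 (x/2) and sin (x/2) >= x/8 for x >= 0; the constant is 1/32 = 2 /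
    8^2. *)
Lemma cos_upper (x : R) : (- PI <= x <= PI)%R -> (cos x <= 1 - x ^ 2 / 32)%R.
Proof.
  assert (P : forall y, (0 <= y <= PI)%R -> (cos y <= 1 - y ^ 2 / 32)%R).
  { intros y Hy. pose proof (sin_lower (y / 2) ltac:(lra)) as H.
    pose proof (cos_2a_sin (y / 2)) as E. replace (2 * (y / 2))%R with y in E by field.
    rewrite E. nra. }
  intros Hx. destruct (Rle_lt_dec 0 x).
  - apply P; lra.
  - rewrite <- cos_neg. replace (x ^ 2)%R with ((- x) ^ 2)%R by ring. apply P; lra.
Qed.

Lemma is_RInt_gauss (K b a1 a2 : R) : (0 < b)%R ->
  is_RInt (fun x => K * ((x - PI) * exp (- b * (x - PI) ^ 2)))%R a1 a2
   (K / (2 * b) * (exp (- b * (a1 - PI) ^ 2) - exp (- b * (a2 - PI) ^ 2)))%R.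
Proof.
  intros Hb. evar_last.
  - apply (is_RInt_derive (fun x => - (K / (2 * b)) * exp (- b * (x - PI) ^ 2))%R); intros x _.
    + auto_derive; [exact I|].
      unfold Rminus; simpl. field; lra.
    + apply ex_Rderive_continuous. auto_derive; exact I.
  - unfold minus, plus, opp; simpl; ring.
Qed.

(** The factor |x - pi| makes the Gaussian integral elementary; each side of pi contributes at most
    K / (2 b). *)
Lemma CRInt_gauss_le (f : R -> C) (K b : R) : (0 <= K)%R -> (0 < b)%R ->
  (forall x, Ccontinuous f x) ->
  (forall x, (0 <= x <= 2 * PI)%R -> (Cmod (f x) <= K * (Rabs (x - PI) * exp (- b * (x - PI) ^ 2)))%R) ->
  (Cmod (CRInt f 0 (0 + 2 * PI)) <= K / b)%R.
Proof.
  intros HK Hb Hf HB. pose proof PI_RGT_0 as HPI.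
  assert (X : forall a c, ex_CRInt f a c) by (intros; apply ex_CRInt_continuous; auto).
  rewrite <- (CRInt_Chasles f 0 PI (0 + 2 * PI)) by apply X.
  apply Rle_trans with (1 := Cmod_triangle _ _).
  assert (B1 : (Cmod (CRInt f 0 PI) <= (- K) / (2 * b) * (exp (- b * (0 - PI) ^ 2) - exp (- b * (PI - PI) ^ 2)))%R).
  { apply Cmod_CRInt_le with (fun x => - K * ((x - PI) * exp (- b * (x - PI) ^ 2)))%R;
      [lra|apply X| |apply is_RInt_gauss, Hb].
    intros x Hx. apply Rle_trans with (1 := HB x ltac:(lra)).
    rewrite Rabs_left1 by lra. right; ring. }
  assert (B2 : (Cmod (CRInt f PI (0 + 2 * PI)) <= K / (2 * b) * (exp (- b * (PI - PI) ^ 2) - exp (- b * (0 + 2 * PI - PI) ^ 2)))%R).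
  { apply Cmod_CRInt_le with (fun x => K * ((x - PI) * exp (- b * (x - PI) ^ 2)))%R;
      [lra|apply X| |apply is_RInt_gauss, Hb].
    intros x Hx. apply Rle_trans with (1 := HB x ltac:(lra)).
    rewrite Rabs_pos_eq by lra. right; ring. }
  assert (E0 : exp (- b * (PI - PI) ^ 2) = 1%R).
  { rewrite <- exp_0; f_equal; ring. }
  rewrite E0 in *.
  pose proof (exp_pos (- b * (0 - PI) ^ 2)). pose proof (exp_pos (- b * (0 + 2 * PI - PI) ^ 2)).
  assert (P : (0 <= K / (2 * b))%R) by (apply Rmult_le_pos; [exact HK|left; apply Rinv_0_lt_compat; lra]).
  replace (- K / (2 * b))%R with (- (K / (2 * b)))%R in B1 by (field; lra).
  replace (K / b)%R with (K / (2 * b) + K / (2 * b))%R by (field; lra).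
  nra.
Qed.

(** Hankel's formula for 1 / Gamma(s), kept apart from Gauss's product [rGamma] until
    [rGamma_recip_gamma] identifies the two. *)
Definition recip_gamma (s : C) : C := - (Hankel s * Cexp (PI * Ci * s)) / (2 * PI * Ci).

Lemma two_pi_i_neq_0 : 2 * PI * Ci <> 0.
Proof.
  apply Cmult_neq_0; [apply Cmult_neq_0|apply Ci_nz]; apply RtoC_neq_0; [lra|].
  pose proof PI_RGT_0; lra.
Qed.

Lemma RtoC_PI_neq_0 : RtoC PI <> 0.
Proof. apply RtoC_neq_0. pose proof PI_RGT_0; lra. Qed.

Lemma recip_gamma_rec (s : C) : recip_gamma s = s * recip_gamma (s + 1).
Proof.
  unfold recip_gamma. rewrite (Hankel_rec s).
  replace (PI * Ci * (s + 1)) with (PI * Ci * s + PI * Ci) by ring.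
  rewrite Cexp_plus, Cexp_PI. field. split; [apply Ci_nz|apply RtoC_PI_neq_0].
Qed.

Lemma recip_gamma_1 : recip_gamma 1 = 1.
Proof.
  unfold recip_gamma. rewrite Hankel_1, Cmult_1_r, Cexp_PI. field.
  split; [apply Ci_nz|apply RtoC_PI_neq_0].
Qed.

Lemma INR_fact_neq_0_C (n : nat) : RtoC (INR (fact n)) <> 0.
Proof. apply RtoC_neq_0, INR_fact_neq_0. Qed.

Lemma recip_gamma_fact (n : nat) : INR (fact n) * recip_gamma (INR n + 1) = 1.
Proof.
  induction n as [|n IH].
  - simpl. rewrite Cplus_0_l, recip_gamma_1. ring.
  - rewrite recip_gamma_rec in IH. rewrite fact_simpl, mult_INR, RtoC_mult, S_INR, RtoC_plus. etransitivity; [|exact IH]. ring.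
Qed.

(** Produces the numerator of Gauss's product; what is left is the asymptotics of 1 / Gamma(s + n +
    1). *)
Lemma recip_gamma_rising (s : C) (n : nat) : recip_gamma s = rising s n * recip_gamma (s + INR n).
Proof.
  induction n as [|n IH].
  - simpl. rewrite Cplus_0_r. ring.
  - rewrite IH, (recip_gamma_rec (s + INR n)), S_INR, RtoC_plus, Cplus_assoc. simpl rising. ring.
Qed.

(** For Re s >= 0 the power is largest at the beginning of the ray, so the rays beyond N contribute
    only O(N^(-Re s) e^(-N)). *)
Lemma Hankel_circle_approx (s : C) (N : R) : (1 <= N)%R -> (0 <= Re s)%R ->
  (Cmod (Hankel s - CRInt (angular_form s exp_opp N) 0 (0 + 2 * PI)) <=
   (1 + exp (2 * PI * Im s)) * exp (- Re s * ln N - N))%R.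
Proof.
  intros HN Hs. rewrite <- (Hankel_delta s N) by lra.
  replace (exp (- Re s * ln N - N))%R with (exp (- Re s * ln N) / 1 * exp (- (1) * N))%R.
  - apply loop_circle_approx; [lra|apply C1_exp_opp|lra|].
    intros rho Hrho. unfold integrand. rewrite Cmod_mult, Cmod_exp_opp, cos_0, Cmod_Cexp.
    replace (- (1) * rho)%R with (- (rho * 1))%R by ring.
    apply Rmult_le_compat_r; [left; apply exp_pos|]. apply exp_le_compat.
    assert (ln N <= ln rho)%R by (apply ln_le; lra). csimpl. nra.
  - unfold Rminus; rewrite exp_plus. unfold Rdiv. rewrite Rinv_1, Rmult_1_r. do 2 f_equal. ring.
Qed.

(* The circle |t| = N passes through the saddle point - N of e^(-t) t^(-N-1); on it the
   integrands at s and at 0 differ by a factor 1 + O(|phi - PI|), which gains the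
   factor 1 / N over the size e^N N^(-N) of each of them. *)
Lemma Hankel_asymptotic (s : C) : exists K, (0 <= K)%R /\ forall N : R, (1 <= N)%R -> (0 <= Re s + N + 1)%R ->
  (Cmod (Cexp (s * ln N + PI * Ci * s) * Hankel (s + N + 1) - Hankel (N + 1)) <=
    K * exp (- N * ln N + N - ln N))%R.
Proof.
  set (k1 := (exp (- (PI * Im s)) * (1 + exp (2 * PI * Im s)))%R).
  set (k2 := (32 * (Cmod s * exp (Cmod s * PI)))%R).
  pose proof PI_RGT_0 as HPI. pose proof (Cmod_ge_0 s) as Hs0.
  assert (Hk1 : (0 <= k1)%R).
  { apply Rmult_le_pos; [left; apply exp_pos|]. pose proof (exp_pos (2 * PI * Im s)); lra. }
  assert (Hk2 : (0 <= Cmod s * exp (Cmod s * PI))%R).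
  { apply Rmult_le_pos; [exact Hs0|left; apply exp_pos]. }
  exists (k1 + 2 + k2)%R; split; [unfold k2; lra|]. intros N HN HsN.
  assert (HlnN : (0 <= ln N)%R) by (rewrite <- ln_1; apply ln_le; lra).
  set (k := Cexp (s * ln N + PI * Ci * s)).
  set (I1 := CRInt (angular_form (s + N + 1) exp_opp N) 0 (0 + 2 * PI)).
  set (I2 := CRInt (angular_form (N + 1) exp_opp N) 0 (0 + 2 * PI)).
  assert (Hk : Cmod k = exp (Re s * ln N - PI * Im s)).
  { unfold k; rewrite Cmod_Cexp; f_equal; csimpl; ring. }
  (* Replacing a loop by its circle costs e^(-2 N) times the allowed error, which is relaxed here
     and in [A2] to a constant multiple of it. *)
  assert (A1 : (Cmod (k * (Hankel (s + N + 1) - I1)) <= k1 * exp (- N * ln N + N - ln N))%R).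
  { rewrite Cmod_mult, Hk.
    assert (B := Hankel_circle_approx (s + N + 1) N HN ltac:(csimpl; exact HsN)).
    apply Rle_trans with (exp (Re s * ln N - PI * Im s) * ((1 + exp (2 * PI * Im s)) *
      exp (- (Re s + N + 1) * ln N - N)))%R.
    - apply Rmult_le_compat_l; [left; apply exp_pos|].
      apply Rle_trans with (1 := B). right. csimpl. do 2 f_equal. f_equal; ring.
    - unfold k1.
      replace (exp (Re s * ln N - PI * Im s) * ((1 + exp (2 * PI * Im s)) * exp (- (Re s + N + 1) * ln N - N)))%R
        with (exp (- (PI * Im s)) * (1 + exp (2 * PI * Im s)) * exp (- N * ln N - N - ln N))%R.
      + apply Rmult_le_compat_l; [exact Hk1|]. apply exp_le_compat; lra.
      + replace (exp (Re s * ln N - PI * Im s)) with (exp (- (PI * Im s)) * exp (Re s * ln N))%R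
          by (rewrite <- exp_plus; f_equal; ring).
        replace (exp (- N * ln N - N - ln N)) with (exp (Re s * ln N) * exp (- (Re s + N + 1) * ln N - N))%R
          by (rewrite <- exp_plus; f_equal; ring).
        ring. }
  assert (A2 : (Cmod (Hankel (N + 1) - I2) <= 2 * exp (- N * ln N + N - ln N))%R).
  { assert (B := Hankel_circle_approx (N + 1) N HN ltac:(csimpl; lra)).
    apply Rle_trans with (1 := B). csimpl. rewrite Rplus_0_r, Rmult_0_r, exp_0.
    replace (1 + 1)%R with 2%R by ring. apply Rmult_le_compat_l; [lra|]. apply exp_le_compat; lra. }
  assert (Hc : forall s' x, Ccontinuous (angular_form s' exp_opp N) x).
  { intros s' x; apply (continuous_angular_form (fun _ => True) _ exp_opp (C1_exp_opp _)); exact I. }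
  assert (A3 : (Cmod (k * I1 - I2) <= k2 * exp (- N * ln N + N - ln N))%R).
  { assert (X : forall s', ex_CRInt (angular_form s' exp_opp N) 0 (0 + 2 * PI)) by (intros; apply ex_CRInt_continuous; auto).
    assert (EI : k * I1 - I2 = CRInt (fun p => k * angular_form (s + N + 1) exp_opp N p - angular_form (N + 1) exp_opp N p) 0 (0 + 2 * PI)).
    { symmetry. apply (is_CRInt_unique).
      apply (is_RInt_minus (V := C_R_NormedModule)).
      - apply is_CRInt_Cscal, X.
      - apply (CRInt_correct), X. }
    rewrite EI.
    (* The Gaussian rate N / 32 of [cos_upper] gives the factor 32 / N: the source of the constant
       in [k2] and of the gained 1 / N. *)
    apply Rle_trans with (exp (- N * ln N + N) * (Cmod s * exp (Cmod s * PI)) / (N / 32))%R.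
    - apply CRInt_gauss_le.
      + apply Rmult_le_pos; [left; apply exp_pos|exact Hk2].
      + lra.
      + intros x; apply continuous_Cplus; [apply continuous_Cmult; [apply continuous_Cconst|]|apply continuous_Copp]; apply Hc.
      + intros x Hx.
        replace (k * angular_form (s + N + 1) exp_opp N x - angular_form (N + 1) exp_opp N x)
          (* For t = N e^(ix) one has N^s e^(pi i s) t^(-s) = e^(i s (pi - x)), which is 1 at the
             saddle point x = pi. *)
          with (angular_form (N + 1) exp_opp N x * (Cexp (Ci * s * (PI - x)%R) - 1)).
        2: { unfold angular_form, integrand, k.
          replace (Cexp (s * ln N + PI * Ci * s) * (Cexp (- (s + N + 1) * (ln N, x)) * exp_opp (polar N x) * (Ci * polar N x)))
            with (Cexp (s * ln N + PI * Ci * s) * Cexp (- (s + N + 1) * (ln N, x)) * (exp_opp (polar N x) * (Ci * polar N x))) by ring.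
          rewrite <- Cexp_plus.
          replace (s * ln N + PI * Ci * s + - (s + N + 1) * (ln N, x))
            with (- (N + 1) * (ln N, x) + Ci * s * (PI - x)%R) by (apply C_ext; csimpl; ring).
          rewrite Cexp_plus. ring. }
        rewrite Cmod_mult, Cmod_angular_form by lra. unfold integrand. rewrite Cmod_mult, Cmod_exp_opp, Cmod_Cexp.
        assert (P1 : (exp (Re (- (N + 1) * (ln N, x))) * exp (- (N * cos x)) * N <=
           exp (- N * ln N + N) * exp (- (N / 32) * (x - PI) ^ 2))%R).
        { rewrite <- (exp_ln N) at 4 by lra. rewrite <- !exp_plus. apply exp_le_compat. csimpl.
          pose proof (cos_upper (x - PI) ltac:(lra)) as CU.
          assert (EC : cos (x - PI) = (- cos x)%R) by (rewrite cos_minus, cos_PI, sin_PI; ring).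
          rewrite EC in CU. nra. }
        assert (P2 : (Cmod (Cexp (Ci * s * (PI - x)%R) - 1) <= (Cmod s * exp (Cmod s * PI)) * Rabs (x - PI))%R).
        { apply Rle_trans with (1 := Cmod_Cexp_minus_1 _).
          rewrite 2!Cmod_mult, Cmod_Ci, Cmod_R, Rmult_1_l, (Rabs_minus_sym PI x).
          assert (exp (Cmod s * Rabs (x - PI)) <= exp (Cmod s * PI))%R.
          { apply exp_le_compat, Rmult_le_compat_l; [exact Hs0|apply Rabs_le; lra]. }
          pose proof (Rabs_pos (x - PI)).
          apply Rle_trans with (Cmod s * Rabs (x - PI) * exp (Cmod s * PI))%R; [|right; ring].
          apply Rmult_le_compat_l; [apply Rmult_le_pos; assumption|assumption]. }
        eapply Rle_trans.
        * apply Rmult_le_compat; [|apply Cmod_ge_0|exact P1|exact P2].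
          apply Rmult_le_pos; [apply Rmult_le_pos; left; apply exp_pos|lra].
        * right; ring.
    - right. unfold k2. replace (exp (- N * ln N + N - ln N)) with (exp (- N * ln N + N) * / N)%R.
      + field; lra.
      + replace (- N * ln N + N - ln N)%R with (- N * ln N + N + - ln N)%R by ring.
        rewrite (exp_plus _ (- ln N)), exp_Ropp, exp_ln by lra. reflexivity. }
  replace (k * Hankel (s + N + 1) - Hankel (N + 1)) with
    (k * (Hankel (s + N + 1) - I1) + - (Hankel (N + 1) - I2) + (k * I1 - I2)) by ring.
  eapply Rle_trans; [apply Cmod_triangle|].
  eapply Rle_trans; [apply Rplus_le_compat_r, Cmod_triangle|].
  rewrite Cmod_opp. lra.
Qed.

(** The expression is n^(-1/2). *)
Lemma exp_half_ln_small (eps : R) : (0 < eps)%R ->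
  exists n0 : nat, forall n, (n0 <= n)%nat -> (exp (- (ln (INR n) / 2)) < eps)%R.
Proof.
  intros He. destruct (INR_unbounded (exp (- 2 * ln eps))) as [n0 Hn0].
  exists n0; intros n Hn. apply le_INR in Hn.
  rewrite <- (exp_ln eps) by exact He. apply exp_increasing.
  assert (H : (ln (exp (- 2 * ln eps)) < ln (INR n))%R).
  { apply ln_increasing; [apply exp_pos|lra]. }
  rewrite ln_exp in H. lra.
Qed.

(** n! n^s / Gamma(s + n + 1) tends to 1. The number 1 is replaced by n! / Gamma(n + 1), so that
    [Hankel_asymptotic] applies to the difference; its error O(n^(-n-1) e^n) times n! = O(n^(n +
    1/2) e^(-n)) leaves n^(-1/2). *)
Lemma gauss_ratio_limit (s : C) : exists (K : R) (n0 : nat), (0 <= K)%R /\ forall n : nat, (n0 <= n)%nat ->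
  (Cmod (INR (fact n) * Cexp (s * ln (INR n)) * recip_gamma (s + INR n + 1) - 1) <= K * exp (- (ln (INR n) / 2)))%R.
Proof.
  destruct (Hankel_asymptotic s) as (K & HK & HA).
  (* From [S n0] on, both n >= 1 and Re s + n + 1 >= 0 hold, as [Hankel_asymptotic] requires. *)
  destruct (INR_unbounded (Rabs (Re s) + 1)) as [n0 Hn0].
  exists (K * exp 1)%R, (S n0). split; [apply Rmult_le_pos; [exact HK|left; apply exp_pos]|].
  intros n Hn.
  assert (Hn' : (INR n0 + 1 <= INR n)%R) by (rewrite <- S_INR; apply le_INR, Hn).
  pose proof (Rabs_pos (Re s)). pose proof (Rle_abs (- Re s)). rewrite Rabs_Ropp in H0.
  set (N := INR n) in *.
  specialize (HA N ltac:(lra) ltac:(lra)).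
  assert (EQ : INR (fact n) * Cexp (s * ln N) * recip_gamma (s + N + 1) - 1 =
     - (INR (fact n) * Cexp (PI * Ci * (N + 1)) / (2 * PI * Ci)) *
     (Cexp (s * ln N + PI * Ci * s) * Hankel (s + N + 1) - Hankel (N + 1))).
  { transitivity (INR (fact n) * Cexp (s * ln N) * recip_gamma (s + N + 1) - INR (fact n) * recip_gamma (N + 1)).
    { unfold N; rewrite recip_gamma_fact; reflexivity. }
    unfold recip_gamma.
    replace (PI * Ci * (s + N + 1)) with (PI * Ci * s + PI * Ci * (N + 1)) by ring.
    rewrite 2!Cexp_plus. field. split; [apply Ci_nz|apply RtoC_PI_neq_0]. }
  rewrite EQ, Cmod_mult, Cmod_opp, Cmod_div, Cmod_mult by apply two_pi_i_neq_0.
  rewrite !Cmod_mult, Cmod_Cexp, Cmod_Ci, !Cmod_R.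
  replace (Re (PI * Ci * (N + 1))) with 0%R by (csimpl; ring).
  pose proof PI_RGT_0. rewrite exp_0, (Rabs_pos_eq 2), (Rabs_pos_eq PI) by lra.
  rewrite (Rabs_pos_eq (INR (fact n))) by apply pos_INR.
  assert (HF : (INR (fact n) <= exp (1 + (N + 1 / 2) * ln N - N))%R).
  { unfold N. destruct n as [|n]; [lia|apply fact_upper]. }
  apply Rle_trans with (INR (fact n) * (K * exp (- N * ln N + N - ln N)))%R.
  - apply Rmult_le_compat; [|apply Cmod_ge_0| |exact HA].
    + apply Rmult_le_pos; [apply Rmult_le_pos; [apply pos_INR|lra]|]. left; apply Rinv_0_lt_compat; lra.
    + apply Rmult_le_reg_r with (2 * PI)%R; [lra|].
      replace (INR (fact n) * 1 / (2 * PI * 1) * (2 * PI))%R with (INR (fact n)) by (field; lra).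
      pose proof (pos_INR (fact n)). pose proof PI2_3_2. nra.
  - apply Rle_trans with (exp (1 + (N + 1 / 2) * ln N - N) * (K * exp (- N * ln N + N - ln N)))%R.
    + apply Rmult_le_compat_r; [apply Rmult_le_pos; [exact HK|left; apply exp_pos]|exact HF].
    + right. replace (- (ln N / 2))%R with (- (1) + (1 + (N + 1 / 2) * ln N - N) + (- N * ln N + N - ln N))%R by field.
      rewrite (exp_plus _ (- N * ln N + N - ln N)), (exp_plus (- (1))), (exp_Ropp 1).
      field. pose proof (exp_pos 1); lra.
Qed.

(** By [recip_gamma_rising] the n-th Gauss term is [recip_gamma s] divided by the ratio of
    [gauss_ratio_limit]. This also covers the poles of Gamma, where both vanish for large n. *)
Lemma rGamma_limit (s : C) :
  filterlim (fun n => rising s (S n) / INR (fact n) * Cexp (- s * ln (INR n))) eventually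
    (Clocally (recip_gamma s)).
Proof.
  destruct (gauss_ratio_limit s) as (K & n0 & HK & HA).
  apply locally_C_Cmod; [exact _|]. intros eps Heps.
  set (v n := INR (fact n) * Cexp (s * ln (INR n)) * recip_gamma (s + INR n + 1)) in HA.
  pose proof (Cmod_ge_0 (recip_gamma s)) as H0.
  set (e1 := (Rmin (1 / 2) (eps / (2 * (Cmod (recip_gamma s) + 1))) / (K + 1))%R).
  (* The bound 1/2 keeps the ratio away from 0, the other bound makes the quotient close to its
     limit. *)
  assert (Hm : (0 < Rmin (1 / 2) (eps / (2 * (Cmod (recip_gamma s) + 1))))%R).
  { apply Rmin_glb_lt; [lra|apply Rdiv_lt_0_compat; lra]. }
  assert (He1 : (0 < e1)%R) by (apply Rdiv_lt_0_compat; lra).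
  destruct (exp_half_ln_small e1 He1) as [n1 Hn1].
  exists (n0 + n1)%nat; intros n Hn.
  specialize (HA n ltac:(lia)). specialize (Hn1 n ltac:(lia)).
  assert (Hv : (Cmod (v n - 1) < Rmin (1 / 2) (eps / (2 * (Cmod (recip_gamma s) + 1))))%R).
  { apply Rle_lt_trans with (1 := HA).
    apply Rle_lt_trans with (K * e1)%R; [apply Rmult_le_compat_l; lra|].
    apply Rlt_le_trans with ((K + 1) * e1)%R; [nra|]. right. unfold e1. field. lra. }
  assert (Hv1 : (Cmod (v n - 1) < 1 / 2)%R) by (apply Rlt_le_trans with (1 := Hv), Rmin_l).
  assert (Hv2 : (Cmod (v n - 1) < eps / (2 * (Cmod (recip_gamma s) + 1)))%R) by (apply Rlt_le_trans with (1 := Hv), Rmin_r).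
  assert (Hvn : (1 / 2 <= Cmod (v n))%R).
  { pose proof (Cmod_triangle (v n) (- (v n - 1))) as T.
    replace (v n + - (v n - 1)) with (RtoC 1) in T by ring. rewrite Cmod_1, Cmod_opp in T. lra. }
  assert (Hv0 : v n <> 0) by (apply Cmod_gt_0; lra).
  assert (EU : rising s (S n) / INR (fact n) * Cexp (- s * ln (INR n)) = recip_gamma s / v n).
  { rewrite (recip_gamma_rising s (S n)). replace (s + INR (S n)) with (s + INR n + 1) by (rewrite S_INR, RtoC_plus; ring).
    replace (- s * ln (INR n)) with (- (s * ln (INR n))) by ring. rewrite Cexp_opp.
    assert (recip_gamma (s + INR n + 1) <> 0).
    { intros E; apply Hv0; unfold v; rewrite E; ring. }
    unfold v. field. repeat split; [|apply Cexp_neq_0|apply INR_fact_neq_0_C]; assumption. }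
  rewrite EU.
  replace (recip_gamma s / v n - recip_gamma s) with (- (recip_gamma s * (v n - 1) / v n)) by (field; exact Hv0).
  rewrite Cmod_opp, Cmod_div, Cmod_mult by exact Hv0.
  apply Rle_lt_trans with (Cmod (recip_gamma s) * Cmod (v n - 1) * 2)%R.
  - apply Rmult_le_compat_l; [apply Rmult_le_pos; apply Cmod_ge_0|].
    apply Rmult_le_reg_r with (Cmod (v n)); [lra|]. rewrite Rinv_l by lra. lra.
  - apply Rle_lt_trans with ((Cmod (recip_gamma s)) * (eps / (2 * (Cmod (recip_gamma s) + 1))) * 2)%R.
    + apply Rmult_le_compat_r; [lra|]. apply Rmult_le_compat_l; lra.
    + apply Rmult_lt_reg_r with (Cmod (recip_gamma s) + 1)%R; [lra|].
      replace (Cmod (recip_gamma s) * (eps / (2 * (Cmod (recip_gamma s) + 1))) * 2 * (Cmod (recip_gamma s) + 1))%R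
        with (Cmod (recip_gamma s) * eps)%R by (field; lra). nra.
Qed.

Lemma rGamma_recip_gamma (s : C) : rGamma s = recip_gamma s.
Proof.
  pose proof (rGamma_limit s) as L.
  assert (LR : is_lim_seq (fun n => Re (rising s (S n) / INR (fact n) * Cexp (- s * ln (INR n)))) (Re (recip_gamma s))).
  { apply (filterlim_comp nat C R _ Re eventually (Clocally (recip_gamma s)) (locally (Re (recip_gamma s))) L).
    apply (continuous_Re (T := C_UniformSpace) (fun z => z)), continuous_id. }
  assert (LI : is_lim_seq (fun n => Im (rising s (S n) / INR (fact n) * Cexp (- s * ln (INR n)))) (Im (recip_gamma s))).
  { apply (filterlim_comp nat C R _ Im eventually (Clocally (recip_gamma s)) (locally (Im (recip_gamma s))) L).
    apply (continuous_Im (T := C_UniformSpace) (fun z => z)), continuous_id. }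
  unfold rGamma. rewrite (is_lim_seq_unique _ _ LR), (is_lim_seq_unique _ _ LI).
  apply C_ext; reflexivity.
Qed.

(** Between the directions 0 and [a] the cosine is at least cos a > 0, so e^(-t) decays uniformly.
    The sign of [a] decides which direction comes first in [loop_rotate]. *)
Lemma loop_exp_opp_rotate (s : C) (a d : R) : (0 < d)%R -> (- (PI / 2) < a < PI / 2)%R ->
  loop_ok s exp_opp a d /\ loop_integral s exp_opp a d = Hankel s.
Proof.
  intros Hd Ha. pose proof PI_RGT_0.
  assert (Hc : (0 < cos a)%R) by (apply cos_gt_0; lra).
  assert (D : forall a1 a2, ((a1 = 0 /\ a2 = a) \/ (a1 = a /\ a2 = 0))%R -> (a1 <= a2)%R ->
    exists M, forall rho phi, (d <= rho)%R -> (a1 <= phi <= a2)%R ->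
    (Cmod (integrand s exp_opp rho phi) <= M * exp (- (cos a / 2) * rho))%R).
  { intros a1 a2 H12 Hle. apply (integrand_decay s exp_opp d a1 a2 1 (cos a) Hd Hc).
    intros rho phi Hr Hp. rewrite Cmod_exp_opp, Rmult_1_l. apply exp_le_compat.
    assert (cos a <= cos phi)%R; [|nra].
    destruct H12 as [[-> ->]|[-> ->]].
    - apply cos_decr_1; lra.
    - rewrite <- (cos_neg a), <- (cos_neg phi). apply cos_decr_1; lra. }
  destruct (Rle_lt_dec 0 a) as [H0|H0].
  - destruct (D 0%R a ltac:(left; auto) H0) as [M HM]. split.
    + apply (loop_ok_rotate (fun _ => True) s exp_opp 0 a d M (cos a / 2) d); first [exact HM | apply C1_exp_opp | intros; exact I | lra].
    + rewrite <- (loop_rotate (fun _ => True) s exp_opp 0 a d M (cos a / 2) d); first [exact HM | apply C1_exp_opp | intros; exact I | lra | apply Hankel_delta, Hd].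
  - destruct (D a 0%R ltac:(right; auto) ltac:(lra)) as [M HM]. split.
    + apply (loop_ok_rotate (fun _ => True) s exp_opp a 0 d M (cos a / 2) d); first [exact HM | apply C1_exp_opp | intros; exact I | lra].
    + rewrite (loop_rotate (fun _ => True) s exp_opp a 0 d M (cos a / 2) d); first [exact HM | apply C1_exp_opp | intros; exact I | lra | apply Hankel_delta, Hd].
Qed.

(** * The functions p_n as integrals over a tilted loop *)

Lemma Carg_upper (y : C) : (0 <= Re y)%R -> (0 < Im y)%R ->
  (0 < Carg y <= PI / 2)%R /\ y = polar (Cmod y) (Carg y).
Proof.
  intros Hr Hi. unfold Carg. destruct (Rle_dec 0 (Im y)) as [_|N]; [|lra].
  assert (Hy : (0 < Cmod y)%R).
  { apply Cmod_gt_0. intros E; rewrite E in Hi; simpl in Hi; lra. }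
  pose proof (Cmod2_alt y) as Q.
  assert (B : (Re y < Cmod y)%R) by nra.
  set (u := (Re y / Cmod y)%R).
  assert (Hu : (0 <= u < 1)%R).
  { split; [apply Rmult_le_pos; [exact Hr|left; apply Rinv_0_lt_compat, Hy]|].
    unfold u. apply Rmult_lt_reg_r with (Cmod y); [exact Hy|]. unfold Rdiv. rewrite Rmult_assoc, Rinv_l; lra. }
  assert (Hcos : cos (acos u) = u) by (apply cos_acos; lra).
  pose proof (acos_bound u) as Hb. pose proof PI_RGT_0.
  split.
  - split.
    + destruct (Req_dec (acos u) 0) as [E|E]; [rewrite E, cos_0 in Hcos; lra|lra].
    + apply Rnot_lt_le; intros Hlt. pose proof (cos_lt_0 (acos u) Hlt ltac:(lra)). lra.
  - unfold polar. rewrite Hcos, sin_acos by lra.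
    assert (Hy2 : (Cmod y * u = Re y)%R) by (unfold u; field; lra).
    apply C_ext; [change (Re y = (Cmod y * u)%R)|change (Im y = (Cmod y * sqrt (1 - u²))%R)].
    + symmetry; exact Hy2.
    + assert (Hs : (Cmod y * sqrt (1 - u²))² = (Im y)²).
      { rewrite Rsqr_mult, Rsqr_sqrt by (unfold Rsqr; nra).
        replace ((Cmod y)² * (1 - u²))%R with ((Cmod y)^2 - (Cmod y * u)^2)%R by (unfold Rsqr; ring).
        rewrite Hy2, Q. unfold Rsqr; ring. }
      apply Rsqr_inj in Hs; [symmetry; exact Hs| |lra].
      apply Rmult_le_pos; [lra|apply sqrt_pos].
Qed.

(** The substitution y t turns the ray to the argument Carg y - phi. Because phi > 0, it lies
    strictly inside the right half-plane even when Re y = 0 and Carg y = pi/2. Rotating by exactly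
    Carg y makes the power principal. *)
Lemma loop_exp_upper (s y : C) (phi d : R) : (0 <= Re y)%R -> (0 < Im y)%R ->
  (0 < phi <= PI / 4)%R -> (0 < d)%R ->
  loop_ok s (fun t => Cexp (- y * t)) (- phi) d /\
  loop_integral s (fun t => Cexp (- y * t)) (- phi) d = Cpow_principal y (s - 1) * Hankel s.
Proof.
  intros Hr Hi Hphi Hd. destruct (Carg_upper y Hr Hi) as [Ha Hy].
  assert (Hy0 : (0 < Cmod y)%R).
  { apply Cmod_gt_0. intros E; rewrite E in Hi; simpl in Hi; lra. }
  pose proof PI_RGT_0.
  destruct (loop_exp_opp_rotate s (- phi + Carg y) (Cmod y * d)) as [H1 H2];
    [apply Rmult_lt_0_compat; assumption|lra|].
  assert (E : (fun t => Cexp (- y * t)) = (fun t => exp_opp (polar (Cmod y) (Carg y) * t))).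
  { apply functional_extensionality; intros t.
    rewrite <- Hy. unfold exp_opp. f_equal. ring. }
  rewrite E. split.
  - apply loop_ok_scale; assumption.
  - rewrite loop_scale, H2 by assumption. reflexivity.
Qed.

Notation Csum := (sum_n (G := C_AbelianMonoid)).

(** Pascal's rule summed up to [j], with a boundary term. The range stops at n because
    [Binomial.C n (S n)] is not 0: its factorials use truncated subtraction. *)
Lemma binomial_sum_partial (a : nat -> C) (n j : nat) : (j <= n)%nat ->
  Csum (fun m => Binomial.C (S n) m * a m) j + Binomial.C n j * a (S j) =
  Csum (fun m => Binomial.C n m * a m) j + Csum (fun m => Binomial.C n m * a (S m)) j.
Proof.
  induction j as [|j IH]; intros Hj.
  - rewrite !sum_n_0_C.
    assert (E : forall k, Binomial.C k 0 = 1%R).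
    { intros k; unfold Binomial.C. rewrite Nat.sub_0_r. simpl. field. apply INR_fact_neq_0. }
    rewrite !E. ring.
  - rewrite 3!sum_n_Sm_C. specialize (IH ltac:(lia)).
    pose proof (pascal n j ltac:(lia)) as P.
    rewrite <- P, RtoC_plus.
    transitivity (Csum (fun m => Binomial.C (S n) m * a m) j + Binomial.C n j * a (S j)
      + Binomial.C n (S j) * a (S j) + Binomial.C n (S j) * a (S (S j))); [ring|].
    rewrite IH. ring.
Qed.

Lemma binomial_sum_S (a : nat -> C) (n : nat) :
  Csum (fun m => Binomial.C (S n) m * a m) (S n) =
  Csum (fun m => Binomial.C n m * a m) n + Csum (fun m => Binomial.C n m * a (S m)) n.
Proof.
  rewrite <- (binomial_sum_partial a n n (Nat.le_refl n)), sum_n_Sm_C.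
  assert (E : forall k, Binomial.C k k = 1%R).
  { intros k; unfold Binomial.C. rewrite Nat.sub_diag. simpl. field. apply INR_fact_neq_0. }
  rewrite !E. reflexivity.
Qed.

Lemma Csum_ext (u v : nat -> C) (n : nat) : (forall m, u m = v m) -> Csum u n = Csum v n.
Proof. intros E; apply (sum_n_ext (G := C_AbelianMonoid)); exact E. Qed.

Lemma Csum_scal (k : C) (u : nat -> C) (n : nat) : Csum (fun m => k * u m) n = k * Csum u n.
Proof. exact (sum_n_mult_l (K := C_Ring) k u n). Qed.

Definition p_integrand (x : C) (n : nat) (t : C) : C := Cexp (- x * t) * (1 - Cexp (- t)) ^ n.

(** One more factor 1 - e^(-t) is a finite difference in x; iterating it produces the binomial sum
    of [p_sum]. *)
Lemma p_integrand_S (x : C) (n : nat) (t : C) : p_integrand x (S n) t = p_integrand x n t + - (1) * p_integrand (x + 1) n t.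
Proof.
  unfold p_integrand. rewrite Cpow_S. replace (- (x + 1) * t) with (- x * t + - t) by ring.
  rewrite Cexp_plus. ring.
Qed.

(** Induction on n for all x at once, since the recursion shifts x by 1. The hypotheses include Re x
    = 0, where only the tilt of the ray makes the integral converge absolutely. *)
Lemma loop_p_integrand_upper (s : C) (n : nat) (x : C) (phi d : R) : (0 <= Re x)%R -> (0 < Im x)%R ->
  (0 < phi <= PI / 4)%R -> (0 < d)%R ->
  loop_ok s (p_integrand x n) (- phi) d /\
  loop_integral s (p_integrand x n) (- phi) d =
  Hankel s * Csum (fun m => Binomial.C n m * ((- (1)) ^ m * Cpow_principal (x + INR m) (s - 1))) n.
Proof.
  intros Hr Hi Hphi Hd. revert x Hr Hi; induction n as [|n IH]; intros x Hr Hi.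
  - destruct (loop_exp_upper s x phi d Hr Hi Hphi Hd) as [H1 H2].
    assert (E : p_integrand x 0 = (fun t => Cexp (- x * t))).
    { apply functional_extensionality; intros t; unfold p_integrand. rewrite Cmult_1_r. reflexivity. }
    rewrite E. split; [exact H1|]. rewrite H2, sum_n_0_C.
    replace (Binomial.C 0 0) with 1%R by (unfold Binomial.C; simpl; field). simpl INR.
    rewrite Cplus_0_r. change ((- (1)) ^ 0) with (RtoC 1). ring.
  - destruct (IH x Hr Hi) as [H1 E1].
    destruct (IH (x + 1)) as [H2 E2]; [csimpl; lra|csimpl; lra|].
    assert (E : p_integrand x (S n) = (fun t => p_integrand x n t + - (1) * p_integrand (x + 1) n t)).
    { apply functional_extensionality; intros t; apply p_integrand_S. }
    rewrite E. split; [apply loop_ok_plus; [exact H1|apply loop_ok_scal, H2]|].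
    rewrite loop_plus; [|exact H1|apply loop_ok_scal, H2].
    rewrite loop_scal by exact H2. rewrite E1, E2, binomial_sum_S.
    rewrite (Csum_ext (fun m => Binomial.C n m * ((- (1)) ^ S m * Cpow_principal (x + INR (S m)) (s - 1)))
      (fun m => - (1) * (Binomial.C n m * ((- (1)) ^ m * Cpow_principal (x + 1 + INR m) (s - 1))))).
    + rewrite Csum_scal. ring.
    + intros m. rewrite Cpow_S, S_INR, RtoC_plus.
      replace (x + (INR m + 1)) with (x + 1 + INR m) by ring. ring.
Qed.

Lemma p_sum_eq_loop (n : nat) (x s : C) (phi d : R) : (0 <= Re x)%R -> (0 < Im x)%R ->
  (0 < phi <= PI / 4)%R -> (0 < d)%R ->
  p_sum n x s = loop_integral s (p_integrand x n) (- phi) d.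
Proof.
  intros Hr Hi Hphi Hd. rewrite (proj2 (loop_p_integrand_upper s n x phi d Hr Hi Hphi Hd)).
  unfold p_sum. rewrite rGamma_recip_gamma.
  rewrite (Csum_ext _ (fun m => Binomial.C n m * ((- (1)) ^ m * Cpow_principal (x + INR m) (s - 1))))
    by (intros m; ring).
  f_equal. unfold recip_gamma. rewrite Cexp_opp.
  field.
  repeat split; [apply Ci_nz|apply RtoC_PI_neq_0|apply Cexp_neq_0].
Qed.

Lemma Cmod_exp_polar (x : C) (r p : R) :
  Cmod (Cexp (- x * polar r p)) = exp (- (Re x * cos p - Im x * sin p) * r).
Proof. rewrite Cmod_Cexp. f_equal. unfold polar; csimpl; ring. Qed.

Lemma C1_exp_lin (U : C -> Prop) (x : C) : C1_on U (fun t => Cexp (- x * t)).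
Proof. apply C1_Cexp, C1_mult; [apply C1_const|apply C1_id]. Qed.

Lemma C1_1mexp (U : C -> Prop) : C1_on U (fun t => 1 - Cexp (- t)).
Proof. apply C1_minus; [apply C1_const|apply C1_Cexp, C1_opp, C1_id]. Qed.

Lemma C1_p_integrand (U : C -> Prop) (x : C) (n : nat) : C1_on U (p_integrand x n).
Proof. apply C1_mult; [apply C1_exp_lin|apply C1_pow, C1_1mexp]. Qed.

Lemma Cmod_1mexp_le (t : C) : (Cmod (1 - Cexp (- t)) <= 1 + exp (- Re t))%R.
Proof.
  apply Rle_trans with (1 := Cmod_triangle _ _). rewrite Cmod_opp, Cmod_1, Cmod_Cexp.
  right; f_equal.
Qed.

(** For Re x > 0 the integrand decays on the whole sector between the tilted ray and the real axis;
    there Re tau >= 0, so the n-th power is at most 2^n. *)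
Lemma p_integral_eq_loop (n : nat) (x s : C) (phi d : R) : (0 < Re x)%R -> (0 < Im x)%R ->
  (0 < phi <= PI / 4)%R -> (0 < d <= 1)%R ->
  p_integral n x s = loop_integral s (p_integrand x n) (- phi) d.
Proof.
  intros Hr Hi Hphi Hd. pose proof PI_RGT_0.
  assert (Hcp : (0 < cos phi)%R) by (apply cos_gt_0; lra).
  assert (Hc : (0 < Re x * cos phi)%R) by (apply Rmult_lt_0_compat; assumption).
  destruct (integrand_decay s (p_integrand x n) 1 (- phi) 0 (2 ^ n) (Re x * cos phi) ltac:(lra) Hc) as [M HM].
  { intros r p Hr1 Hp. unfold p_integrand. rewrite Cmod_mult, Cmod_exp_polar, Cmod_pow, Rmult_comm.
    assert (Hcos : (cos phi <= cos p)%R).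
    { rewrite <- (cos_neg p). apply cos_decr_1; lra. }
    assert (Hsin : (sin p <= 0)%R).
    { replace p with (- - p)%R by ring. rewrite sin_neg.
      pose proof (sin_ge_0 (- p) ltac:(lra) ltac:(lra)). lra. }
    apply Rmult_le_compat; [apply pow_le, Cmod_ge_0|left; apply exp_pos| |].
    - apply pow_incr; split; [apply Cmod_ge_0|]. apply Rle_trans with (1 := Cmod_1mexp_le _).
      assert (exp (- Re (polar r p)) <= exp 0)%R; [|rewrite exp_0 in *; lra].
      apply exp_le_compat. unfold polar; csimpl. nra.
    - apply exp_le_compat.
      apply Rmult_le_compat_r; [lra|]. apply Ropp_le_contravar.
      pose proof (Rmult_le_compat_l (Re x) _ _ ltac:(lra) Hcos). nra. }
  unfold p_integral. change (fun tau => Cexp (- x * tau) * (1 - Cexp (- tau)) ^ n) with (p_integrand x n).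
  rewrite <- (loop_rotate (fun _ => True) s (p_integrand x n) (- phi) 0 1 M (Re x * cos phi / 2) 1);
    first [exact HM | apply C1_p_integrand | intros; exact I | lra | idtac].
  symmetry. apply (loop_shrink (fun _ => True) s (p_integrand x n) (- phi) d 1 d);
    first [apply C1_p_integrand | intros; exact I | lra | idtac].
  - apply loop_p_integrand_upper; lra.
  - apply loop_p_integrand_upper; lra.
Qed.

(** One description for both clauses in the definition of [p]; from here on the boundary case Re x =
    0 needs no separate treatment. *)
Lemma p_eq_loop (n : nat) (x s : C) (phi d : R) : (0 <= Re x)%R -> (0 < Im x)%R ->
  (0 < phi <= PI / 4)%R -> (0 < d <= 1)%R ->
  p n x s = loop_integral s (p_integrand x n) (- phi) d.
Proof.
  intros Hr Hi Hphi Hd. unfold p. destruct (Rlt_dec 0 (Re x)).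
  - apply p_integral_eq_loop; assumption.
  - apply p_sum_eq_loop; try assumption; lra.
Qed.

(** * Growth of p_n and the series in q *)

Lemma Cmod_1mexp_sqr (t : C) :
  (Cmod (1 - Cexp (- t)) ^ 2 = 1 - exp (- Re t) * (2 * cos (Im t) - exp (- Re t)))%R.
Proof.
  rewrite Cmod2_alt. unfold Cexp; csimpl. rewrite cos_neg, sin_neg.
  pose proof (sin2_cos2 (snd t)) as H; unfold Rsqr in H.
  transitivity (1 - 2 * exp (- fst t) * cos (snd t) + exp (- fst t) * exp (- fst t) *
     (sin (snd t) * sin (snd t) + cos (snd t) * cos (snd t)))%R; [ring|rewrite H; ring].
Qed.

Lemma Cmod_1mexp_le_1 (t : C) : (exp (- Re t) <= 2 * cos (Im t))%R -> (Cmod (1 - Cexp (- t)) <= 1)%R.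
Proof.
  intros H. pose proof (Cmod_1mexp_sqr t) as E. pose proof (Cmod_ge_0 (1 - Cexp (- t))).
  pose proof (exp_pos (- Re t)). nra.
Qed.

(** Through e^(1/2) <= sqrt 3 = 2 cos (pi/6), which follows from e <= 3, and 1/2 <= pi/6. *)
Lemma Cmod_1mexp_small (t : C) : (Cmod t <= 1 / 2)%R -> (Cmod (1 - Cexp (- t)) <= 1)%R.
Proof.
  intros H. apply Cmod_1mexp_le_1.
  pose proof (re_le_Cmod t) as H1.
  assert (H2 : (Rabs (Im t) <= Cmod t)%R).
  { pose proof (Rmax_Cmod t). apply Rle_trans with (2 := H0). apply Rmax_r. }
  pose proof PI2_3_2 as HPI.
  apply Rle_trans with (sqrt 3).
  - apply Rle_trans with (exp (1 / 2)).
    + apply exp_le_compat. pose proof (Rle_abs (- Re t)). rewrite Rabs_Ropp in H0. lra.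
    + rewrite <- (sqrt_Rsqr (exp (1 / 2))) by (left; apply exp_pos).
      apply sqrt_le_1; [apply Rle_0_sqr|lra|]. unfold Rsqr. rewrite <- exp_plus.
      replace (1 / 2 + 1 / 2)%R with 1%R by field. apply exp_le_3.
  - apply Rle_trans with (2 * cos (PI / 6))%R; [rewrite cos_PI6; right; field|].
    apply Rmult_le_compat_l; [lra|].
    assert (E : cos (Im t) = cos (Rabs (Im t))).
    { unfold Rabs; destruct (Rcase_abs (Im t)); [rewrite cos_neg|]; reflexivity. }
    rewrite E. pose proof (Rabs_pos (Im t)). apply cos_decr_1; lra.
Qed.

(* On a ray close to the positive real axis, |Im tau| only exceeds PI / 3 once
   Re tau is so large that exp (- Re tau) <= r - 1. *)
Lemma small_angle (r : R) : (1 < r)%R -> exists phi : R, (0 < phi <= PI / 4)%R /\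
  forall rho, (0 <= rho)%R -> (Cmod (1 - Cexp (- polar rho (- phi))) <= r)%R.
Proof.
  intros Hr. set (L := Rabs (ln (r - 1))). pose proof (Rabs_pos (ln (r - 1))) as HL. fold L in HL.
  pose proof PI2_3_2 as HPI. pose proof PI_4.
  (* If rho sin phi > pi/3 > 1, then rho > 1 / phi >= 2 (L + 1); since cos phi >= 1/2, this gives Re
     tau >= L + 1 and e^(-Re tau) <= r - 1. *)
  set (phi := Rmin (PI / 4) (1 / (2 * (L + 1)))).
  assert (H1 : (phi <= PI / 4)%R) by apply Rmin_l.
  assert (H2 : (phi <= 1 / (2 * (L + 1)))%R) by apply Rmin_r.
  assert (H3 : (0 < phi)%R) by (apply Rmin_glb_lt; [lra|apply Rdiv_lt_0_compat; lra]).
  exists phi; split; [lra|]. intros rho Hrho.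
  assert (Hs : (0 < sin phi < phi)%R) by (split; [apply sin_gt_0; lra|apply sin_lt_x; lra]).
  assert (Hc : (1 / 2 <= cos phi)%R) by (rewrite <- cos_PI3; apply cos_decr_1; lra).
  destruct (Rle_lt_dec (rho * sin phi) (PI / 3)) as [Hv|Hv].
  - apply Rle_trans with 1%R; [|lra]. apply Cmod_1mexp_le_1.
    unfold polar; csimpl. rewrite cos_neg, sin_neg.
    replace (rho * - sin phi)%R with (- (rho * sin phi))%R by ring. rewrite cos_neg.
    assert (cos (PI / 3) <= cos (rho * sin phi))%R by (apply cos_decr_1; nra).
    rewrite cos_PI3 in *.
    assert (exp (- (rho * cos phi)) <= exp 0)%R by (apply exp_le_compat; nra).
    rewrite exp_0 in *. lra.
  - apply Rle_trans with (1 := Cmod_1mexp_le _). unfold polar; csimpl. rewrite cos_neg.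
    assert (exp (- (rho * cos phi)) <= exp (ln (r - 1)))%R; [|rewrite exp_ln in * by lra; lra].
    apply exp_le_compat. pose proof (Rle_abs (- ln (r - 1))) as A. rewrite Rabs_Ropp in A. fold L in A.
    apply (Rmult_le_compat_r (2 * (L + 1))) in H2; [|lra].
    replace (1 / (2 * (L + 1)) * (2 * (L + 1)))%R with 1%R in H2 by (field; lra).
    assert (1 < rho * phi)%R by nra.
    assert (L + 1 <= rho / 2)%R by nra.
    nra.
Qed.

Lemma integrand_circle_bound (s : C) (g : C -> C) (alpha d N0 : R) : (0 < d)%R ->
  (forall p, (Cmod (g (polar d p)) <= N0)%R) ->
  exists N, forall p, (alpha <= p <= alpha + 2 * PI)%R -> (Cmod (integrand s g d p) <= N)%R.
Proof.
  intros Hd HN. pose proof PI_RGT_0.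
  destruct (Cmod_Cexp_pow_le s d (Rabs alpha + 2 * PI) 1 Hd ltac:(lra)) as (M & HM0 & HM).
  exists (M * exp (1 * d) * N0)%R. intros p Hp. unfold integrand. rewrite Cmod_mult.
  apply Rmult_le_compat; [apply Cmod_ge_0|apply Cmod_ge_0| |apply HN].
  apply HM; [lra|]. pose proof (Rle_abs alpha). pose proof (Rle_abs (- alpha)).
  rewrite Rabs_Ropp in *. pose proof (Rabs_pos alpha). apply Rabs_le; lra.
Qed.

Lemma Cmod_exp_lin_le (x t : C) : (Cmod (Cexp (- x * t)) <= exp (Cmod x * Cmod t))%R.
Proof.
  rewrite Cmod_Cexp. apply exp_le_compat. rewrite <- Cmod_mult.
  apply Rle_trans with (1 := Rle_abs _). apply Rle_trans with (1 := re_le_Cmod _).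
  replace (- x * t) with (- (x * t)) by ring. rewrite Cmod_opp. right; reflexivity.
Qed.

(** The rate comes from Im x alone and thus survives at Re x = 0, provided that the angle stays
    below -phi. *)
Lemma polar_exp_rate (x : C) (phi p : R) : (0 <= Re x)%R -> (0 < Im x)%R -> (0 < phi)%R ->
  (- (PI / 4) <= p <= - phi)%R -> (Im x * sin phi <= Re x * cos p - Im x * sin p)%R.
Proof.
  intros Hr Hi Hphi Hp. pose proof PI_RGT_0.
  assert (H1 : (0 < cos p)%R) by (apply cos_gt_0; lra).
  assert (H2 : (sin phi <= - sin p)%R) by (rewrite <- sin_neg; apply sin_incr_1; lra).
  nra.
Qed.

Lemma exists_gt_1_mult_lt_1 (M : R) : (0 <= M < 1)%R -> exists r, (1 < r)%R /\ (r * M < 1)%R.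
Proof.
  intros HM. exists (2 / (1 + M))%R; split; apply Rmult_lt_reg_r with (1 + M)%R; try lra.
  - replace (2 / (1 + M) * (1 + M))%R with 2%R by (field; lra). lra.
  - replace (2 / (1 + M) * M * (1 + M))%R with (2 * M)%R by (field; lra). lra.
Qed.

Section PSeries.
Context (x s : C).
Hypothesis Hr : (0 <= Re x)%R.
Hypothesis Hi : (0 < Im x)%R.

(** The angle depends on r only and is fixed before the radius: later the radius has to be adapted
    to the poles, which depend on [a]. *)
Lemma p_loop_setup (r : R) : (1 < r)%R -> exists phi, (0 < phi <= PI / 4)%R /\
  forall d, (0 < d <= 1 / 2)%R -> exists M c N, (0 < c)%R /\
    (forall rho, (d <= rho)%R -> (Cmod (integrand s (fun t => Cexp (- x * t)%C) rho (- phi)) <= M * exp (- c * rho))%R) /\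
    (forall p, (- phi <= p <= - phi + 2 * PI)%R -> (Cmod (integrand s (fun t => Cexp (- x * t)%C) d p) <= N)%R) /\
    (forall t, contour (- phi) d t -> (Cmod (1 - Cexp (- t)) <= r)%R).
Proof.
  intros H1. destruct (small_angle r H1) as (phi & Hphi & Hw).
  exists phi; split; [exact Hphi|]. intros d Hd. pose proof PI_RGT_0.
  assert (Hs : (0 < Im x * sin phi)%R) by (apply Rmult_lt_0_compat; [exact Hi|apply sin_gt_0; lra]).
  destruct (integrand_decay s (fun t => Cexp (- x * t)) d (- phi) (- phi) 1 (Im x * sin phi) ltac:(lra) Hs) as [M HM].
  { intros rho p Hrho Hp. rewrite Cmod_exp_polar, Rmult_1_l. apply exp_le_compat.
    apply Rmult_le_compat_r; [lra|]. apply Ropp_le_contravar, polar_exp_rate; lra. }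
  destruct (integrand_circle_bound s (fun t => Cexp (- x * t)) (- phi) d (exp (Cmod x * d)) ltac:(lra)) as [N HN].
  { intros p. apply Rle_trans with (1 := Cmod_exp_lin_le _ _).
    rewrite Cmod_polar, Rabs_pos_eq by lra. right; reflexivity. }
  exists M, (Im x * sin phi / 2)%R, N. split; [lra|split; [|split; [exact HN|]]].
  - intros rho Hrho; apply HM; lra.
  - intros t [(rho & Hrho & ->)|(p & ->)].
    + apply Hw; lra.
    + apply Rle_trans with 1%R; [|lra]. apply Cmod_1mexp_small.
      rewrite Cmod_polar, Rabs_pos_eq; lra.
Qed.

Lemma p_bound (r : R) : (1 < r)%R -> exists K, forall n, (Cmod (p n x s) <= K * r ^ n)%R.
Proof.
  intros H1. destruct (p_loop_setup r H1) as (phi & Hphi & H).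
  destruct (H (1 / 2)%R ltac:(lra)) as (M & c & N & Hc & HM & HN & Hw).
  eexists. intros n. rewrite (p_eq_loop n x s phi (1 / 2)) by lra.
  exact (family_bound s (fun t => Cexp (- x * t)) (fun t => 1 - Cexp (- t)) (- phi) (1 / 2) M c N r
    ltac:(lra) Hc (C1_exp_lin _ x) (C1_1mexp _) HM HN Hw n).
Qed.

Lemma p_series (q : C) : (Cmod q < 1)%R -> exists phi, (0 < phi <= PI / 4)%R /\
  forall d, (0 < d <= 1 / 2)%R ->
  is_Cseries (fun n => q ^ n * p n x s)
    (loop_integral s (fun t => Cexp (- x * t) / (1 - q * (1 - Cexp (- t)))) (- phi) d).
Proof.
  intros Hq. pose proof (Cmod_ge_0 q) as Hq0.
  (* The tilted ray has |1 - e^(-tau)| <= r with r > 1; the geometric series needs |q| r < 1 as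
     well. *)
  destruct (exists_gt_1_mult_lt_1 (Cmod q) (conj Hq0 Hq)) as (r & H1 & H2). rewrite Rmult_comm in H2.
  destruct (p_loop_setup r H1) as (phi & Hphi & H).
  exists phi; split; [exact Hphi|]. intros d Hd.
  destruct (H d Hd) as (M & c & N & Hc & HM & HN & Hw).
  apply (is_series_ext (K := C_AbsRing) (V := C_NormedModule)
    (fun n => q ^ n * loop_integral s (fun t => Cexp (- x * t) * (1 - Cexp (- t)) ^ n) (- phi) d)).
  - intros n. rewrite (p_eq_loop n x s phi d) by lra. reflexivity.
  - apply (loop_geometric s q (fun t => Cexp (- x * t)) (fun t => 1 - Cexp (- t)) _ (- phi) d M c N r);
      try assumption; try lra.
    + apply C1_exp_lin.
    + apply C1_1mexp.
    + intros t _; reflexivity.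
Qed.

End PSeries.

(** * The integral for B at real a *)

Section RealB.
Context (x s : C) (a : R).
Hypothesis Hr : (0 <= Re x)%R.
Hypothesis Hi : (0 < Im x)%R.
Hypothesis Ha : (0 < a < 1)%R.

Let E := Cexp (2 * PI * Ci * a).
Let h (t : C) : C := Cexp (- x * t) / (E * Cexp (- t) - 1).
Let m := Rmin a (1 - a).

Lemma Cmod_E : Cmod E = 1%R.
Proof.
  unfold E; rewrite Cmod_Cexp. replace (Re (2 * PI * Ci * a)) with 0%R by (csimpl; ring). apply exp_0.
Qed.

(** For real [a] one has |E| = 1, so the denominator is bounded away from 0 in the right half-plane
    by an explicit amount. *)
Lemma denom_lower (t : C) : (1 - exp (- Re t) <= Cmod (E * Cexp (- t) - 1))%R.
Proof.
  pose proof (Cmod_triangle (E * Cexp (- t)) (- (E * Cexp (- t) - 1))) as T.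
  replace (E * Cexp (- t) + - (E * Cexp (- t) - 1)) with (RtoC 1) in T by ring.
  rewrite Cmod_1, Cmod_opp, Cmod_mult, Cmod_E, Cmod_Cexp in T. csimpl. lra.
Qed.

Lemma denom_right (t : C) : (0 < Re t)%R -> E * Cexp (- t) - 1 <> 0.
Proof.
  intros Ht. apply Cmod_gt_0. apply Rlt_le_trans with (2 := denom_lower t).
  assert (exp (- Re t) < exp 0)%R by (apply exp_increasing; lra). rewrite exp_0 in *; lra.
Qed.

(** The zeros of the denominator are 2 pi i (a - k), and the integers k = 0 and k = 1 are the
    nearest to [a]. *)
Lemma denom_small (t : C) : (0 < Cmod t < 2 * PI * m)%R -> E * Cexp (- t) - 1 <> 0.
Proof.
  intros Ht E0. pose proof PI_RGT_0.
  assert (E1 : Cexp (2 * PI * Ci * a + - t) = 1).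
  { rewrite Cexp_plus. fold E. rewrite <- (Cplus_0_l 1), <- E0. ring. }
  destruct (Cexp_eq_1 _ E1) as [k Hk].
  assert (Et : t = 2 * PI * Ci * (a - IZR k)%R).
  { rewrite RtoC_minus. transitivity (2 * PI * Ci * a - (2 * PI * Ci * a + - t)); [ring|rewrite Hk; ring]. }
  assert (M : Cmod t = (2 * PI * Rabs (a - IZR k))%R).
  { rewrite Et, !Cmod_mult, Cmod_Ci, !Cmod_R, (Rabs_pos_eq 2), (Rabs_pos_eq PI) by lra. ring. }
  assert (L : (m <= Rabs (a - IZR k))%R).
  { destruct (Z.le_gt_cases k 0) as [H0|H0].
    - apply IZR_le in H0. rewrite Rabs_pos_eq by lra. apply Rle_trans with (1 := Rmin_l _ _). lra.
    - assert (H1 : (1 <= k)%Z) by lia. apply IZR_le in H1. rewrite Rabs_left1 by lra.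
      apply Rle_trans with (1 := Rmin_r _ _). lra. }
  rewrite M in Ht. nra.
Qed.

Let U (t : C) : Prop := E * Cexp (- t) - 1 <> 0.

Lemma h_C1 : C1_on U h.
Proof.
  apply C1_mult; [apply C1_exp_lin|]. apply C1_inv; [intros w Hw; exact Hw|].
  apply C1_minus; [|apply C1_const]. apply C1_mult; [apply C1_const|apply C1_Cexp, C1_opp, C1_id].
Qed.

Lemma U_right (r p : R) : (0 < r)%R -> (- (PI / 2) < p < PI / 2)%R -> U (polar r p).
Proof.
  intros Hrr Hp; apply denom_right. unfold polar; csimpl.
  apply Rmult_lt_0_compat; [exact Hrr|apply cos_gt_0; lra].
Qed.

Lemma U_small (r p : R) : (0 < r < 2 * PI * m)%R -> U (polar r p).
Proof. intros H; apply denom_small. rewrite Cmod_polar, Rabs_pos_eq; lra. Qed.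

Lemma m_pos : (0 < m)%R.
Proof. apply Rmin_glb_lt; lra. Qed.

(** In this sector Re tau >= d cos (pi/4), which bounds the denominator from below, while the
    numerator decays by [polar_exp_rate]. *)
Lemma h_integrand_decay (phi d : R) : (0 < phi <= PI / 4)%R -> (0 < d)%R ->
  exists M c, (0 < c)%R /\ forall r p, (d <= r)%R -> (- (PI / 4) <= p <= - phi)%R ->
    (Cmod (integrand s h r p) <= M * exp (- c * r))%R.
Proof.
  intros Hphi Hd. pose proof PI_RGT_0.
  assert (Hs : (0 < Im x * sin phi)%R) by (apply Rmult_lt_0_compat; [exact Hi|apply sin_gt_0; lra]).
  assert (Hc4 : (0 < cos (PI / 4))%R) by (apply cos_gt_0; lra).
  assert (Hden : (0 < 1 - exp (- (d * cos (PI / 4))))%R).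
  { assert (exp (- (d * cos (PI / 4))) < exp 0)%R; [|rewrite exp_0 in *; lra].
    apply exp_increasing. pose proof (Rmult_lt_0_compat _ _ Hd Hc4). lra. }
  destruct (integrand_decay s h d (- (PI / 4)) (- phi) (/ (1 - exp (- (d * cos (PI / 4))))) (Im x * sin phi) Hd Hs) as [M HM].
  - intros r p Hrr Hp.
    assert (Hcp : (cos (PI / 4) <= cos p)%R) by (rewrite <- (cos_neg p); apply cos_decr_1; lra).
    unfold h. rewrite Cmod_div by (apply U_right; lra). rewrite Cmod_exp_polar. unfold Rdiv.
    rewrite Rmult_comm. apply Rmult_le_compat; [|left; apply exp_pos| |].
    + left; apply Rinv_0_lt_compat, Cmod_gt_0, U_right; lra.
    + apply Rinv_le_contravar; [exact Hden|].
      apply Rle_trans with (2 := denom_lower _). unfold polar; csimpl.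
      apply Rplus_le_compat_l, Ropp_le_contravar, exp_le_compat, Ropp_le_contravar.
      apply Rmult_le_compat; lra.
    + apply exp_le_compat. apply Rmult_le_compat_r; [lra|]. apply Ropp_le_contravar, polar_exp_rate; lra.
  - exists M, (Im x * sin phi / 2)%R; split; [lra|exact HM].
Qed.

Lemma h_loop_ok (phi d p : R) : (0 < phi <= PI / 4)%R -> (0 < d < 2 * PI * m)%R ->
  (- (PI / 4) <= p <= - phi)%R -> loop_ok s h p d.
Proof.
  intros Hphi Hd Hp. pose proof PI_RGT_0.
  destruct (h_integrand_decay phi d Hphi ltac:(lra)) as (M & c & Hc & HM).
  (* The sector widened by at most pi/8 still lies in the right half-plane. *)
  set (e := Rmin d (PI / 8)).
  assert (He : (0 < e)%R) by (apply Rmin_glb_lt; lra).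
  assert (He1 : (e <= d)%R) by apply Rmin_l.
  assert (He2 : (e <= PI / 8)%R) by apply Rmin_r.
  apply (loop_ok_rotate U s h (- (PI / 4)) (- phi) d M c e);
    first [exact h_C1 | exact HM | lra | idtac].
  - intros r q H1 H2; apply U_right; lra.
  - intros q; apply U_small; lra.
Qed.

(** The circle is shrunk within the pole-free disc, and the ray is turned within the right
    half-plane. *)
Lemma h_loop_deform (phi d : R) : (0 < phi <= PI / 4)%R -> (0 < d <= PI * m)%R ->
  loop_integral s h (- (PI / 4)) (PI * m) = loop_integral s h (- phi) d.
Proof.
  intros Hphi Hd. pose proof PI_RGT_0. pose proof m_pos as Hm.
  assert (Hpm : (0 < PI * m)%R) by (apply Rmult_lt_0_compat; assumption).
  transitivity (loop_integral s h (- (PI / 4)) d).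
  - symmetry. apply (loop_shrink U s h (- (PI / 4)) d (PI * m) d);
      first [exact h_C1 | lra | apply (h_loop_ok phi); lra | idtac].
    intros r p Hrr; apply U_small; lra.
  - destruct (h_integrand_decay phi d Hphi ltac:(lra)) as (M & c & Hc & HM).
    set (e := Rmin d (PI / 8)).
    assert (He : (0 < e)%R) by (apply Rmin_glb_lt; lra).
    assert (He1 : (e <= d)%R) by apply Rmin_l.
    assert (He2 : (e <= PI / 8)%R) by apply Rmin_r.
    apply (loop_rotate U s h (- (PI / 4)) (- phi) d M c e);
      first [exact h_C1 | exact HM | lra | idtac].
    + intros r q H1 H2; apply U_right; lra.
    + intros q; apply U_small; lra.
Qed.

Lemma h_loop_normalize (q : C) (phi d : R) : E - 1 <> 0 -> q = E / (E - 1) ->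
  (0 < phi <= PI / 4)%R -> (0 < d <= PI * m)%R ->
  loop_integral s h (- phi) d =
  / (E - 1) * loop_integral s (fun t => Cexp (- x * t) / (1 - q * (1 - Cexp (- t)))) (- phi) d.
Proof.
  intros HE Hq Hphi Hd. pose proof PI_RGT_0. pose proof m_pos as Hm.
  assert (Hpm : (0 < PI * m)%R) by (apply Rmult_lt_0_compat; assumption).
  assert (Hok : loop_ok s h (- phi) d) by (apply (h_loop_ok phi); lra).
  rewrite (loop_ext s (fun t => Cexp (- x * t) / (1 - q * (1 - Cexp (- t)))) (fun t => (E - 1) * h t)).
  - rewrite loop_scal by exact Hok. field. exact HE.
  - intros t Ht.
    assert (Ut : U t).
    { destruct Ht as [(r & Hrr & ->)|(p & ->)]; [apply U_right|apply U_small]; lra. }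
    unfold h. rewrite Hq.
    replace (1 - E / (E - 1) * (1 - Cexp (- t))) with ((E * Cexp (- t) - 1) / (E - 1)) by (field; exact HE).
    field. split; [exact Ut|exact HE].
  - apply loop_ok_scal, Hok.
Qed.

(** The substitution tau = 2 pi i t: the direction -3 pi/4 becomes -pi/4, the radius m/2 becomes pi
    m, and the factor (2 pi i)^(s-1) appears with argument pi/2. *)
Lemma B_loop_scale (z : C) (theta : R) : x = x_of z theta ->
  loop_integral s (fun t => Cexp (t * lnz z theta) * (Ci / (2 * Csin (PI * (t - a)))))
    (- (3 * PI / 4)) (Rmin a (1 - a) / 2) =
  Cexp (PI * Ci * a) * (Cexp ((s - 1) * (ln (2 * PI), (PI / 2)%R)) * loop_integral s h (- (PI / 4)) (PI * m)).
Proof.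
  intros Hx. pose proof PI_RGT_0. pose proof m_pos as Hm.
  assert (Hpm : (0 < PI * m)%R) by (apply Rmult_lt_0_compat; assumption).
  assert (Hok : loop_ok s h (- (3 * PI / 4) + PI / 2) (2 * PI * (Rmin a (1 - a) / 2))).
  { fold m. replace (- (3 * PI / 4) + PI / 2)%R with (- (PI / 4))%R by field.
    replace (2 * PI * (m / 2))%R with (PI * m)%R by field.
    apply (h_loop_ok (PI / 4)); lra. }
  assert (Hsc := loop_scale s h (- (3 * PI / 4)) (Rmin a (1 - a) / 2) (2 * PI) (PI / 2) ltac:(lra) Hok).
  assert (Hok' := loop_ok_scale s h (- (3 * PI / 4)) (Rmin a (1 - a) / 2) (2 * PI) (PI / 2) ltac:(lra) Hok).
  rewrite (loop_ext s _ (fun t => Cexp (PI * Ci * a) * h (polar (2 * PI) (PI / 2) * t))).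
  - rewrite loop_scal by exact Hok'. rewrite Hsc. fold m.
    replace (- (3 * PI / 4) + PI / 2)%R with (- (PI / 4))%R by field.
    replace (2 * PI * (m / 2))%R with (PI * m)%R by field. reflexivity.
  - intros t Ht.
    assert (P2 : polar (2 * PI) (PI / 2) = 2 * PI * Ci).
    { unfold polar. rewrite cos_PI2, sin_PI2. apply C_ext; csimpl; ring. }
    assert (Ut : U (2 * PI * Ci * t)).
    { rewrite <- P2. destruct Ht as [(r & Hrr & ->)|(p & ->)]; rewrite polar_mult.
      - fold m in Hrr. replace (PI / 2 + - (3 * PI / 4))%R with (- (PI / 4))%R by field.
        apply U_right; [apply Rmult_lt_0_compat; lra|lra].
      - fold m. apply U_small. nra. }
    unfold U in Ut. rewrite P2. unfold h.
    (* In terms of u the sine is (u - 1/u) / (2 i) and E e^(-tau) is u^(-2), so the claim becomes an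
       identity of rational functions. *)
    set (u := Cexp (PI * Ci * (t - a))).
    assert (Hu : u <> 0) by apply Cexp_neq_0.
    assert (E1 : E * Cexp (- (2 * PI * Ci * t)) = / (u * u)).
    { unfold E, u. rewrite <- 2!Cexp_plus, <- Cexp_opp. f_equal. ring. }
    assert (E2 : Cexp (- x * (2 * PI * Ci * t)) = Cexp (t * lnz z theta) * Cexp (- (PI * Ci * t))).
    { rewrite <- Cexp_plus, Hx. f_equal. unfold x_of. field. split; [apply Ci_nz|apply RtoC_PI_neq_0]. }
    assert (E3 : Cexp (PI * Ci * a) * Cexp (- (PI * Ci * t)) = / u).
    { unfold u. rewrite <- Cexp_plus, <- Cexp_opp. f_equal. ring. }
    assert (E4 : Csin (PI * (t - a)) = (u - / u) / (2 * Ci)).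
    { unfold Csin, u. rewrite <- Cexp_opp.
      replace (Ci * (PI * (t - a))) with (PI * Ci * (t - a)) by ring. reflexivity. }
    rewrite E1 in *. rewrite E2, E4.
    assert (Huu : u * u - 1 <> 0).
    { intros Z. apply Ut. assert (Z' : u * u = 1) by (rewrite <- (Cplus_0_l 1), <- Z; ring).
      rewrite Z'. field. }
    assert (Hi2 : Ci * Ci = - (1)) by (apply C_ext; csimpl; ring).
    assert (Hu1 : 1 - u * u <> 0).
    { intros Z; apply Huu. transitivity (- (1 - u * u)); [ring|rewrite Z; ring]. }
    transitivity (Cexp (t * lnz z theta) * (Cexp (PI * Ci * a) * Cexp (- (PI * Ci * t))) / (/ (u * u) - 1)).
    + rewrite E3.
      transitivity (Cexp (t * lnz z theta) * (Ci * Ci) * u / (u * u - 1));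
        [|rewrite Hi2]; field; repeat split; first [exact Hu | exact Huu | exact Hu1 | apply Ci_nz].
    + field. repeat split; first [exact Hu | exact Huu | exact Hu1].
  - apply loop_ok_scal, Hok'.
Qed.

End RealB.

(** * Power series *)

Ltac toR := match goal with |- ?a = ?b => change (@eq R a b); cbv beta end.

Notation Rsum := (sum_n (G := R_AbelianMonoid)).

Lemma Rsum_S (u : nat -> R) (n : nat) : Rsum u (S n) = (Rsum u n + u (S n))%R.
Proof. exact (sum_Sn (G := R_AbelianMonoid) u n). Qed.

Lemma Rsum_0 (u : nat -> R) : Rsum u 0 = u 0%nat.
Proof. exact (sum_O (G := R_AbelianMonoid) u). Qed.

Lemma Rsum_le (u v : nat -> R) (n : nat) : (forall k, (u k <= v k)%R) -> (Rsum u n <= Rsum v n)%R.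
Proof.
  intros H; induction n as [|n IH]; [rewrite !Rsum_0; apply H|].
  rewrite !Rsum_S. specialize (H (S n)). lra.
Qed.

Lemma Rsum_scal_r (c : R) (u : nat -> R) (n : nat) : Rsum (fun k => u k * c)%R n = (Rsum u n * c)%R.
Proof. induction n as [|n IH]; [rewrite !Rsum_0; toR; ring|rewrite !Rsum_S, IH; toR; ring]. Qed.

Lemma Rsum_geom (q : R) (n : nat) : (0 <= q < 1)%R -> (Rsum (fun k => q ^ k) n <= / (1 - q))%R.
Proof.
  intros Hq. assert (E : (Rsum (fun k => q ^ k) n * (1 - q) = 1 - q ^ S n)%R).
  { induction n as [|n IH]; [rewrite Rsum_0; simpl; toR; ring|].
    rewrite Rsum_S, Rmult_plus_distr_r, IH. simpl; ring. }
  apply Rmult_le_reg_r with (1 - q)%R; [lra|]. rewrite E, Rinv_l by lra.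
  pose proof (pow_le q (S n) ltac:(lra)). lra.
Qed.

Lemma Csum_tail (u : nat -> C) (b : nat -> R) (n m : nat) : (forall k, (Cmod (u k) <= b k)%R) ->
  (n <= m)%nat -> (Cmod (Csum u m - Csum u n) <= Rsum b m - Rsum b n)%R.
Proof.
  intros H Hnm; induction Hnm as [|m Hnm IH].
  - replace (Csum u n - Csum u n) with (RtoC 0) by (apply C_ext; csimpl; ring). rewrite Cmod_0; lra.
  - rewrite sum_n_Sm_C, Rsum_S.
    replace (Csum u m + u (S m) - Csum u n) with ((Csum u m - Csum u n) + u (S m)) by (apply C_ext; csimpl; ring).
    eapply Rle_trans; [apply Cmod_triangle|]. specialize (H (S m)). lra.
Qed.

Lemma Cmod_Csum_le (u : nat -> C) (b : nat -> R) (n : nat) : (forall k, (Cmod (u k) <= b k)%R) ->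
  (Cmod (Csum u n) <= Rsum b n)%R.
Proof.
  intros H; induction n as [|n IH]; [rewrite sum_n_0_C, Rsum_0; apply H|].
  rewrite sum_n_Sm_C, Rsum_S. eapply Rle_trans; [apply Cmod_triangle|]. specialize (H (S n)). lra.
Qed.

Lemma is_Cseries_bound (u : nat -> C) (l : C) (M : R) : is_Cseries u l ->
  (forall n, (Cmod (Csum u n) <= M)%R) -> (Cmod l <= M)%R.
Proof.
  intros Hu HM. apply (filterlim_Cmod_le eventually (fun n => Csum u n) l M); [exact Hu|].
  exists 0%nat; intros n _; apply HM.
Qed.

Lemma is_Cseries_unique (u : nat -> C) (l m : C) : is_Cseries u l -> is_Cseries u m -> l = m.
Proof. apply (filterlim_Cunique eventually (fun n => Csum u n)). Qed.

Lemma is_Cseries_ext (u v : nat -> C) (l : C) : (forall n, u n = v n) -> is_Cseries u l -> is_Cseries v l.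
Proof. apply (is_series_ext (K := C_AbsRing) (V := C_NormedModule)). Qed.

Lemma is_Cseries_scal (k : C) (u : nat -> C) (l : C) : is_Cseries u l -> is_Cseries (fun n => k * u n) (k * l).
Proof. apply (is_series_scal (K := C_AbsRing) (V := C_NormedModule) k). Qed.

Lemma is_Cseries_plus (u v : nat -> C) (l m : C) : is_Cseries u l -> is_Cseries v m ->
  is_Cseries (fun n => u n + v n) (l + m).
Proof. apply (is_series_plus (K := C_AbsRing) (V := C_NormedModule)). Qed.

Lemma summable_Cauchy (b : nat -> R) (M eps : R) : (forall n, (0 <= b n)%R) ->
  (forall n, (Rsum b n <= M)%R) -> (0 < eps)%R ->
  exists n, forall m, (n <= m)%nat -> (Rsum b m - Rsum b n < eps)%R.
Proof.
  intros Hb HM He.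
  assert (Hinc : forall n, (Rsum b n <= Rsum b (S n))%R) by (intros n; rewrite Rsum_S; specialize (Hb (S n)); lra).
  destruct (ex_finite_lim_seq_incr _ M Hinc HM) as [l Hl].
  assert (Hle := is_lim_seq_incr_compare _ l Hl Hinc).
  apply is_lim_seq_spec in Hl. destruct (Hl (mkposreal _ He)) as [n Hn].
  exists n; intros m Hm. specialize (Hn n (Nat.le_refl n)); simpl in Hn. apply Rabs_def2 in Hn.
  specialize (Hle m). lra.
Qed.

Lemma ex_Cseries_dominated (u : nat -> C) (b : nat -> R) (M : R) : (forall n, (Cmod (u n) <= b n)%R) ->
  (forall n, (Rsum b n <= M)%R) -> exists l, is_Cseries u l.
Proof.
  intros Hu HM.
  assert (Hb : forall n, (0 <= b n)%R) by (intros n; apply Rle_trans with (2 := Hu n), Cmod_ge_0).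
  assert (Hinc : forall n, (Rsum b n <= Rsum b (S n))%R) by (intros n; rewrite Rsum_S; specialize (Hb (S n)); lra).
  destruct (ex_finite_lim_seq_incr _ M Hinc HM) as [l Hl].
  apply (ex_series_le (K := C_AbsRing) (V := C_CompleteNormedModule) u b); [exact Hu|].
  exists l. exact Hl.
Qed.

Lemma is_Cseries_head (k : C) : is_Cseries (fun n => match n with O => k | S _ => RtoC 0 end) k.
Proof.
  apply (is_Cseries_remainder _ (fun _ => 0) _ 0 0); [lra| |].
  - intros n. induction n as [|n IH]; [rewrite sum_n_0_C; toC; ring|].
    rewrite sum_n_Sm_C, IH. toC. ring.
  - intros n; rewrite Cmod_0; lra.
Qed.

Section DoubleSeries.
Context (a : nat -> nat -> C) (b : nat -> R) (M : R) (f cc : nat -> C) (F : C).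
Hypothesis HbM : forall n, (Rsum b n <= M)%R.
Hypothesis Hab : forall n k, (Rsum (fun j => Cmod (a n j)) k <= b n)%R.
Hypothesis Hf : forall n, is_Cseries (a n) (f n).
Hypothesis HF : is_Cseries f F.
Hypothesis Hcc : forall k, is_Cseries (fun n => a n k) (cc k).

Lemma double_series_rows (N : nat) :
  filterlim (fun K => Csum (fun n => Csum (a n) K - f n) N) eventually (Clocally (RtoC 0)).
Proof.
  assert (R : forall n, filterlim (fun K => Csum (a n) K - f n) eventually (Clocally (RtoC 0))).
  { intros n. replace (RtoC 0) with (f n + - f n) by ring.
    apply filterlim_Cplus; [exact _|exact (Hf n)|apply filterlim_const]. }
  induction N as [|N IH].
  - apply (filterlim_ext (fun K => Csum (a 0%nat) K - f 0%nat)); [|apply R].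
    intros K; rewrite sum_n_0_C; reflexivity.
  - apply (filterlim_ext (fun K => Csum (fun n => Csum (a n) K - f n) N + (Csum (a (S N)) K - f (S N)))).
    + intros K; rewrite sum_n_Sm_C; reflexivity.
    + replace (RtoC 0) with (0 + 0) by ring. apply filterlim_Cplus; [exact _|exact IH|apply R].
Qed.

Lemma double_series_columns (K : nat) : is_Cseries (fun n => Csum (a n) K) (Csum cc K).
Proof.
  induction K as [|K IH].
  - rewrite sum_n_0_C. apply (is_Cseries_ext (fun n => a n 0%nat)); [|apply Hcc].
    intros n; rewrite sum_n_0_C; reflexivity.
  - rewrite sum_n_Sm_C. apply (is_Cseries_ext (fun n => Csum (a n) K + a n (S K))).
    + intros n; rewrite sum_n_Sm_C; reflexivity.
    + apply is_Cseries_plus; [exact IH|apply Hcc].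
Qed.

(** Exchange of summations by dominated convergence: rows beyond N are bounded by the tail of [b],
    uniformly in the truncation K of the rows; the finitely many remaining rows converge as K
    grows. *)
Lemma double_series : is_Cseries cc F.
Proof.
  assert (Hb : forall n, (0 <= b n)%R).
  { intros n; apply Rle_trans with (2 := Hab n 0). rewrite Rsum_0; apply Cmod_ge_0. }
  assert (HS : forall n K, (Cmod (Csum (a n) K) <= b n)%R).
  { intros n K. apply Rle_trans with (2 := Hab n K). apply Cmod_Csum_le; intros; right; reflexivity. }
  assert (HD : forall K n, (Cmod (Csum (a n) K - f n) <= b n * 2)%R).
  { intros K n. eapply Rle_trans; [apply Cmod_triangle|]. rewrite Cmod_opp.
    pose proof (HS n K). pose proof (is_Cseries_bound _ _ _ (Hf n) (HS n)). lra. }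
  apply is_Cseries_lim, locally_C_Cmod; [exact _|]. intros eps He.
  (* Each row differs from its sum by at most 2 b n, so the tail costs at most eps/4. *)
  destruct (summable_Cauchy b M (eps / 8) Hb HbM ltac:(lra)) as [N HN].
  assert (HR := proj2 (locally_C_Cmod eventually _ _) (double_series_rows N) (eps / 4)%R ltac:(lra)).
  refine (filter_imp (F := eventually) _ _ _ HR). intros K HK.
  apply Rle_lt_trans with (eps / 2)%R; [|lra].
  assert (HL : is_Cseries (fun n => Csum (a n) K - f n) (Csum cc K - F)).
  { apply (is_Cseries_ext (fun n => Csum (a n) K + - (1) * f n)); [intros n; apply C_ext; csimpl; ring|].
    replace (Csum cc K - F) with (Csum cc K + - (1) * F) by (apply C_ext; csimpl; ring).
    apply is_Cseries_plus; [apply double_series_columns|apply is_Cseries_scal, HF]. }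
  apply (filterlim_Cmod_le eventually (fun m => Csum (fun n => Csum (a n) K - f n) m) _ _ HL).
  exists N; intros m Hm.
  pose proof (Csum_tail _ _ N m (HD K) Hm) as T. rewrite 2!Rsum_scal_r in T.
  specialize (HN m Hm).
  replace (Csum (fun n => Csum (a n) K - f n) N - 0) with (Csum (fun n => Csum (a n) K - f n) N) in HK
    by (apply C_ext; csimpl; ring).
  replace (Csum (fun n => Csum (a n) K - f n) m) with
    ((Csum (fun n => Csum (a n) K - f n) m - Csum (fun n => Csum (a n) K - f n) N) +
     Csum (fun n => Csum (a n) K - f n) N) by (apply C_ext; csimpl; ring).
  eapply Rle_trans; [apply Cmod_triangle|]. lra.
Qed.

End DoubleSeries.

(** [M] bounds the weighted sum of |c k| r^k. This norm is submultiplicative, so sums, products and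
    substitutions come with explicit bounds, and one radius serves them all. *)
Definition is_PS (r M : R) (f : C -> C) : Prop :=
  exists c : nat -> C, (forall n, (Rsum (fun k => Cmod (c k) * r ^ k) n <= M)%R) /\
    forall h, (Cmod h <= r)%R -> is_Cseries (fun k => h ^ k * c k) (f h).

Lemma is_PS_ext (r M : R) (f g : C -> C) : (forall h, (Cmod h <= r)%R -> f h = g h) -> is_PS r M f -> is_PS r M g.
Proof.
  intros E (c & H1 & H2); exists c; split; [exact H1|].
  intros h Hh; rewrite <- (E h Hh); apply H2, Hh.
Qed.

Lemma is_PS_term_le (c : nat -> C) (r : R) (h : C) (k : nat) : (Cmod h <= r)%R ->
  (Cmod (h ^ k * c k) <= Cmod (c k) * r ^ k)%R.
Proof.
  intros Hh. rewrite Cmod_mult, Cmod_pow, Rmult_comm.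
  apply Rmult_le_compat_l; [apply Cmod_ge_0|apply pow_incr; split; [apply Cmod_ge_0|exact Hh]].
Qed.

Lemma is_PS_bound (r M : R) (f : C -> C) (h : C) : is_PS r M f -> (Cmod h <= r)%R -> (Cmod (f h) <= M)%R.
Proof.
  intros (c & H1 & H2) Hh. apply (is_Cseries_bound _ _ _ (H2 h Hh)). intros n.
  apply Rle_trans with (2 := H1 n). apply Cmod_Csum_le; intros k. apply is_PS_term_le, Hh.
Qed.

Lemma is_PS_const (r : R) (k : C) : is_PS r (Cmod k) (fun _ => k).
Proof.
  exists (fun n => match n with O => k | S _ => 0 end); split.
  - intros n. right. induction n as [|n IH]; [rewrite Rsum_0; simpl; toR; ring|].
    rewrite Rsum_S, IH, Cmod_0. toR; ring.
  - intros h _. apply (is_Cseries_ext (fun n => match n with O => k | S _ => RtoC 0 end)); [|apply is_Cseries_head].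
    intros [|n]; ring.
Qed.

(** Weierstrass's double series theorem in this norm. The k-th coefficient of the sum is the sum of
    the k-th coefficients, which converges since they are dominated by b n / r^k. *)
Lemma is_PS_sum (r M : R) (f : nat -> C -> C) (b : nat -> R) (F : C -> C) : (0 < r)%R ->
  (forall n, is_PS r (b n) (f n)) -> (forall n, (Rsum b n <= M)%R) ->
  (forall h, (Cmod h <= r)%R -> is_Cseries (fun n => f n h) (F h)) -> is_PS r M F.
Proof.
  intros Hr Hf HbM HF.
  destruct (choice _ Hf) as [c Hc].
  assert (Hb : forall n, (0 <= b n)%R).
  { intros n; apply Rle_trans with (2 := proj1 (Hc n) 0%nat). rewrite Rsum_0.
    apply Rmult_le_pos; [apply Cmod_ge_0|simpl; lra]. }
  assert (Hck : forall n k, (Cmod (c n k) * r ^ k <= b n)%R).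
  { intros n k. apply Rle_trans with (2 := proj1 (Hc n) k). destruct k as [|k]; [rewrite Rsum_0; lra|].
    rewrite Rsum_S.
    assert (0 <= Rsum (fun j => Cmod (c n j) * r ^ j)%R k)%R; [|lra].
    clear -Hr. induction k as [|k IH].
    - rewrite Rsum_0. apply Rmult_le_pos; [apply Cmod_ge_0|simpl; lra].
    - rewrite Rsum_S. apply Rplus_le_le_0_compat; [exact IH|].
      apply Rmult_le_pos; [apply Cmod_ge_0|apply pow_le; lra]. }
  assert (EX : forall k, exists l, is_Cseries (fun n => c n k) l).
  { intros k. apply (ex_Cseries_dominated _ (fun n => b n * / r ^ k)%R (M * / r ^ k)%R).
    - intros n. apply Rmult_le_reg_r with (r ^ k)%R; [apply pow_lt, Hr|].
      rewrite Rmult_assoc, Rinv_l, Rmult_1_r by (apply pow_nonzero; lra). apply Hck.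
    - intros n. rewrite Rsum_scal_r. apply Rmult_le_compat_r; [|apply HbM].
      left; apply Rinv_0_lt_compat, pow_lt, Hr. }
  destruct (choice _ EX) as [cc Hcc].
  exists cc; split.
  - intros K.
    (* For finitely many summands the norm is subadditive; then N tends to infinity with K fixed. *)
    assert (A : forall N, (Rsum (fun k => Cmod (Csum (fun n => c n k) N) * r ^ k) K <= Rsum b N)%R).
    { intros N; induction N as [|N IH].
      - rewrite Rsum_0. apply Rle_trans with (2 := proj1 (Hc 0%nat) K). apply Rsum_le; intros k.
        rewrite sum_n_0_C. right; reflexivity.
      - rewrite Rsum_S. apply Rle_trans with (2 := Rplus_le_compat _ _ _ _ IH (proj1 (Hc (S N)) K)).
        clear -Hr. induction K as [|K IHK].
        + rewrite !Rsum_0, sum_n_Sm_C. simpl. rewrite !Rmult_1_r. apply Cmod_triangle.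
        + rewrite !Rsum_S, sum_n_Sm_C.
          pose proof (Cmod_triangle (Csum (fun n => c n (S K)) N) (c (S N) (S K))) as T.
          pose proof (pow_le r (S K) ltac:(lra)).
          apply (Rmult_le_compat_r (r ^ S K)) in T; [|assumption]. lra. }
    assert (L : is_lim_seq (fun N => Rsum (fun k => Cmod (Csum (fun n => c n k) N) * r ^ k)%R K)
       (Rsum (fun k => Cmod (cc k) * r ^ k)%R K)).
    { clear -Hcc.
      assert (T : forall k, is_lim_seq (fun N => Cmod (Csum (fun n => c n k) N) * r ^ k)%R (Cmod (cc k) * r ^ k)%R).
      { intros k. apply (is_lim_seq_scal_r _ (r ^ k) (Cmod (cc k))).
        apply (filterlim_comp nat C R _ Cmod eventually (Clocally (cc k)) (locally (Cmod (cc k))) (Hcc k)).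
        exact (filterlim_norm (K := C_AbsRing) (V := C_NormedModule) (cc k)). }
      induction K as [|K IH].
      - rewrite Rsum_0. refine (is_lim_seq_ext _ _ _ _ (T 0%nat)). intros N; rewrite Rsum_0; reflexivity.
      - rewrite Rsum_S. refine (is_lim_seq_ext _ _ _ _ (is_lim_seq_plus' _ _ _ _ IH (T (S K)))).
        intros N; rewrite Rsum_S; reflexivity. }
    apply (is_lim_seq_le _ (fun _ => M) _ M (fun N => Rle_trans _ _ _ (A N) (HbM N)) L), is_lim_seq_const.
  - intros h Hh.
    apply (double_series (fun n k => h ^ k * c n k) b M (fun n => f n h)).
    + exact HbM.
    + intros n K. apply Rle_trans with (2 := proj1 (Hc n) K). apply Rsum_le; intros k; apply is_PS_term_le, Hh.
    + intros n. apply (proj2 (Hc n)), Hh.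
    + apply HF, Hh.
    + intros k. apply is_Cseries_scal, Hcc.
Qed.

Lemma is_PS_plus (r M N : R) (f g : C -> C) : (0 <= r)%R -> is_PS r M f -> is_PS r N g ->
  is_PS r (M + N) (fun h => f h + g h).
Proof.
  intros Hr (c & H1 & H2) (d & H3 & H4). exists (fun k => c k + d k); split.
  - intros n. apply Rle_trans with (2 := Rplus_le_compat _ _ _ _ (H1 n) (H3 n)).
    clear -Hr. induction n as [|n IH].
    + rewrite !Rsum_0. rewrite <- Rmult_plus_distr_r. apply Rmult_le_compat_r; [simpl; lra|apply Cmod_triangle].
    + rewrite !Rsum_S. pose proof (Cmod_triangle (c (S n)) (d (S n))) as T.
      apply (Rmult_le_compat_r (r ^ S n)) in T; [|apply pow_le; lra]. lra.
  - intros h Hh. apply (is_Cseries_ext (fun k => h ^ k * c k + h ^ k * d k)); [intros; ring|].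
    apply is_Cseries_plus; [apply H2|apply H4]; exact Hh.
Qed.

Lemma is_PS_scal (r M : R) (k : C) (f : C -> C) : is_PS r M f -> is_PS r (Cmod k * M) (fun h => k * f h).
Proof.
  intros (c & H1 & H2). exists (fun j => k * c j); split.
  - intros n. apply Rle_trans with (Rsum (fun j => Cmod (c j) * r ^ j * Cmod k)%R n).
    + apply Rsum_le; intros j. rewrite Cmod_mult. right; ring.
    + rewrite Rsum_scal_r, Rmult_comm. apply Rmult_le_compat_l; [apply Cmod_ge_0|apply H1].
  - intros h Hh. apply (is_Cseries_ext (fun j => k * (h ^ j * c j))); [intros; ring|].
    apply is_Cseries_scal, H2, Hh.
Qed.

Lemma is_Cseries_shift (u : nat -> C) (l : C) : u 0%nat = 0 ->
  is_Cseries (fun n => u (S n)) l -> is_Cseries u l.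
Proof.
  intros H0 Hu. apply is_Cseries_lim.
  apply (filterlim_ext_loc (fun n => match n with O => RtoC 0 | S m => Csum (fun n => u (S n)) m end)).
  - exists 1%nat; intros n Hn. destruct n as [|n]; [lia|]. clear Hn.
    induction n as [|n IH].
    + rewrite sum_n_Sm_C, !sum_n_0_C, H0. toC. ring.
    + rewrite sum_n_Sm_C, IH. symmetry. exact (sum_n_Sm_C u (S n)).
  - intros P HP. destruct (Hu P HP) as [N HN]. exists (S N); intros n Hn.
    destruct n as [|n]; [lia|]. apply HN; lia.
Qed.

Lemma is_PS_mul_h (r M : R) (f : C -> C) : (0 <= r)%R -> is_PS r M f -> is_PS r (r * M) (fun h => h * f h).
Proof.
  intros Hr (c & H1 & H2). exists (fun k => match k with O => RtoC 0 | S j => c j end); split.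
  - intros n. destruct n as [|n].
    + rewrite Rsum_0, Cmod_0, Rmult_0_l. apply Rmult_le_pos; [exact Hr|].
      apply Rle_trans with (2 := H1 0%nat). rewrite Rsum_0. apply Rmult_le_pos; [apply Cmod_ge_0|simpl; lra].
    + replace (Rsum _ (S n)) with (Rsum (fun k => Cmod (c k) * r ^ k * r)%R n).
      * rewrite Rsum_scal_r, Rmult_comm. apply Rmult_le_compat_l; [exact Hr|apply H1].
      * induction n as [|n IH]; [rewrite Rsum_S, !Rsum_0, Cmod_0; simpl; toR; ring|].
        rewrite Rsum_S, IH. symmetry; rewrite Rsum_S. simpl. toR; ring.
  - intros h Hh. apply is_Cseries_shift; [ring|].
    apply (is_Cseries_ext (fun k => h * (h ^ k * c k))); [intros n; rewrite Cpow_S; ring|].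
    apply is_Cseries_scal, H2, Hh.
Qed.

Lemma is_PS_mul_pow (r M : R) (f : C -> C) (n : nat) : (0 <= r)%R -> is_PS r M f ->
  is_PS r (r ^ n * M) (fun h => h ^ n * f h).
Proof.
  intros Hr Hf; induction n as [|n IH].
  - rewrite Rmult_1_l. apply (is_PS_ext r M f); [intros h _; symmetry; apply Cmult_1_l|exact Hf].
  - simpl pow. rewrite Rmult_assoc.
    apply (is_PS_ext r _ (fun h => h * (h ^ n * f h))); [intros h _; rewrite Cpow_S; ring|].
    apply is_PS_mul_h; assumption.
Qed.

(** Instead of a Cauchy product, f g is expanded as the sum of c n h^n g(h), to which [is_PS_sum]
    applies. *)
Lemma is_PS_mult (r M N : R) (f g : C -> C) : (0 < r)%R -> is_PS r M f -> is_PS r N g ->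
  is_PS r (M * N) (fun h => f h * g h).
Proof.
  intros Hr (c & H1 & H2) Hg.
  apply (is_PS_sum r (M * N) (fun n h => c n * (h ^ n * g h)) (fun n => Cmod (c n) * r ^ n * N)%R); [exact Hr| | |].
  - intros n. rewrite Rmult_assoc. apply is_PS_scal, is_PS_mul_pow; [lra|exact Hg].
  - intros n. rewrite Rsum_scal_r. apply Rmult_le_compat_r; [|apply H1].
    apply Rle_trans with (2 := is_PS_bound r N g 0 Hg ltac:(rewrite Cmod_0; lra)), Cmod_ge_0.
  - intros h Hh. apply (is_Cseries_ext (fun n => g h * (h ^ n * c n))); [intros; ring|].
    rewrite (Cmult_comm (f h)). apply is_Cseries_scal, H2, Hh.
Qed.

Lemma is_PS_pow (r M : R) (f : C -> C) (n : nat) : (0 < r)%R -> is_PS r M f ->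
  is_PS r (M ^ n) (fun h => f h ^ n).
Proof.
  intros Hr Hf; induction n as [|n IH].
  - replace (M ^ 0)%R with (Cmod 1) by apply Cmod_1. exact (is_PS_const r 1).
  - exact (is_PS_mult r M (M ^ n) f (fun h => f h ^ n) Hr Hf IH).
Qed.

Lemma is_PS_M_pos (r M : R) (f : C -> C) : (0 <= r)%R -> is_PS r M f -> (0 <= M)%R.
Proof.
  intros Hr Hf. apply Rle_trans with (2 := is_PS_bound r M f 0 Hf ltac:(rewrite Cmod_0; lra)), Cmod_ge_0.
Qed.

(** Substitution of u into a power series with coefficients O(rho^n). The condition is on the norm M
    of u, not on its supremum, because M^n bounds the norm of u^n. *)
Lemma is_PS_comp_series (r M q K rho : R) (u : C -> C) (p : nat -> C) (F : C -> C) : (0 < r)%R ->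
  is_PS r M u -> (forall n, (Cmod (p n) <= K * rho ^ n)%R) -> (0 <= rho)%R -> (rho * M < 1)%R ->
  (forall h, (Cmod h <= r)%R -> is_Cseries (fun n => u h ^ n * p n) (F h)) ->
  is_PS r (K / (1 - rho * M)) F.
Proof.
  intros Hr Hu Hp Hrho HM HF.
  assert (HM0 := is_PS_M_pos r M u ltac:(lra) Hu).
  assert (HK : (0 <= K)%R) by (specialize (Hp 0%nat); simpl in Hp; pose proof (Cmod_ge_0 (p 0%nat)); lra).
  apply (is_PS_sum r _ (fun n h => p n * u h ^ n) (fun n => Cmod (p n) * M ^ n)%R); [exact Hr| | |].
  - intros n. apply is_PS_scal, is_PS_pow; assumption.
  - intros n. apply Rle_trans with (Rsum (fun n => (rho * M) ^ n * K)%R n).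
    + apply Rsum_le; intros k. rewrite Rpow_mult_distr.
      apply Rle_trans with (K * rho ^ k * M ^ k)%R; [|right; ring].
      apply Rmult_le_compat_r; [apply pow_le, HM0|apply Hp].
    + rewrite Rsum_scal_r. unfold Rdiv. rewrite Rmult_comm. apply Rmult_le_compat_l; [exact HK|].
      apply Rsum_geom. split; [apply Rmult_le_pos; assumption|exact HM].
  - intros h Hh. apply (is_Cseries_ext (fun n => u h ^ n * p n)); [intros; ring|apply HF, Hh].
Qed.

Lemma is_Rderive_pow (f : R -> C) (t : R) (l : C) (n : nat) : is_Rderive f t l ->
  is_Rderive (fun u => f u ^ S n) t (INR (S n) * f t ^ n * l).
Proof.
  intros Hf; induction n as [|n IH].
  - apply (is_Rderive_ext f); [intros u; rewrite Cpow_1_r; reflexivity|].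
    eapply is_Rderive_eq; [exact Hf|]. simpl INR. change (f t ^ 0) with (RtoC 1). ring.
  - apply (is_Rderive_ext (fun u => f u * f u ^ S n)); [intros u; reflexivity|].
    eapply is_Rderive_eq; [apply is_Rderive_mult; [exact Hf|exact IH]|].
    cbv beta. rewrite (S_INR (S n)), RtoC_plus, (Cpow_S _ n). ring.
Qed.

Definition expsum (n : nat) (w : C) : C := Csum (fun k => w ^ k / INR (fact k)) n.

Lemma expsum_S (n : nat) (w : C) : expsum (S n) w = expsum n w + w ^ S n / INR (fact (S n)).
Proof. apply sum_n_Sm_C. Qed.

Lemma expsum_0 (w : C) : expsum 0 w = 1.
Proof. unfold expsum. rewrite sum_n_0_C. simpl. toC. field. Qed.

Lemma is_Rderive_lin (w : C) (t : R) : is_Rderive (fun u => u * w) t w.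
Proof. split; csimpl; auto_derive; auto; ring. Qed.

Lemma is_Rderive_expsum (n : nat) (w : C) (t : R) :
  is_Rderive (fun u => expsum (S n) (u * w)) t (w * expsum n (t * w)).
Proof.
  induction n as [|n IH].
  - apply (is_Rderive_ext (fun u => 1 + u * w)).
    + intros u. rewrite expsum_S, expsum_0, Cpow_1_r. simpl. field.
    + eapply is_Rderive_eq; [apply is_Rderive_plus; [apply is_Rderive_const|apply is_Rderive_lin]|].
      rewrite expsum_0. ring.
  - apply (is_Rderive_ext (fun u => expsum (S n) (u * w) + (u * w) ^ S (S n) * / INR (fact (S (S n))))).
    + intros u. rewrite (expsum_S (S n)). reflexivity.
    + eapply is_Rderive_eq.
      * apply is_Rderive_plus; [exact IH|].
        apply is_Rderive_mult; [apply is_Rderive_pow, is_Rderive_lin|apply is_Rderive_const].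
      * cbv beta. rewrite (expsum_S n), (fact_simpl (S n)), mult_INR, RtoC_mult.
        field. split; [apply INR_fact_neq_0_C|]. apply RtoC_neq_0, not_0_INR. lia.
Qed.

Lemma is_Rderive_exp_lin (w : C) (t : R) : is_Rderive (fun u => Cexp (u * w)) t (w * Cexp (t * w)).
Proof. eapply is_Rderive_eq; [apply is_Rderive_Cexp, is_Rderive_lin|cbv beta; ring]. Qed.

(** Induction on n: the remainder of order n + 1 at w is the integral over t in [0, 1] of w times
    the remainder of order n at t w. *)
Lemma Cexp_remainder (n : nat) (w : C) :
  (Cmod (Cexp w - expsum n w) <= Cmod w ^ S n / INR (fact (S n)) * exp (Cmod w))%R.
Proof.
  revert w; induction n as [|n IH]; intros w.
  - rewrite expsum_0. apply Rle_trans with (1 := Cmod_Cexp_minus_1 w). right. simpl. field.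
  - pose proof (Cmod_ge_0 w) as Hw.
    assert (I : is_CRInt (fun t => w * (Cexp (t * w) - expsum n (t * w))) 0 1
      ((Cexp (1%R * w) - expsum (S n) (1%R * w)) - (Cexp (0%R * w) - expsum (S n) (0%R * w)))).
    { apply (is_CRInt_derive (fun t => Cexp (RtoC t * w) - expsum (S n) (RtoC t * w))); intros t _.
      - eapply is_Rderive_eq.
        + apply is_Rderive_plus; [apply is_Rderive_exp_lin|apply is_Rderive_opp, is_Rderive_expsum].
        + ring.
      - apply continuous_Cmult; [apply continuous_Cconst|]. apply continuous_Cplus.
        + exact (is_Rderive_continuous _ _ _ (is_Rderive_exp_lin w t)).
        + apply continuous_Copp. destruct n as [|n].
          * apply (continuous_ext (fun _ => RtoC 1)); [intros u; rewrite expsum_0; reflexivity|apply continuous_Cconst].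
          * exact (is_Rderive_continuous _ _ _ (is_Rderive_expsum n w t)). }
    assert (E0 : Cexp (0%R * w) - expsum (S n) (0%R * w) = 0).
    { rewrite Cmult_0_l, Cexp_0. clear. induction n as [|n IHn].
      - rewrite expsum_S, expsum_0. simpl. field.
      - rewrite expsum_S, Cpow_S, Cmult_0_l.
        transitivity (1 - expsum (S n) 0); [unfold Cdiv; ring|exact IHn]. }
    rewrite E0, Cmult_1_l in I. replace (Cexp w - expsum (S n) w - 0) with (Cexp w - expsum (S n) w) in I by ring.
    rewrite <- (is_CRInt_unique _ _ _ _ I).
    assert (HF : (0 < INR (fact (S n)))%R) by apply INR_fact_lt_0.
    pose (K := (Cmod w ^ S (S n) / INR (fact (S n)) * exp (Cmod w))%R).
    assert (J : is_RInt (fun t => K * t ^ S n)%R 0 1 (K / INR (S (S n)))%R).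
    { evar_last.
      - apply (is_RInt_derive (fun t => K / INR (S (S n)) * t ^ S (S n))%R); intros t _.
        + evar_last.
          * apply (is_derive_scal (fun t => t ^ S (S n))%R), (is_derive_pow (fun t => t)), (is_derive_id (K := R_AbsRing)).
          * change (K / INR (S (S n)) * (INR (S (S n)) * 1 * t ^ S n) = K * t ^ S n)%R.
            field. apply not_0_INR; lia.
        + apply ex_Rderive_continuous.
          eexists. apply (is_derive_scal (fun t => t ^ S n)%R), (is_derive_pow (fun t => t)), (is_derive_id (K := R_AbsRing)).
      - change (K / INR (S (S n)) * 1 ^ S (S n) - K / INR (S (S n)) * 0 ^ S (S n) = K / INR (S (S n)))%R.
        rewrite pow1, pow_i by lia. ring. }
    replace (Cmod w ^ S (S n) / INR (fact (S (S n))) * exp (Cmod w))%R with (K / INR (S (S n)))%R.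
    2: { unfold K. rewrite (fact_simpl (S n)), mult_INR. field. split; [lra|apply not_0_INR; lia]. }
    apply Cmod_CRInt_le with (fun t => K * t ^ S n)%R; [lra|eexists; exact I| |exact J].
    intros t Ht. rewrite Cmod_mult.
    apply Rle_trans with (Cmod w * (Cmod (t * w) ^ S n / INR (fact (S n)) * exp (Cmod (t * w))))%R.
    + apply Rmult_le_compat_l; [exact Hw|apply IH].
    + rewrite Cmod_mult, Cmod_R, Rabs_pos_eq, Rpow_mult_distr by lra. unfold K.
      apply Rle_trans with (Cmod w * (t ^ S n * Cmod w ^ S n / INR (fact (S n)) * exp (Cmod w)))%R.
      * apply Rmult_le_compat_l; [exact Hw|]. apply Rmult_le_compat_l.
        -- unfold Rdiv. apply Rmult_le_pos; [|left; apply Rinv_0_lt_compat, HF].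
           apply Rmult_le_pos; apply pow_le; lra.
        -- apply exp_le_compat. nra.
      * right. change (Cmod w ^ S (S n))%R with (Cmod w * Cmod w ^ S n)%R. field. lra.
Qed.

Lemma Cexp_series (w : C) : is_Cseries (fun k => w ^ k / INR (fact k)) (Cexp w).
Proof.
  apply is_Cseries_lim, locally_C_Cmod; [exact _|]. intros eps He.
  pose proof (exp_pos (Cmod w)) as HE.
  destruct (cv_speed_pow_fact (Cmod w) (eps / exp (Cmod w))%R) as [N HN].
  { apply Rdiv_lt_0_compat; assumption. }
  exists N; intros n Hn. specialize (HN (S n) ltac:(lia)). unfold Rdist in HN.
  rewrite Rminus_0_r in HN. apply Rle_lt_trans with (1 := Rle_abs _) in HN.
  replace (Csum (fun k => w ^ k / INR (fact k)) n - Cexp w) with (- (Cexp w - expsum n w)) by (unfold expsum; ring).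
  rewrite Cmod_opp. apply Rle_lt_trans with (1 := Cexp_remainder n w).
  apply (Rmult_lt_compat_r (exp (Cmod w))) in HN; [|exact HE].
  replace (eps / exp (Cmod w) * exp (Cmod w))%R with eps in HN by (field; lra). exact HN.
Qed.

Lemma exp_partial_sum_le (y : R) (n : nat) : (0 <= y)%R -> (Rsum (fun k => y ^ k / INR (fact k))%R n <= exp y)%R.
Proof.
  intros Hy. revert n. apply is_lim_seq_incr_compare.
  - apply (is_lim_seq_ext (Rsum (fun k => scal (pow_n y k) (/ INR (fact k))%R))).
    + intros n; apply sum_n_ext; intros k. rewrite pow_n_pow. reflexivity.
    + exact (is_exp_Reals y).
  - intros n. rewrite Rsum_S.
    assert (0 <= y ^ S n / INR (fact (S n)))%R; [|lra].
    apply Rmult_le_pos; [apply pow_le, Hy|left; apply Rinv_0_lt_compat, INR_fact_lt_0].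
Qed.

(** Without the constant term the norm tends to 0 with r, as needed to invert 1 - e^(-2 pi i a)
    locally. *)
Lemma is_PS_exp_m1 (r : R) (c : C) : (0 <= r)%R -> is_PS r (exp (Cmod c * r) - 1) (fun h => Cexp (c * h) - 1).
Proof.
  intros Hr. exists (fun k => match k with O => RtoC 0 | S _ => c ^ k / INR (fact k) end); split.
  - intros n. pose proof (exp_partial_sum_le (Cmod c * r) n) as H.
    specialize (H ltac:(apply Rmult_le_pos; [apply Cmod_ge_0|exact Hr])).
    assert (E : forall m, (Rsum (fun k => Cmod (match k with O => RtoC 0 | S _ => c ^ k / INR (fact k) end) * r ^ k) m
      = Rsum (fun k => (Cmod c * r) ^ k / INR (fact k)) m - 1)%R).
    { intros m; induction m as [|m IH].
      - rewrite !Rsum_0, Cmod_0. simpl. toR. field.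
      - rewrite !Rsum_S, IH. rewrite Cmod_div by apply INR_fact_neq_0_C.
        rewrite Cmod_pow, Cmod_R, Rabs_pos_eq, Rpow_mult_distr by apply pos_INR. toR. field. apply INR_fact_neq_0. }
    rewrite E. lra.
  - intros h _.
    apply (is_Cseries_ext (fun k => (c * h) ^ k / INR (fact k) + match k with O => - (1) | S _ => RtoC 0 end)).
    + intros [|k].
      * simpl. field.
      * rewrite Cpow_mult_l. field. apply INR_fact_neq_0_C.
    + apply is_Cseries_plus; [apply Cexp_series|apply is_Cseries_head].
Qed.

Lemma is_PS_exp (r : R) (c : C) : (0 <= r)%R -> is_PS r (exp (Cmod c * r)) (fun h => Cexp (c * h)).
Proof.
  intros Hr. apply (is_PS_ext r _ (fun h => 1 + (Cexp (c * h) - 1))); [intros; ring|].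
  replace (exp (Cmod c * r)) with (Cmod 1 + (exp (Cmod c * r) - 1))%R by (rewrite Cmod_1; ring).
  apply is_PS_plus; [exact Hr|apply is_PS_const|apply is_PS_exp_m1, Hr].
Qed.

Lemma is_PS_geom (r M : R) (u : C -> C) : (0 < r)%R -> is_PS r M u -> (M < 1)%R ->
  is_PS r (/ (1 - M)) (fun h => / (1 - u h)).
Proof.
  intros Hr Hu HM. pose proof (is_PS_M_pos r M u ltac:(lra) Hu) as HM0.
  replace (/ (1 - M))%R with (1 / (1 - 1 * M))%R by (field; lra).
  apply (is_PS_comp_series r M 0 1 1 u (fun _ => 1)); try lra; try assumption.
  - intros n; rewrite Cmod_1, pow1; lra.
  - intros h Hh. assert (Hb := is_PS_bound r M u h Hu Hh).
    assert (Hn : 1 - u h <> 0).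
    { intros E. assert (u h = 1) by (transitivity (1 - (1 - u h)); [ring|rewrite E; ring]).
      rewrite H, Cmod_1 in Hb. lra. }
    apply (is_Cseries_remainder _ (fun n => u h ^ S n / (1 - u h)) _ (M / Cmod (1 - u h)) M); [lra| |].
    + intros n; induction n as [|n IH].
      * rewrite sum_n_0_C, Cpow_1_r. toC. change (u h ^ 0) with (RtoC 1). field. exact Hn.
      * rewrite sum_n_Sm_C, IH. toC. rewrite (Cpow_S _ (S n)). field. exact Hn.
    + intros n. rewrite Cmod_div, Cmod_pow by exact Hn.
      replace (M / Cmod (1 - u h) * M ^ n)%R with (M ^ S n / Cmod (1 - u h))%R by (simpl; field; apply Rgt_not_eq, Cmod_gt_0, Hn).
      apply Rmult_le_compat_r; [left; apply Rinv_0_lt_compat, Cmod_gt_0, Hn|].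
      apply pow_incr; split; [apply Cmod_ge_0|exact Hb].
Qed.

(** The number q = E / (E - 1) with E = e^(2 pi i a), in the form in which [region] says |q| < 1. *)
Definition ratio (a : C) : C := / (1 - Cexp (- (2 * PI * Ci * a))).

Lemma region_denom (a : C) : region a -> 1 - Cexp (- (2 * PI * Ci * a)) <> 0.
Proof. intros Ha; apply Cmod_gt_0. unfold region in Ha. lra. Qed.

Lemma Cmod_ratio_lt_1 (a : C) : region a -> (Cmod (ratio a) < 1)%R.
Proof.
  intros Ha. unfold ratio. rewrite Cmod_inv by (apply region_denom, Ha).
  unfold region in Ha. apply Rmult_lt_reg_r with (1 := Rlt_trans _ _ _ Rlt_0_1 Ha).
  rewrite Rinv_l by lra. lra.
Qed.

(** What matters is a norm below 1, not merely |q| < 1. Factoring 1 - e0 e^(c h) = A (1 - (e0 / A)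
    (e^(c h) - 1)) gives a geometric series whose argument has small norm for small r. *)
Lemma is_PS_ratio (a0 : C) : region a0 ->
  exists r M, (0 < r)%R /\ (M < 1)%R /\ is_PS r M (fun h => ratio (a0 + h)).
Proof.
  intros Ha. set (e0 := Cexp (- (2 * PI * Ci * a0))). set (A := 1 - e0).
  assert (HA : (1 < Cmod A)%R) by exact Ha.
  assert (He : (0 < Cmod e0)%R) by (apply Cmod_gt_0, Cexp_neq_0).
  set (c := - (2 * PI * Ci)).
  assert (Hc : (0 < Cmod c)%R).
  { apply Cmod_gt_0. intros E. apply two_pi_i_neq_0.
    transitivity (- c); [unfold c; ring|rewrite E; ring]. }
  (* Chosen with r so that e^(|c| r) - 1 = y; the argument of the geometric series then has norm
     (|A| - 1) / (2 |A|), and q has norm 2 / (|A| + 1) < 1. *)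
  set (y := ((Cmod A - 1) / (2 * Cmod e0))%R).
  assert (Hy : (0 < y)%R) by (apply Rdiv_lt_0_compat; lra).
  set (r := (ln (1 + y) / Cmod c)%R).
  assert (Hr : (0 < r)%R).
  { apply Rdiv_lt_0_compat; [|exact Hc]. rewrite <- ln_1. apply ln_increasing; lra. }
  assert (HAn : A <> 0) by (apply Cmod_gt_0; lra).
  assert (H1 := is_PS_scal r _ (e0 / A) _ (is_PS_exp_m1 r c ltac:(lra))).
  assert (EM : (Cmod (e0 / A) * (exp (Cmod c * r) - 1) = (Cmod A - 1) / (2 * Cmod A))%R).
  { rewrite Cmod_div by exact HAn. replace (Cmod c * r)%R with (ln (1 + y)) by (unfold r; field; lra).
    rewrite exp_ln by lra. unfold y. field; lra. }
  rewrite EM in H1.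
  assert (HM1 : ((Cmod A - 1) / (2 * Cmod A) < 1)%R).
  { apply Rmult_lt_reg_r with (2 * Cmod A)%R; [lra|]. unfold Rdiv. rewrite Rmult_assoc, Rinv_l by lra. lra. }
  assert (H2 := is_PS_scal r _ (/ A) _ (is_PS_geom r _ _ Hr H1 HM1)).
  exists r. eexists. split; [exact Hr|split; [|refine (is_PS_ext _ _ _ _ _ H2)]].
  - rewrite Cmod_inv by exact HAn.
    replace (/ Cmod A * / (1 - (Cmod A - 1) / (2 * Cmod A)))%R with (2 / (Cmod A + 1))%R by (field; lra).
    apply Rmult_lt_reg_r with (Cmod A + 1)%R; [lra|]. unfold Rdiv. rewrite Rmult_assoc, Rinv_l by lra. lra.
  - intros h Hh.
    assert (Hu := is_PS_bound r _ _ h H1 Hh). cbv beta in *.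
    assert (Hn : 1 - e0 / A * (Cexp (c * h) - 1) <> 0).
    { intros E. assert (E' : e0 / A * (Cexp (c * h) - 1) = 1).
      { transitivity (1 - (1 - e0 / A * (Cexp (c * h) - 1))); [ring|rewrite E; ring]. }
      rewrite E', Cmod_1 in Hu. lra. }
    unfold ratio.
    replace (- (2 * PI * Ci * (a0 + h))) with (- (2 * PI * Ci * a0) + c * h) by (unfold c; ring).
    rewrite Cexp_plus. fold e0.
    replace (1 - e0 * Cexp (c * h)) with (A * (1 - e0 / A * (Cexp (c * h) - 1))).
    + clear -HAn Hn. set (w := 1 - e0 / A * (Cexp (c * h) - 1)) in *. clearbody w. field. split; assumption.
    + unfold A at 1. unfold Cdiv. transitivity (A - e0 * (A * / A) * (Cexp (c * h) - 1)); [unfold A; ring|].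
      rewrite Cinv_r by exact HAn. unfold A; ring.
Qed.

Lemma pow_n_Cpow (h : C) (k : nat) : pow_n (K := C_Ring) h k = h ^ k.
Proof. induction k as [|k IH]; [reflexivity|]. simpl. rewrite IH. reflexivity. Qed.

Lemma is_Cseries_pseries (c : nat -> C) (h l : C) :
  is_Cseries (fun k => h ^ k * c k) l <-> is_pseries (K := C_AbsRing) (V := C_NormedModule) c h l.
Proof.
  split; intros H; refine (is_Cseries_ext _ _ _ _ H); intros n; simpl;
  [rewrite <- pow_n_Cpow|rewrite <- pow_n_Cpow]; reflexivity.
Qed.

Lemma is_PS_analytic (D : C -> Prop) (f : C -> C) :
  (forall a0, D a0 -> exists r M, (0 < r)%R /\ is_PS r M (fun h => f (a0 + h))) -> analytic_on D f.
Proof.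
  intros H a0 Ha0. destruct (H a0 Ha0) as (r & M & Hr & c & _ & Hc).
  exists c, r; split; [exact Hr|]. intros a Ha. apply is_Cseries_pseries.
  replace (f a) with (f (a0 + (a - a0))) by (f_equal; ring). apply Hc. lra.
Qed.

(** * The identity theorem *)

Lemma is_Cseries_terms_bounded (u : nat -> C) (l : C) : is_Cseries u l ->
  exists B, forall n, (Cmod (u n) <= B)%R.
Proof.
  intros Hu.
  destruct (filterlim_bounded (K := C_AbsRing) (V := C_NormedModule) (fun n => Csum u n)
    (ex_intro _ l Hu)) as [M HM].
  exists (2 * M)%R; intros n.
  assert (HM' : forall n, (Cmod (Csum u n) <= M)%R) by exact HM.
  destruct n as [|n].
  - specialize (HM' 0%nat). rewrite sum_n_0_C in HM'. pose proof (Cmod_ge_0 (u 0%nat)). lra.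
  - pose proof (HM' n) as H1. pose proof (HM' (S n)) as H2. rewrite sum_n_Sm_C in H2.
    pose proof (Cmod_triangle (Csum u n + u (S n)) (- Csum u n)) as T. rewrite Cmod_opp in T.
    replace (Csum u n + u (S n) + - Csum u n) with (u (S n)) in T by (apply C_ext; csimpl; ring). lra.
Qed.

(** Strong induction: if all coefficients before c k vanish, then at a zero h the term h^k c k is
    balanced by the later ones, whence |c k| <= K |h|; and h can be taken arbitrarily small. *)
Lemma pseries_zeros_cluster (c : nat -> C) (r : R) (d : C -> C) : (0 < r)%R ->
  (forall h, (Cmod h < r)%R -> is_Cseries (fun k => h ^ k * c k) (d h)) ->
  (forall eps, (0 < eps)%R -> exists h, (0 < Cmod h < eps)%R /\ d h = 0) ->
  forall k, c k = 0.
Proof.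
  intros Hr Hd Hz.
  destruct (is_Cseries_terms_bounded _ _ (Hd (r / 2)%R ltac:(rewrite Cmod_R, Rabs_pos_eq; lra))) as [B HB].
  assert (HB' : forall j, (Cmod (c j) * (r / 2) ^ j <= B)%R).
  { intros j. specialize (HB j). rewrite Cmod_mult, Cmod_pow, Cmod_R, Rabs_pos_eq in HB by lra. lra. }
  assert (HB0 : (0 <= B)%R) by (apply Rle_trans with (2 := HB 0%nat), Cmod_ge_0).
  intros k. induction k as [k IH] using (well_founded_induction Wf_nat.lt_wf).
  assert (Est : forall h, (Cmod h < r / 4)%R -> d h = 0 ->
    (Cmod (h ^ k * c k) <= B * (Cmod h / (r / 2)) ^ k * (2 * (Cmod h / (r / 2))))%R).
  { intros h Hh Hdh. set (t := (Cmod h / (r / 2))%R).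
    assert (Ht : (0 <= t <= 1 / 2)%R).
    { split; [apply Rmult_le_pos; [apply Cmod_ge_0|left; apply Rinv_0_lt_compat; lra]|].
      unfold t. apply Rmult_le_reg_r with (r / 2)%R; [lra|]. unfold Rdiv at 1. rewrite Rmult_assoc, Rinv_l; lra. }
    assert (Hterm : forall j, (Cmod (h ^ j * c j) <= B * t ^ j)%R).
    { intros j. rewrite Cmod_mult, Cmod_pow.
      replace (Cmod h ^ j * Cmod (c j))%R with (Cmod (c j) * (r / 2) ^ j * t ^ j)%R.
      - apply Rmult_le_compat_r; [apply pow_le; lra|apply HB'].
      - unfold t. rewrite Rmult_assoc, <- Rpow_mult_distr.
        replace (r / 2 * (Cmod h / (r / 2)))%R with (Cmod h) by (field; lra). ring. }
    assert (Hlow : forall n, (n < k)%nat -> Csum (fun j => (h ^ j * c j)%C) n = RtoC 0).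
    { intros n; induction n as [|n IHn]; intros Hn.
      - rewrite sum_n_0_C, (IH 0%nat Hn). toC; ring.
      - rewrite sum_n_Sm_C, IHn, (IH (S n) Hn) by lia. toC; ring. }
    assert (Hat : Csum (fun j => (h ^ j * c j)%C) k = h ^ k * c k).
    { destruct k as [|k']; [rewrite sum_n_0_C; reflexivity|].
      rewrite sum_n_Sm_C, (Hlow k') by lia. toC; ring. }
    (* For t <= 1/2 the sum t + ... + t^n is at most 2 t - 2 t^(n+1); in this form the induction
       closes. *)
    assert (Hpart : forall n, (Cmod (Csum (fun j => (h ^ j * c j)%C) (k + n)%nat - h ^ k * c k) <=
      B * t ^ k * (2 * t - 2 * t ^ S n))%R).
    { intros n; induction n as [|n IHn].
      - rewrite Nat.add_0_r, Hat. replace (h ^ k * c k - h ^ k * c k) with (RtoC 0) by ring.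
        rewrite Cmod_0, pow_1. right; ring.
      - rewrite Nat.add_succ_r, sum_n_Sm_C.
        replace (Csum (fun j => (h ^ j * c j)%C) (k + n)%nat + h ^ S (k + n) * c (S (k + n)) - h ^ k * c k)
          with ((Csum (fun j => (h ^ j * c j)%C) (k + n)%nat - h ^ k * c k) + h ^ S (k + n) * c (S (k + n)))
          by (apply C_ext; csimpl; ring).
        eapply Rle_trans; [apply Cmod_triangle|].
        apply Rle_trans with (B * t ^ k * (2 * t - 2 * t ^ S n) + B * t ^ S (k + n))%R.
        + apply Rplus_le_compat; [exact IHn|apply Hterm].
        + replace (t ^ S (k + n))%R with (t ^ k * t ^ S n)%R by (rewrite <- pow_add; f_equal; lia).
          assert (HP : (0 <= B * t ^ k * t ^ S n)%R).
          { apply Rmult_le_pos; [apply Rmult_le_pos; [exact HB0|]|]; apply pow_le; lra. }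
          change (t ^ S (S n))%R with (t * t ^ S n)%R. nra. }
    assert (HL := Hd h ltac:(lra)). rewrite Hdh in HL.
    assert (HL' : filterlim (fun n => Csum (fun j => (h ^ j * c j)%C) n + - (h ^ k * c k)) eventually
      (Clocally (0 + - (h ^ k * c k)))).
    { apply filterlim_Cplus; [exact _|exact HL|apply filterlim_const]. }
    rewrite <- (Cmod_opp (h ^ k * c k)), <- (Cplus_0_l (- (h ^ k * c k))).
    apply (filterlim_Cmod_le eventually _ _ _ HL').
    exists k; intros n Hn. replace n with (k + (n - k))%nat by lia.
    eapply Rle_trans; [apply Hpart|].
    apply Rmult_le_compat_l; [apply Rmult_le_pos; [exact HB0|apply pow_le; lra]|].
    pose proof (pow_le t (S (n - k)) ltac:(lra)). lra. }
  apply Cmod_eq_0, Rle_antisym; [|apply Cmod_ge_0]. apply Rnot_lt_le; intros Hck.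
  set (K := (B * (/ (r / 2)) ^ k * (2 * / (r / 2)))%R).
  assert (HK : (0 <= K)%R).
  { assert (0 < / (r / 2))%R by (apply Rinv_0_lt_compat; lra).
    apply Rmult_le_pos; [apply Rmult_le_pos; [exact HB0|apply pow_le; lra]|lra]. }
  destruct (Hz (Rmin (r / 4) (Cmod (c k) / (K + 1)))%R) as (h & Hh & Hdh).
  { apply Rmin_glb_lt; [lra|apply Rdiv_lt_0_compat; lra]. }
  assert (Hh1 : (Cmod h < r / 4)%R) by (apply Rlt_le_trans with (1 := proj2 Hh), Rmin_l).
  assert (Hh2 : (Cmod h < Cmod (c k) / (K + 1))%R) by (apply Rlt_le_trans with (1 := proj2 Hh), Rmin_r).
  specialize (Est h Hh1 Hdh). rewrite Cmod_mult, Cmod_pow in Est.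
  assert (Hhk : (0 < Cmod h ^ k)%R) by (apply pow_lt; lra).
  assert (E2 : (Cmod (c k) <= K * Cmod h)%R).
  { apply Rmult_le_reg_l with (Cmod h ^ k)%R; [exact Hhk|].
    apply Rle_trans with (1 := Est). right. unfold K, Rdiv at 1 3. rewrite Rpow_mult_distr. ring. }
  apply (Rmult_lt_compat_r (K + 1)) in Hh2; [|lra].
  replace (Cmod (c k) / (K + 1) * (K + 1))%R with (Cmod (c k)) in Hh2 by (field; lra). nra.
Qed.

Definition vanishes_near (d : C -> C) (w : C) : Prop :=
  exists r, (0 < r)%R /\ forall w', (Cmod (w' - w) < r)%R -> d w' = 0.

Lemma vanishes_near_cluster_point (D : C -> Prop) (d : C -> C) (w : C) : analytic_on D d -> D w ->
  (forall eps, (0 < eps)%R -> exists w', (0 < Cmod (w' - w) < eps)%R /\ d w' = 0) -> vanishes_near d w.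
Proof.
  intros Hd Hw Hz. destruct (Hd w Hw) as (c & r & Hr & Hc).
  assert (Hs : forall h, (Cmod h < r)%R -> is_Cseries (fun k => h ^ k * c k) (d (w + h))).
  { intros h Hh. apply is_Cseries_pseries. replace h with (w + h - w) at 1 by ring.
    apply Hc. replace (w + h - w) with h by ring. exact Hh. }
  assert (H0 : forall k, c k = 0).
  { apply (pseries_zeros_cluster c r (fun h => d (w + h)) Hr Hs).
    intros eps He. destruct (Hz eps He) as (w' & H1 & H2). exists (w' - w); split; [exact H1|].
    replace (w + (w' - w)) with w' by ring. exact H2. }
  exists r; split; [exact Hr|]. intros w' Hw'.
  assert (H1 := Hs _ Hw'). replace (w + (w' - w)) with w' in H1 by ring.
  apply (is_Cseries_unique _ _ _ H1).
  apply (is_Cseries_ext (fun n => match n with O => RtoC 0 | S _ => RtoC 0 end)); [|apply is_Cseries_head].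
  intros [|n]; rewrite H0; ring.
Qed.

Lemma vanishes_near_open (d : C -> C) (w : C) : vanishes_near d w ->
  exists r, (0 < r)%R /\ forall w', (Cmod (w' - w) < r)%R -> vanishes_near d w'.
Proof.
  intros (r & Hr & H). exists r; split; [exact Hr|]. intros w' Hw'.
  exists (r - Cmod (w' - w))%R; split; [lra|]. intros v Hv. apply H.
  replace (v - w) with ((v - w') + (w' - w)) by ring.
  apply Rle_lt_trans with (1 := Cmod_triangle _ _). lra.
Qed.

(** Connectedness by a supremum T: points before T accumulate at T, so the function vanishes near T
    by [vanishes_near_cluster_point]; openness then carries this beyond T unless T = 1. *)
Lemma vanishes_along_segment (D : C -> Prop) (d : C -> C) (a b : C) : analytic_on D d ->
  (forall t : R, (0 <= t <= 1)%R -> D (a + t * b)) -> vanishes_near d a -> vanishes_near d (a + b).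
Proof.
  intros Hd HD Ha.
  destruct (Ceq_dec b 0) as [->|Hb]; [rewrite Cplus_0_r; exact Ha|].
  apply Cmod_gt_0 in Hb.
  assert (Hdist : forall t u : R, Cmod ((a + t * b) - (a + u * b)) = (Rabs (t - u) * Cmod b)%R).
  { intros t u. rewrite <- Cmod_R, RtoC_minus, <- Cmod_mult. f_equal. ring. }
  set (good t := (0 <= t <= 1)%R /\ forall u : R, (0 <= u <= t)%R -> vanishes_near d (a + u * b)).
  assert (G0 : good 0%R).
  { split; [lra|]. intros u Hu. replace u with 0%R by lra. rewrite Cmult_0_l, Cplus_0_r. exact Ha. }
  destruct (completeness good) as [T [HT1 HT2]].
  { exists 1%R. intros t [Ht _]; lra. }
  { exists 0%R; exact G0. }
  assert (HT : (0 <= T <= 1)%R).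
  { split; [apply HT1, G0|apply HT2]. intros t [Ht _]; lra. }
  assert (Below : forall u, (0 <= u < T)%R -> vanishes_near d (a + u * b)).
  { intros u Hu. destruct (classic (exists t, good t /\ (u < t)%R)) as [(t & [_ Ht] & Hut)|N].
    - apply Ht; lra.
    - assert (T <= u)%R; [|lra]. apply HT2. intros t Ht. apply Rnot_lt_le; intros Hlt. apply N; eauto. }
  assert (VT : vanishes_near d (a + T * b)).
  { destruct (Req_dec T 0) as [->|HT0]; [rewrite Cmult_0_l, Cplus_0_r; exact Ha|].
    apply (vanishes_near_cluster_point D d); [exact Hd|apply HD, HT|].
    intros eps He.
    set (u := (T - Rmin T (eps / (2 * Cmod b)))%R).
    assert (Hm : (0 < Rmin T (eps / (2 * Cmod b)))%R).
    { apply Rmin_glb_lt; [lra|apply Rdiv_lt_0_compat; lra]. }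
    assert (Hm1 : (Rmin T (eps / (2 * Cmod b)) <= T)%R) by apply Rmin_l.
    assert (Hm2 : (Rmin T (eps / (2 * Cmod b)) <= eps / (2 * Cmod b))%R) by apply Rmin_r.
    exists (a + u * b). split.
    - rewrite Hdist. replace (u - T)%R with (- Rmin T (eps / (2 * Cmod b)))%R by (unfold u; ring).
      rewrite Rabs_Ropp, Rabs_pos_eq by lra.
      apply (Rmult_le_compat_r (Cmod b)) in Hm2; [|lra].
      replace (eps / (2 * Cmod b) * Cmod b)%R with (eps / 2)%R in Hm2 by (field; lra). nra.
    - destruct (Below u ltac:(unfold u; lra)) as (r & Hr & H). apply H.
      replace (a + u * b - (a + u * b)) with (RtoC 0) by ring. rewrite Cmod_0; exact Hr. }
  destruct (Rle_lt_dec 1 T) as [H1|H1].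
  { replace T with 1%R in VT by lra. rewrite Cmult_1_l in VT. exact VT. }
  exfalso. destruct (vanishes_near_open d _ VT) as (r & Hr & Hopen).
  set (e := Rmin (1 - T) (r / (2 * Cmod b))).
  assert (He : (0 < e)%R) by (apply Rmin_glb_lt; [lra|apply Rdiv_lt_0_compat; lra]).
  assert (He1 : (e <= 1 - T)%R) by apply Rmin_l.
  assert (He2 : (e <= r / (2 * Cmod b))%R) by apply Rmin_r.
  apply (Rmult_le_compat_r (Cmod b)) in He2; [|lra].
  replace (r / (2 * Cmod b) * Cmod b)%R with (r / 2)%R in He2 by (field; lra).
  assert (good (T + e)%R); [|specialize (HT1 _ H); lra].
  split; [lra|]. intros u Hu. destruct (Rle_lt_dec T u) as [HTu|HTu]; [|apply Below; lra].
  apply Hopen. rewrite Hdist, Rabs_pos_eq by lra.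
  apply Rle_lt_trans with (e * Cmod b)%R; [apply Rmult_le_compat_r; lra|lra].
Qed.

(** * The region and the analytic continuation *)

Lemma region_iff (u v : R) : region (u, v) <-> (2 * cos (2 * PI * u) < exp (2 * PI * v))%R.
Proof.
  unfold region. set (w := 2 * PI * Ci * (u, v)).
  pose proof (Cmod_1mexp_sqr w) as E.
  assert (Ew : Re w = (- (2 * PI * v))%R) by (unfold w; csimpl; ring).
  assert (Ei : Im w = (2 * PI * u)%R) by (unfold w; csimpl; ring).
  rewrite Ew, Ei, Ropp_involutive in E.
  pose proof (exp_pos (2 * PI * v)) as HE. pose proof (Cmod_ge_0 (1 - Cexp (- w))) as H0.
  split; intros H; nra.
Qed.

(** The path rises from 1/2 to height V, moves horizontally above all the humps of the boundary, and
    descends to the target; the descent stays inside because the region is closed under moving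
    up. *)
Lemma analytic_identity_region (d : C -> C) : analytic_on region d ->
  (forall r : R, (0 < r < 1)%R -> region (RtoC r) -> d (RtoC r) = 0) ->
  forall a, region a -> d a = 0.
Proof.
  intros Hd Hz [u v] Ha. pose proof PI_RGT_0.
  assert (Hhalf : forall t : R, region (1 / 2, t)%R).
  { intros t. apply region_iff. replace (2 * PI * (1 / 2))%R with PI by field. rewrite cos_PI.
    pose proof (exp_pos (2 * PI * t)). lra. }
  (* V >= 1 gives e^(2 pi V) > 2, so the whole horizontal line lies in the region; V >= v makes the
     last segment go down. *)
  set (V := Rmax 1 v).
  assert (HV1 : (1 <= V)%R) by apply Rmax_l. assert (HV2 : (v <= V)%R) by apply Rmax_r.
  assert (H1 : vanishes_near d (1 / 2, 0)%R).
  { apply (vanishes_near_cluster_point region d _ Hd (Hhalf 0%R)). intros eps He.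
    (* With e <= 1/6 the point 1/2 + e stays below 1 and has cos (2 pi (1/2 + e)) < 0, hence lies in
       the region. *)
    set (e := (Rmin (1 / 6) (eps / 2))%R).
    assert (He0 : (0 < e)%R) by (apply Rmin_glb_lt; lra).
    assert (He1 : (e <= 1 / 6)%R) by apply Rmin_l. assert (He2 : (e <= eps / 2)%R) by apply Rmin_r.
    exists (RtoC (1 / 2 + e)%R). split.
    - replace (RtoC (1 / 2 + e)%R - (1 / 2, 0)%R) with (RtoC e) by (apply C_ext; csimpl; field).
      rewrite Cmod_R, Rabs_pos_eq; lra.
    - apply Hz; [lra|]. apply region_iff. rewrite Rmult_0_r, exp_0.
      assert (cos (2 * PI * (1 / 2 + e)) < 0)%R; [|lra].
      replace (2 * PI * (1 / 2 + e))%R with (2 * PI * e + PI)%R by field.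
      rewrite neg_cos. assert (0 < cos (2 * PI * e))%R by (apply cos_gt_0; nra). lra. }
  assert (H2 : vanishes_near d (1 / 2, V)%R).
  { replace ((1 / 2)%R, V) with (((1 / 2)%R, 0%R) + (0%R, V)) by (apply C_ext; csimpl; field).
    apply (vanishes_along_segment region); [exact Hd| |exact H1].
    intros t Ht. replace (((1 / 2)%R, 0%R) + t * (0%R, V)) with ((1 / 2)%R, (t * V)%R) by (apply C_ext; csimpl; field).
    apply Hhalf. }
  assert (H3 : vanishes_near d (u, V)).
  { replace (u, V) with (((1 / 2)%R, V) + ((u - 1 / 2)%R, 0%R)) by (apply C_ext; csimpl; field).
    apply (vanishes_along_segment region); [exact Hd| |exact H2].
    intros t Ht. replace (((1 / 2)%R, V) + t * ((u - 1 / 2)%R, 0%R)) with ((1 / 2 + t * (u - 1 / 2))%R, V) by (apply C_ext; csimpl; field).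
    apply region_iff. pose proof (COS_bound (2 * PI * (1 / 2 + t * (u - 1 / 2)))).
    pose proof (exp_ineq1_le (2 * PI * V)). pose proof PI2_3_2. nra. }
  assert (H4 : vanishes_near d (u, v)).
  { replace (u, v) with ((u, V) + (0%R, (v - V)%R)) by (apply C_ext; csimpl; field).
    apply (vanishes_along_segment region); [exact Hd| |exact H3].
    intros t Ht. replace ((u, V) + t * (0%R, (v - V)%R)) with (u, (V + t * (v - V))%R) by (apply C_ext; csimpl; field).
    apply region_iff in Ha. apply region_iff. apply Rlt_le_trans with (1 := Ha).
    apply exp_le_compat. apply Rmult_le_compat_l; [lra|]. nra. }
  destruct H4 as (r & Hr & H4). apply H4.
  replace ((u, v) - (u, v)) with (RtoC 0) by ring. rewrite Cmod_0; exact Hr.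
Qed.

Lemma analytic_minus (D : C -> Prop) (f g : C -> C) : analytic_on D f -> analytic_on D g ->
  analytic_on D (fun a => f a + - (1) * g a).
Proof.
  intros Hf Hg a0 Ha0. destruct (Hf a0 Ha0) as (c & r & Hr & Hc), (Hg a0 Ha0) as (c' & r' & Hr' & Hc').
  exists (fun k => c k + - (1) * c' k), (Rmin r r'). split; [apply Rmin_glb_lt; assumption|].
  intros a Ha. apply (proj1 (is_Cseries_pseries _ _ _)).
  apply (is_Cseries_ext (fun k => (a - a0) ^ k * c k + - (1) * ((a - a0) ^ k * c' k))); [intros; ring|].
  apply is_Cseries_plus; [|apply is_Cseries_scal]; apply (proj2 (is_Cseries_pseries _ _ _));
  [apply Hc, Rlt_le_trans with (1 := Ha), Rmin_l|apply Hc', Rlt_le_trans with (1 := Ha), Rmin_r].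
Qed.

(** [F] itself shows that the choice in [continuation] is not vacuous; the identity theorem shows
    that any choice agrees with [F] on the region. *)
Lemma continuation_region (F : C -> C) (f0 : R -> C) : analytic_on region F ->
  (forall r : R, (0 < r < 1)%R -> region (RtoC r) -> F (RtoC r) = f0 r) ->
  forall a, region a -> continuation region f0 a = F a.
Proof.
  intros HF Hf0 a Ha. unfold continuation.
  destruct (epsilon_spec (inhabits (fun _ : C => RtoC 0))
    (fun f : C -> C => analytic_on region f /\
       forall r : R, (0 < r < 1)%R -> region (RtoC r) -> f (RtoC r) = f0 r)
    (ex_intro _ F (conj HF Hf0))) as [H1 H2].
  set (f := epsilon _ _) in *.
  assert (E : f a + - (1) * F a = 0).
  { apply (analytic_identity_region (fun a => f a + - (1) * F a)); [apply analytic_minus; assumption| |exact Ha].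
    intros r Hr Hreg. rewrite H2, Hf0 by assumption. ring. }
  transitivity (f a + - (1) * F a + F a); [ring|rewrite E; ring].
Qed.

(** * The value of B on the region *)

Lemma x_of_E (z : C) (theta : R) :
  x_of z theta = (1 / 2 - theta / (2 * PI), ln (Cmod z) / (2 * PI))%R.
Proof.
  pose proof PI_RGT_0. unfold x_of.
  replace (lnz z theta) with ((theta / (2 * PI), - (ln (Cmod z) / (2 * PI)))%R * (2 * PI * Ci)).
  - transitivity (1 / 2 - (theta / (2 * PI), - (ln (Cmod z) / (2 * PI)))%R).
    + field. split; [apply Ci_nz|apply RtoC_PI_neq_0].
    + apply C_ext; csimpl; field; lra.
  - unfold lnz. apply C_ext; csimpl; field; lra.
Qed.

(** The principal argument of 2 pi i is pi/2, the angle by which [B_loop_scale] rotates. *)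
Lemma Cpow_principal_2_pi_i (b : C) :
  Cpow_principal (2 * PI * Ci) b = Cexp (b * (ln (2 * PI), (PI / 2)%R)).
Proof.
  pose proof PI_RGT_0. unfold Cpow_principal, Clog. do 2 f_equal.
  assert (HM : Cmod (2 * PI * Ci) = (2 * PI)%R).
  { rewrite !Cmod_mult, Cmod_Ci, !Cmod_R, (Rabs_pos_eq 2), (Rabs_pos_eq PI) by lra. ring. }
  f_equal; [rewrite HM; reflexivity|].
  unfold Carg. destruct (Rle_dec 0 (Im (2 * PI * Ci))) as [_|N].
  - replace (Re (2 * PI * Ci)) with 0%R by (csimpl; ring). unfold Rdiv. rewrite Rmult_0_l, acos_0. reflexivity.
  - exfalso; apply N. csimpl. nra.
Qed.

Section Value.
Context (z : C) (theta : R) (s : C).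
Hypothesis Hz : (1 < Cmod z)%R.
Hypothesis Ht : (- PI <= theta <= PI)%R.

Let x := x_of z theta.

Lemma Re_x : (0 <= Re x)%R.
Proof.
  unfold x; rewrite x_of_E; csimpl. pose proof PI_RGT_0.
  apply Rmult_le_reg_r with (2 * PI)%R; [lra|].
  replace ((1 / 2 - theta / (2 * PI)) * (2 * PI))%R with (PI - theta)%R by (field; lra). lra.
Qed.

Lemma Im_x : (0 < Im x)%R.
Proof.
  unfold x; rewrite x_of_E; csimpl. pose proof PI_RGT_0. apply Rdiv_lt_0_compat; [|lra].
  rewrite <- ln_1. apply ln_increasing; lra.
Qed.

(** A choice makes the sum a total function of q; its value is meaningful for |q| < 1. *)
Definition p_gen (q : C) : C :=
  epsilon (inhabits (RtoC 0)) (fun l => is_Cseries (fun n => q ^ n * p n x s) l).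

Lemma p_gen_spec (q : C) : (Cmod q < 1)%R -> is_Cseries (fun n => q ^ n * p n x s) (p_gen q).
Proof.
  intros Hq. unfold p_gen. apply epsilon_spec.
  destruct (p_series x s Re_x Im_x q Hq) as (phi & _ & H).
  eexists. apply (H (1 / 2)%R). lra.
Qed.

(** The right-hand side of the theorem: since q - 1 = 1 / (E - 1), the terms E^n / (E - 1)^(n+1) are
    (q - 1) q^n. *)
Definition B_value (a : C) : C :=
  Cexp (PI * Ci * a) * Cpow_principal (2 * PI * Ci) (s - 1) / zpow z theta a *
  ((ratio a - 1) * p_gen (ratio a)).

Lemma E_minus_1_neq_0 (a : C) : region a -> Cexp (2 * PI * Ci * a) - 1 <> 0.
Proof.
  intros Ha E. apply (region_denom a Ha). rewrite Cexp_opp.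
  replace (Cexp (2 * PI * Ci * a)) with (Cexp (2 * PI * Ci * a) - 1 + 1) by ring.
  rewrite E. field.
Qed.

Lemma ratio_E (a : C) : region a ->
  ratio a = Cexp (2 * PI * Ci * a) / (Cexp (2 * PI * Ci * a) - 1) /\
  ratio a - 1 = / (Cexp (2 * PI * Ci * a) - 1).
Proof.
  intros Ha. pose proof (E_minus_1_neq_0 a Ha) as HE. pose proof (Cexp_neq_0 (2 * PI * Ci * a)) as H0.
  unfold ratio. rewrite Cexp_opp. set (E := Cexp (2 * PI * Ci * a)) in *. clearbody E.
  split; field; repeat split; assumption.
Qed.

Lemma B_value_series (a : C) : region a ->
  is_Cseries (fun n : nat => Cexp (2 * PI * Ci * a * INR n)
            / (Cexp (2 * PI * Ci * a) - 1) ^ (n + 1) * p n x s) ((ratio a - 1) * p_gen (ratio a)).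
Proof.
  intros Ha. destruct (ratio_E a Ha) as [E1 E2]. pose proof (E_minus_1_neq_0 a Ha) as HE.
  apply (is_Cseries_ext (fun n => (ratio a - 1) * (ratio a ^ n * p n x s))).
  - intros n. rewrite E2, E1, Cexp_INR, Cpow_add_r, Cpow_1_r. unfold Cdiv at 1.
    rewrite Cpow_mult_l, Cpow_inv by exact HE. field.
    split; [exact HE|apply Cpow_nz, HE].
  - apply is_Cseries_scal, p_gen_spec, Cmod_ratio_lt_1, Ha.
Qed.

Lemma B_value_real (a : R) : (0 < a < 1)%R -> region a -> B_value a = B_integral z theta s a.
Proof.
  intros Ha Hreg. destruct (ratio_E a Hreg) as [E1 E2]. pose proof (E_minus_1_neq_0 a Hreg) as HE.
  pose proof PI_RGT_0.
  destruct (p_series x s Re_x Im_x (ratio a) (Cmod_ratio_lt_1 a Hreg)) as (phi & Hphi & Hser).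
  assert (Hm : (0 < PI * Rmin a (1 - a))%R) by (apply Rmult_lt_0_compat; [lra|apply Rmin_glb_lt; lra]).
  (* The bound 1/2 ensures |1 - e^(-tau)| <= 1 on the circle, the other one keeps the poles
     outside. *)
  set (d := Rmin (1 / 2) (PI * Rmin a (1 - a))).
  assert (Hd : (0 < d)%R) by (apply Rmin_glb_lt; lra).
  assert (Hd1 : (d <= 1 / 2)%R) by apply Rmin_l.
  assert (Hd2 : (d <= PI * Rmin a (1 - a))%R) by apply Rmin_r.
  assert (HL := is_Cseries_unique _ _ _ (p_gen_spec (ratio a) (Cmod_ratio_lt_1 a Hreg)) (Hser d ltac:(lra))).
  unfold B_integral.
  rewrite (B_loop_scale x s a Re_x Im_x Ha z theta eq_refl).
  rewrite (h_loop_deform x s a Re_x Im_x Ha phi d Hphi ltac:(lra)).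
  rewrite (h_loop_normalize x s a Re_x Im_x Ha (ratio a) phi d HE E1 Hphi ltac:(lra)).
  rewrite <- HL, <- E2. unfold B_value. rewrite Cpow_principal_2_pi_i.
  unfold zpow. replace (- a * lnz z theta) with (- (a * lnz z theta)) by ring. rewrite Cexp_opp.
  unfold Cdiv. ring.
Qed.

(** The norm M < 1 of q leaves room for some rho > 1 with rho M < 1, which absorbs the growth p_n =
    O(rho^n). *)
Lemma B_value_analytic : analytic_on region B_value.
Proof.
  apply is_PS_analytic. intros a0 Ha0.
  destruct (is_PS_ratio a0 Ha0) as (r & M & Hr & HM & Hq).
  assert (HM0 := is_PS_M_pos r M _ ltac:(lra) Hq).
  destruct (exists_gt_1_mult_lt_1 M (conj HM0 HM)) as (rho & H1 & H2).
  destruct (p_bound x s Re_x Im_x rho H1) as [K HK].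
  assert (HP : is_PS r (K / (1 - rho * M)) (fun h => p_gen (ratio (a0 + h)))).
  { apply (is_PS_comp_series r M 0 K rho (fun h => ratio (a0 + h)) (fun n => p n x s)); try assumption; try lra.
    intros h Hh. apply p_gen_spec. pose proof (is_PS_bound r M _ h Hq Hh) as B. cbv beta in B. lra. }
  (* Combines e^(pi i a) and z^(-a) into the single exponential e^(k a). *)
  set (k := PI * Ci - lnz z theta).
  assert (HS := is_PS_scal r _ (Cpow_principal (2 * PI * Ci) (s - 1) * Cexp (k * a0)) _
    (is_PS_mult r _ _ _ _ Hr (is_PS_exp r k ltac:(lra))
      (is_PS_mult r _ _ _ _ Hr (is_PS_plus r _ _ _ _ ltac:(lra) Hq (is_PS_const r (- (1)))) HP))).
  exists r. eexists. split; [exact Hr|]. refine (is_PS_ext _ _ _ _ _ HS).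
  intros h Hh. unfold B_value, zpow, Cdiv. rewrite <- Cexp_opp.
  assert (EX : Cexp (k * a0) * Cexp (k * h) = Cexp (PI * Ci * (a0 + h)) * Cexp (- ((a0 + h) * lnz z theta))).
  { rewrite <- 2!Cexp_plus. f_equal. unfold k. ring. }
  transitivity (Cpow_principal (2 * PI * Ci) (s - 1) * (Cexp (k * a0) * Cexp (k * h)) *
    ((ratio (a0 + h) + - (1)) * p_gen (ratio (a0 + h)))); [ring|].
  rewrite EX. unfold Cminus. ring.
Qed.

(** Real values in (0, 1) are given by the integral, all others by the continuation; the same
    function [B_value] gives both. *)
Lemma B_eq_value (a : C) : region a -> B z theta s a = B_value a.
Proof.
  intros Ha. unfold B. destruct (excluded_middle_informative _) as [[H0 H1]|_].
  - assert (E : a = RtoC (Re a)) by (apply C_ext; [reflexivity|rewrite H1; reflexivity]).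
    rewrite E at 2. symmetry; apply B_value_real; [exact H0|rewrite <- E; exact Ha].
  - apply continuation_region; [exact B_value_analytic| |exact Ha].
    intros r Hr Hreg; apply B_value_real; assumption.
Qed.

End Value.

Theorem mainTheorem3 :
  (forall a : R, (1 / 6 < a < 5 / 6)%R ->
     (1 < Cmod (1 - Cexp (- (2 * PI * Ci * a))))%R) /\
  (forall (a s z : C) (theta : R),
     (1 < Cmod (1 - Cexp (- (2 * PI * Ci * a))))%R ->
     (1 < Cmod z)%R ->
     in_closed_sector z theta ->
     exists l : C,
       is_series (K := C_AbsRing) (V := C_NormedModule)
         (fun n : nat =>
            Cexp (2 * PI * Ci * a * INR n)
            / (Cexp (2 * PI * Ci * a) - 1) ^ (n + 1)
            * p n (x_of z theta) s) l /\
       B z theta s a =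
         Cexp (PI * Ci * a) * Cpow_principal (2 * PI * Ci) (s - 1)
         / zpow z theta a * l).
Proof.
  split.
  - intros a Ha. apply (region_iff a 0). pose proof PI_RGT_0. rewrite Rmult_0_r, exp_0.
    (* The bounds 1/6 and 5/6 are where cos (2 pi a) = 1/2; the half of the interval above 1/2 is
       reflected onto the other. *)
    assert (cos (2 * PI * a) < cos (PI / 3))%R; [|rewrite cos_PI3 in *; lra].
    destruct (Rle_lt_dec a (1 / 2)).
    + apply cos_decreasing_1; nra.
    + replace (cos (2 * PI * a)) with (cos (2 * PI - 2 * PI * a)).
      * apply cos_decreasing_1; nra.
      * rewrite cos_minus, cos_2PI, sin_2PI. ring.
  - intros a s z theta Ha Hz [Ht _].
    exists ((ratio a - 1) * p_gen z theta s (ratio a)). split.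
    + apply B_value_series; assumption.
    + apply B_eq_value; assumption.
Qed.
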